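(* Let $\alpha>1$. The horocyclic Bergman projection $P_\alpha$ is of weak type $(1,1)$ and extends to a bounded operator on $L^p_\alpha$ for all $1<p<\infty$. Furthermore, it extends to a bounded operator from $H^1_\alpha$ to $L^1_\alpha$ and from $L^\infty_\alpha$ to $BMO_\alpha$.
   Context: Tree. Let $q\ge 2$ be an integer and let $\mathfrak X$ be (the vertex set of) the $q$-homogeneous tree: the connected graph without cycles in which every vertex has exactly $q+1$ neighbours ($x\sim y$ means $x,y$ are neighbours); $d$ is the edge-counting distance, $\mathbb N=\{0,1,2,\dots\}$. An infinite chain is a sequence $(x_i)_{i\in\mathbb N}$ with $x_i\sim x_{i+1}$ and $x_i\ne x_{i+2}$; two infinite chains $(x_i),(y_j)$ are equivalent if for some $m\in\mathbb Z$ one has $x_i=y_{i+m}$ eventually; a boundary point is an equivalence class. Fix a boundary point $\omega$. For $x\in\mathfrak X$, $[x,\omega)$ is the infinite chain starting at $x$ in the class $\omega$ and $x\wedge y$ is the vertex $z$ with $[x,\omega)\cap[y,\omega)=[z,\omega)$. Vertices $x,y$ lie on the same horocycle if $d(x,x\wedge y)=d(y,x\wedge y)$. Fix a horocycle $H_0$ and, for $k\in\mathbb Z$, let $H_k=\{x: d(x,x\wedge y)=d(y,x\wedge y)+k \text{ for some } y\in H_0\}$; the $H_k$ partition $\mathfrak X$. The horocyclic index $h(x)$ is the integer with $x\in H_{h(x)}$. $U_x=\{y:[x,\omega)\subseteq[y,\omega)\}$ is the sector generated by $x$. Spaces. For $\alpha>1$ let $\sigma_\alpha$ be the measure on $\mathfrak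 X$ with $\sigma_\alpha(x)=q^{-\alpha h(x)}$, and $L^p_\alpha=L^p(\mathfrak X,\sigma_\alpha)$ with norm $\|\cdot\|_{p,\alpha}$. $f:\mathfrak X\to\mathbb C$ is harmonic if $f(x)=\frac1{q+1}\sum_{y\sim x}f(y)$ for all $x$. $\mathcal B^2_\alpha$ is the closed subspace of harmonic functions in $L^2_\alpha$, a reproducing kernel Hilbert space with inner product $\langle f,g\rangle=\sum_x f(x)\overline{g(x)}\sigma_\alpha(x)$, and $P_\alpha$ (the horocyclic Bergman projection) is the orthogonal projection of $L^2_\alpha$ onto $\mathcal B^2_\alpha$. Let $\mathcal D=\{U_x,\{x\}: x\in\mathfrak X\}$. A $(1,\infty)$-atom is a function $a:\mathfrak X\to\mathbb C$ which is supported in some $D\in\mathcal D$, with $\|a\|_{\infty,\alpha}\le\sigma_\alpha(D)^{-1}$ and $\sum_{x\in D}a(x)q^{-\alpha h(x)}=0$. $H^1_\alpha$ is the space of $f\in L^1_\alpha$ of the form $f=\sum_i\lambda_ia_i$ with $a_i$ $(1,\infty)$-atoms and $(\lambda_i)$ a summable complex sequence, with norm the infimum of $\sum_i|\lambda_i|$ over all such representations. $BMO_\alpha$ is the space, modulo constant functions, of $f:\mathfrak X\to\mathbb C$ such that $$\|f\|_{BMO_\alpha}=\sup_{D\in\mathcal D}\frac1{\sigma_\alpha(D)}\sum_{x\in D}|f(x)-f_D|q^{-\alpha h(x)}<\infty,\qquad f_D=\frac1{\sigma_\alpha(D)}\sum_{x\in D}f(x)q^{-\alpha h(x)}.$$ Terminology.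 $P_\alpha$ is of weak type $(1,1)$ if there is $C>0$ such that $\sigma_\alpha(\{x:|P_\alpha f(x)|>\lambda\})\le C\|f\|_{1,\alpha}/\lambda$ for all $\lambda>0$ and $f\in L^1_\alpha\cap L^2_\alpha$. $P_\alpha$ extends to a bounded operator from $E$ to $F$ (on $E$, if $F=E$) if there is a bounded linear operator $E\to F$ which coincides with $P_\alpha$ on $E\cap L^2_\alpha$. *)

(* Defs.v *)
(* MathComp + MathComp-Analysis. *)
From HB Require Import structures.
From mathcomp Require Import all_boot all_order all_algebra.
From mathcomp Require Import complex.
From mathcomp Require Import all_classical all_reals all_analysis.

Set Implicit Arguments.
Unset Strict Implicit.
Unset Printing Implicit Defensive.

Import Order.TTheory GRing.Theory Num.Theory.
Import numFieldNormedType.Exports.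

Local Open Scope classical_set_scope.
Local Open Scope ring_scope.
Local Open Scope complex_scope.

Section Tree.
Context {T : choiceType}.
Implicit Types (adj : rel T) (x y z : T) (c : nat -> T).

Definition homogeneous_tree (q : nat) adj : Prop :=
  [/\ irreflexive adj,
      symmetric adj,
      forall x y, exists p : seq T, path adj x p /\ last x p = y,
      forall p : seq T, (2 < size p)%N -> ~ ucycle adj p
    & forall x, ([set y | adj x y] #= `I_q.+1)%card].

Definition path_lengths adj x y : set nat :=
  [set n | exists p : seq T, [/\ path adj x p, last x p = y & size p = n]].

Definition dist adj x y : nat :=
  xget 0%N [set n | path_lengths adj x y n /\
                    forall m, path_lengths adj x y m -> (n <= m)%N].

Definition chain adj : set (nat -> T) :=
  [set c | forall i : nat, adj (c i) (c i.+1) /\ c i <> c i.+2].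

(* For i large, i + m is nonnegative, so the absolute value is immaterial. *)
Definition chain_equiv c c' : Prop :=
  exists m : int, \forall i \near \oo, c i = c' (absz (i%:Z + m)).

Definition boundary_point adj (omega : set (nat -> T)) : Prop :=
  exists2 c, chain adj c & omega = [set c' | chain adj c' /\ chain_equiv c c'].

(* The functions below, defined by choice, take arbitrary values only when the
   characterised object does not exist, which does not occur in a homogeneous
   tree with omega a boundary point and H0 a horocycle. *)

Definition ray (omega : set (nat -> T)) x : nat -> T :=
  xget (fun=> x) [set c | omega c /\ c 0%N = x].

Definition ray_set (omega : set (nat -> T)) x : set T := range (ray omega x).

Definition meet_pt (omega : set (nat -> T)) x y : T :=
  xget x [set z | ray_set omega x `&` ray_set omega y = ray_set omega z].

Definition same_horocycle adj omega x y : Prop :=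
  dist adj x (meet_pt omega x y) = dist adj y (meet_pt omega x y).

Definition horocycle adj omega (H : set T) : Prop :=
  exists x, H = [set y | same_horocycle adj omega x y].

Definition horocycle_at adj omega (H0 : set T) (k : int) : set T :=
  [set x | exists2 y, H0 y &
     (dist adj x (meet_pt omega x y))%:Z =
     (dist adj y (meet_pt omega x y))%:Z + k].

Definition horo_index adj omega (H0 : set T) x : int :=
  xget 0 [set k | horocycle_at adj omega H0 k x].

Definition sector omega x : set T :=
  [set y | ray_set omega x `<=` ray_set omega y].

(* The family of all sectors and all singletons. *)
Definition sectors_and_points omega : set (set T) :=
  [set D | exists x, D = sector omega x \/ D = [set x]].

Definition horo_weight (R : realType) (q : nat) adj omega (H0 : set T)
    (alpha : R) x : R :=
  q%:R `^ (- (alpha * (horo_index adj omega H0 x)%:~R)).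

Definition harmonic_function (R : realType) (q : nat) adj (f : T -> R[i]) : Prop :=
  forall x, f x = (q.+1%:R)^-1 * \sum_(y \in [set y | adj x y]) f y.

End Tree.

(* Throughout, w x is the mass of the point x; when every mass is positive,
   equality almost everywhere is equality and the essential supremum is the
   supremum. *)
Section Spaces.
Context {R : realType} {T : choiceType}.
Implicit Types (w : T -> R) (D : set T) (f g : T -> R[i]).

Local Notation cnorm := (@Normc.normc R).

Definition mass w D : \bar R := (\esum_(x in D) (w x)%:E)%E.

(* Sums of absolutely summable families. *)
Definition rsum D (u : T -> R) : R :=
  fine (\esum_(x in D) ((EFin \o u)^\+ x))%E -
  fine (\esum_(x in D) ((EFin \o u)^\- x))%E.

Definition csum D f : R[i] :=
  rsum D (fun x => complex.Re (f x)) +i* rsum D (fun x => complex.Im (f x)).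

Definition Lp_norm w (p : R) f : \bar R :=
  ((\esum_(x in [set: T]) (cnorm (f x) `^ p * w x)%:E) `^ p^-1)%E.

Definition Linfty_norm f : \bar R :=
  ereal_sup [set (cnorm (f x))%:E | x in [set: T]].

Definition inner w f g : R[i] :=
  csum [set: T] (fun x => f x * conjc (g x) * (w x)%:C).

(* A space of functions, or of classes of functions modulo fs_eqv. *)
Record fspace := FSpace {
  fs_dom : set (T -> R[i]);
  fs_norm : (T -> R[i]) -> \bar R;
  fs_eqv : (T -> R[i]) -> (T -> R[i]) -> Prop }.

Definition Lp w (p : R) : fspace :=
  FSpace [set f | (Lp_norm w p f < +oo)%E] (Lp_norm w p) eq.

Definition Linfty : fspace :=
  FSpace [set f | (Linfty_norm f < +oo)%E] Linfty_norm eq.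

Definition bergman2 (q : nat) (adj : rel T) w : set (T -> R[i]) :=
  [set f | harmonic_function q adj f /\ fs_dom (Lp w 2) f].

(* P is unconstrained outside L^2. *)
Definition orthogonal_projection w (B : set (T -> R[i]))
    (P : (T -> R[i]) -> T -> R[i]) : Prop :=
  forall f, fs_dom (Lp w 2) f ->
    B (P f) /\ forall g, B g -> inner w (fun x => f x - P f x) g = 0.

Definition atom (w : T -> R) (Ds : set (set T)) (a : T -> R[i]) : Prop :=
  exists2 D, Ds D &
    [/\ forall x, ~ D x -> a x = 0,
        (Linfty_norm a <= ((fine (mass w D))^-1)%:E)%E
      & csum D (fun x => a x * (w x)%:C) = 0].

(* The series converges in L^1 (equivalently pointwise, atoms being bounded
   by 1 in L^1). *)
Definition atomic_decomposition w (Ds : set (set T)) f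
    (lam : nat -> R[i]) (a : nat -> T -> R[i]) : Prop :=
  [/\ forall i, atom w Ds (a i),
      (\sum_(0 <= i <oo) (cnorm (lam i))%:E < +oo)%E
    & Lp_norm w 1 (fun x => f x - \sum_(i < n) lam i * a i x)
        @[n --> \oo] --> 0%E].

Definition H1_norm w (Ds : set (set T)) f : \bar R :=
  ereal_inf [set r | exists lam a, atomic_decomposition w Ds f lam a /\
                       r = (\sum_(0 <= i <oo) (cnorm (lam i))%:E)%E].

Definition H1 w (Ds : set (set T)) : fspace :=
  FSpace [set f | fs_dom (Lp w 1) f /\
                  exists lam a, atomic_decomposition w Ds f lam a]
         (H1_norm w Ds) eq.

Definition mean w D f : R[i] :=
  ((fine (mass w D))^-1)%:C * csum D (fun x => f x * (w x)%:C).

(* If f is not summable on D, the mean is a junk value, but the norm is then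
   infinite whatever this value is, as D has finite mass. *)
Definition BMO_norm w (Ds : set (set T)) f : \bar R :=
  ereal_sup [set (((fine (mass w D))^-1)%:E *
                  \esum_(x in D) (cnorm (f x - mean w D f) * w x)%:E)%E
            | D in Ds].

Definition BMO w (Ds : set (set T)) : fspace :=
  FSpace [set f | (BMO_norm w Ds f < +oo)%E] (BMO_norm w Ds)
         (fun f g => exists k : R[i], forall x, f x = g x + k).

Definition weak_type11 w (P : (T -> R[i]) -> T -> R[i]) : Prop :=
  exists2 C : R, 0 < C &
    forall (lambda : R) f, 0 < lambda ->
      fs_dom (Lp w 1) f -> fs_dom (Lp w 2) f ->
      (mass w [set x | (lambda < cnorm (P f x))%R]
         <= (C / lambda)%:E * Lp_norm w 1 f)%E.

(* Values of S are representatives when F is a space of classes. *)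
Definition bounded_linear (E F : fspace) (S : (T -> R[i]) -> T -> R[i]) : Prop :=
  [/\ forall f, fs_dom E f -> fs_dom F (S f),
      forall (k : R[i]) f g, fs_dom E f -> fs_dom E g ->
        fs_eqv F (S (fun x => k * f x + g x)) (fun x => k * S f x + S g x)
    & exists C : R, forall f, fs_dom E f ->
        (fs_norm F (S f) <= C%:E * fs_norm E f)%E].

Definition extends_bounded w (P : (T -> R[i]) -> T -> R[i]) (E F : fspace)
    : Prop :=
  exists2 S, bounded_linear E F S &
    forall f, fs_dom E f -> fs_dom (Lp w 2) f -> fs_eqv F (S f) (P f).

End Spaces.
Arguments Linfty {R T}.

(* Main.v *)
Require Import Defs.
From mathcomp Require Import all_boot all_order all_algebra.
From mathcomp Require Import complex.
From mathcomp Require Import all_classical all_reals all_analysis.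
From mathcomp Require Import ring lra zify.

(** The boundary point gives every vertex [x] a parent [par x], its neighbour in
    the direction of the boundary point, and the sector of [x] is the set of its
    descendants. With [scale = q ^ (- h)] the measure is [scale ^ alpha]; since
    [alpha > 1], the generations of a sector have geometrically decreasing
    masses, and the mass of a sector is a constant times the weight of its
    vertex ([sec_pow]).

    The projection is made explicit first. For a harmonic function [g], the
    gradient [grad g x = g x - g (par x)] is a flux: its sum over the children
    of [x] is its value at [x]. So the means of [g] over the generations below
    [x] are determined by [g x] and [grad g x] ([sum_desc_harmonic]). To each
    vertex [u] corresponds a wavelet, an element of the Bergman space supported
    in the sector of [par u], and by the previous remark the inner product of
    [g] with it is a multiple of [grad g u - grad g (par u) / q]
    ([coef_harmonic]). Summed along the ray from [x] with suitable weights,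
    these combinations telescope to [g x], because a square summable function
    tends to 0 along a ray ([berg_reproducing]). As [f - P f] is orthogonal to
    the wavelets, [P f] is given by the same series in the wavelet coefficients
    of [f] ([proj_berg]); this series, called [berg], converges far beyond
    [L^2] and provides the extensions.

    The size of the wavelets bounds [berg f] by a constant times the sum of the
    averages of the modulus of [f] over the sectors of all the ancestors
    ([anc_avg], [berg_bound]). This positive operator has the eigenfunctions
    [scale ^ (- s)] for [0 < s < alpha - 1], so Schur's test bounds it on [L^p]
    for [1 < p] ([anc_avg_Lp]). It is also of weak type (1,1)
    ([anc_avg_weak]): if the mass of [f] in each maximal sector of large average
    is concentrated at the vertex of that sector, the new function is bounded,
    the operator does not change outside the maximal sectors, and the [L^2]
    bound applies.

    Cancellation enters only for [H^1]. If [a] is an atom of the sector of [z],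
    then on that sector a wavelet of support much larger than the sector is a
    constant plus a small multiple of [scale], and the mean value zero of [a]
    removes the constant ([sector_atom_coef]). Together with the bound by
    [anc_avg] on the sector itself, this bounds [berg a] in [L^1] uniformly
    ([sector_atom_bound]).

    For bounded [f] the series of [berg] may diverge, but the one of its
    gradient converges to a bounded function ([berg_grad_bound]). Integrating it
    from a base point gives the extension up to constants, and a function of
    bounded gradient is in [BMO] because the mean distance from the vertex of
    a sector to its points is bounded ([gradient_BMO]). *)

Set Implicit Arguments.
Unset Strict Implicit.
Unset Printing Implicit Defensive.

Import Order.TTheory GRing.Theory Num.Theory.
Import numFieldNormedType.Exports.

Local Open Scope classical_set_scope.
Local Open Scope ring_scope.
Local Open Scope complex_scope.

Local Notation cnorm := Normc.normc.

(** * Sums of families of extended nonnegative reals *)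

Section NonnegativeSums.
Context {R : realType}.
Local Open Scope ereal_scope.

Lemma esum_seq (T : choiceType) (s : seq T) (a : T -> \bar R) :
  uniq s -> (forall y, 0 <= a y) ->
  \esum_(y in [set` s]) a y = \sum_(y <- s) a y.
Proof. by move=> us a0; rewrite esum_fset// -fsbig_seq. Qed.

Lemma le_esum_set (T : choiceType) (A B : set T) (a : T -> \bar R) :
  A `<=` B -> (forall y, B y -> 0 <= a y) ->
  \esum_(y in A) a y <= \esum_(y in B) a y.
Proof.
move=> AB a0; rewrite (esumID A B)// (_ : B `&` A = A); last first.
  by apply/seteqP; split => [x []//|x Ax]; split=> //; exact: AB.
by rewrite leeDl//; apply: esum_ge0 => x [Bx _]; exact: a0.
Qed.

Lemma esum_ge_term (T : choiceType) (A : set T) (a : T -> \bar R) x :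
  (forall y, A y -> 0 <= a y) -> A x -> a x <= \esum_(y in A) a y.
Proof.
move=> a0 Ax; rewrite -(@esum_set1 _ _ x a) ?a0//.
by apply: le_esum_set => // _ ->.
Qed.

Lemma esum_eq_supp (T : choiceType) (A B : set T) (a : T -> \bar R) :
  A `<=` B -> (forall y, B y -> 0 <= a y) ->
  (forall y, B y -> ~ A y -> a y = 0) ->
  \esum_(y in A) a y = \esum_(y in B) a y.
Proof.
move=> AB a0 az; rewrite (esumID A B)// (_ : B `&` A = A); last first.
  by apply/seteqP; split => [x []//|x Ax]; split=> //; exact: AB.
by rewrite [X in _ + X]esum1 ?adde0// => x [Bx Ax]; exact: az.
Qed.

Lemma esumZl (T : choiceType) (A : set T) (a : T -> \bar R) (c : R) :
  (0 <= c)%R -> (forall y, A y -> 0 <= a y) ->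
  \esum_(y in A) (c%:E * a y) = c%:E * \esum_(y in A) a y.
Proof.
have half (b : T -> \bar R) (k : R) : (0 < k)%R ->
    (forall y, A y -> 0 <= b y) ->
    \esum_(y in A) (k%:E * b y) <= k%:E * \esum_(y in A) b y.
  move=> k0 b0; rewrite [X in X <= _]/esum ge_ereal_sup => //= _ [X [finX XA]] <-.
  rewrite fsbig_finite//= big_seq -ge0_sume_distrr -?big_seq; last first.
    by move=> i; rewrite in_fset_set// inE => /XA/b0.
  rewrite lee_pmul2l//; apply: esum_ge; exists X => //.
  by rewrite fsbig_finite.
move=> + a0; rewrite le_eqVlt => /predU1P[<-|c0].
  by rewrite mul0e esum1// => x _; rewrite mul0e.
apply/eqP; rewrite eq_le half//=.
rewrite -lee_pdivlMl//.
have ca0 y : A y -> 0 <= c%:E * a y by move=> Ay; rewrite mule_ge0 ?a0// lee_fin ltW.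
have ci : (0 < c^-1)%R by rewrite invr_gt0.
apply: le_trans (half _ _ ci ca0); apply: le_esum => y Ay.
by rewrite muleA -EFinM mulVf ?gt_eqF// mul1e.
Qed.

Lemma esumZl_ereal (T : choiceType) (A : set T) (a : T -> \bar R) (c : \bar R) :
  0 <= c -> (forall y, A y -> 0 <= a y) ->
  \esum_(y in A) (c * a y) = c * \esum_(y in A) a y.
Proof.
move=> + a0; case: c => [c|_|//]; first by rewrite lee_fin => c0; exact: esumZl.
have [a1|/existsNP[x /not_implyP[Ax ax]]] := pselect (forall y, A y -> a y = 0).
  rewrite (esum1 a1) mule0 esum1// => y Ay; by rewrite a1 ?mule0.
have xpos : 0 < a x by rewrite lt_neqAle eq_sym a0// andbT; apply/eqP.
rewrite [RHS]gt0_mulye; last exact: lt_le_trans xpos (esum_ge_term a0 Ax).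
apply/eqP; rewrite -leye_eq -[X in X <= _](gt0_mulye xpos).
by apply: (esum_ge_term (a := fun y => +oo * a y)) => // y Ay; rewrite mule_ge0 ?a0.
Qed.

(** Tonelli's theorem for a double sum over a relation. It is mostly
    used to enumerate the pairs made of a vertex and one of its ancestors, by
    descendants or by ancestors. *)
Lemma esum_swap (T1 T2 : choiceType) (I : set T1) (J : T1 -> set T2)
    (I' : T2 -> set T1) (J' : set T2) (a : T1 -> T2 -> \bar R) :
  (forall i j, I i /\ J i j <-> J' j /\ I' j i) ->
  (forall i j, I i -> J i j -> 0 <= a i j) ->
  \esum_(i in I) \esum_(j in J i) a i j =
  \esum_(j in J') \esum_(i in I' j) a i j.
Proof.
move=> IJ a0; rewrite !esum_esum//; last first.
  by move=> j i J'j I'i; have [] := (IJ i j).2 (conj J'j I'i); exact: a0.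
rewrite (reindex_esum (J' `*`` I') _ (fun k => (k.2, k.1)))//.
split=> [[j i]/= h|[j i] [j' i'] _ _ [-> ->]//|[i j]/= h].
  by apply/IJ.
by exists (j, i) => //=; apply/IJ.
Qed.

Lemma esum_const_le (T : choiceType) (A : set T) (c : \bar R) :
  0 <= c -> (forall x y, A x -> A y -> x = y) -> \esum_(y in A) c <= c.
Proof.
move=> c0 A1; have [->|/set0P[x Ax]] := eqVneq A set0; first by rewrite esum_set0.
rewrite (_ : A = [set x]) ?esum_set1//.
by apply/seteqP; split=> [y Ay|_ ->//]; exact: A1.
Qed.

End NonnegativeSums.

(** * Sums of absolutely summable complex families *)

Section Modulus.
Context {R : realType}.
Implicit Types z : R[i].

Lemma cnormE z : (cnorm z)%:C = `|z|.
Proof. by []. Qed.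

Lemma cnorm_ge0 z : 0 <= cnorm z.
Proof. by case: z => a b; exact: sqrtr_ge0. Qed.

Lemma cnormD z z' : cnorm (z + z') <= cnorm z + cnorm z'.
Proof. by rewrite -lecR rmorphD/= !cnormE ler_normD. Qed.

Lemma cnormN z : cnorm (- z) = cnorm z.
Proof. by apply: complexI; rewrite !cnormE normrN. Qed.

Lemma cnormB z z' : cnorm (z - z') <= cnorm z + cnorm z'.
Proof. by rewrite -(cnormN z') cnormD. Qed.

Lemma cnormC (x : R) : cnorm x%:C = `|x|.
Proof. by rewrite /= expr0n/= addr0 sqrtr_sqr. Qed.

Lemma cnormCM (x : R) z : cnorm (z * x%:C) = cnorm z * `|x|.
Proof. by rewrite Normc.normcM cnormC. Qed.

Lemma cnorm_sum (I : Type) (s : seq I) (F : I -> R[i]) :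
  cnorm (\sum_(i <- s) F i) <= \sum_(i <- s) cnorm (F i).
Proof.
elim/big_rec2: _ => [|i y z _ h]; first by rewrite cnormC normr0.
by rewrite (le_trans (cnormD _ _))// lerD2l.
Qed.

Lemma absRe_le z : `|complex.Re z| <= cnorm z.
Proof.
case: z => a b /=; rewrite -sqrtr_sqr ler_wsqrtr// lerDl sqr_ge0//.
Qed.

Lemma absIm_le z : `|complex.Im z| <= cnorm z.
Proof.
case: z => a b /=; rewrite -sqrtr_sqr ler_wsqrtr// lerDr sqr_ge0//.
Qed.

End Modulus.

Section ComplexSums.
Context {R : realType}.

Definition asum (T : choiceType) (D : set T) (f : T -> R[i]) : \bar R :=
  (\esum_(x in D) (cnorm (f x))%:E)%E.

Context {T : choiceType}.
Implicit Types (D : set T) (u v : T -> R) (f g : T -> R[i]).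

Definition rabs D u : \bar R := (\esum_(x in D) `|u x|%:E)%E.

(** Any splitting of [u] into nonnegative summable parts computes its sum, not
    only the positive and negative parts; linearity follows. *)
Lemma rsum_diff D u a b : (forall x, 0 <= a x) -> (forall x, 0 <= b x) ->
  (mass a D < +oo)%E -> (mass b D < +oo)%E ->
  (forall x, D x -> u x = a x - b x) ->
  rsum D u = fine (mass a D) - fine (mass b D).
Proof.
move=> a0 b0 fa fb uab.
have sa : summable D (EFin \o a).
  by apply: le_lt_trans fa; apply: le_esum => x _ /=; rewrite ger0_norm.
have sb : summable D (EFin \o b).
  by apply: le_lt_trans fb; apply: le_esum => x _ /=; rewrite ger0_norm.
have h := esumB sa sb (fun i _ => a0 i) (fun i _ => b0 i).
have sd := summableB sa sb.
have fin (w : T -> \bar R) : summable D w -> (forall x, (0 <= w x)%E) ->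
    esum D w \is a fin_num.
  rewrite summableE => + w0; congr (_ \is a fin_num).
  by apply: eq_esum => x _; rewrite gee0_abs.
have pe : (\esum_(x in D) (EFin \o u)^\+ x = esum D ((EFin \o a) \- (EFin \o b))^\+)%E.
  by apply: eq_esum => x Dx; rewrite !funeposE /= uab.
have ne : (\esum_(x in D) (EFin \o u)^\- x = esum D ((EFin \o a) \- (EFin \o b))^\-)%E.
  by apply: eq_esum => x Dx; rewrite !funenegE /= uab.
rewrite /rsum pe ne -!fineB ?h//.
- by apply: (fin _ sa).
- by apply: (fin _ sb).
- by apply: fin; [exact: summable_funepos|].
- by apply: fin; [exact: summable_funeneg|].
Qed.

Lemma mass_ge0 u D : (forall x, 0 <= u x) -> (0 <= mass u D)%E.
Proof. by move=> u0; apply: esum_ge0 => x _; rewrite lee_fin. Qed.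

Lemma mass_fin u D : (forall x, 0 <= u x) -> (mass u D < +oo)%E ->
  mass u D \is a fin_num.
Proof. by move=> u0 h; rewrite ge0_fin_numE// mass_ge0. Qed.

Definition rpos u x := Num.max (u x) 0.
Definition rneg u x := Num.max (- u x) 0.

Lemma rpos_ge0 u x : 0 <= rpos u x. Proof. by rewrite /rpos le_max lexx orbT. Qed.
Lemma rneg_ge0 u x : 0 <= rneg u x. Proof. by rewrite /rneg le_max lexx orbT. Qed.
Lemma rposneg u x : u x = rpos u x - rneg u x.
Proof.
rewrite /rpos /rneg; case: (leP 0 (u x)) => h.
  by rewrite max_r ?subr0// oppr_le0.
by rewrite max_l ?opprK ?add0r// oppr_ge0 ltW.
Qed.
Lemma rposneg_abs u x : `|u x| = rpos u x + rneg u x.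
Proof.
rewrite /rpos /rneg; case: (leP 0 (u x)) => h.
  by rewrite max_r ?addr0 ?ger0_norm// oppr_le0.
by rewrite max_l ?ltr0_norm ?add0r// oppr_ge0 ltW.
Qed.

Lemma rabs_split D u : (rabs D u = mass (rpos u) D + mass (rneg u) D)%E.
Proof.
rewrite /rabs /mass -esumD => [|x _|x _]; last 2 first.
- by rewrite lee_fin rpos_ge0.
- by rewrite lee_fin rneg_ge0.
by apply: eq_esum => x _; rewrite rposneg_abs EFinD.
Qed.

Lemma rpos_fin D u : (rabs D u < +oo)%E -> (mass (rpos u) D < +oo)%E.
Proof.
rewrite rabs_split; apply: le_lt_trans; rewrite leeDl//.
by apply: mass_ge0; exact: rneg_ge0.
Qed.

Lemma rneg_fin D u : (rabs D u < +oo)%E -> (mass (rneg u) D < +oo)%E.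
Proof.
rewrite rabs_split; apply: le_lt_trans; rewrite leeDr//.
by apply: mass_ge0; exact: rpos_ge0.
Qed.

Lemma rsumE D u : (rabs D u < +oo)%E ->
  rsum D u = fine (mass (rpos u) D) - fine (mass (rneg u) D).
Proof.
move=> h; apply: rsum_diff; [exact: rpos_ge0|exact: rneg_ge0| | |].
- exact: rpos_fin.
- exact: rneg_fin.
- by move=> x _; exact: rposneg.
Qed.

Lemma massD D u v : (forall x, 0 <= u x) -> (forall x, 0 <= v x) ->
  (mass (fun x => (u x + v x)%R) D = mass u D + mass v D)%E.
Proof.
by move=> u0 v0; rewrite /mass -esumD// => x _; rewrite lee_fin.
Qed.

Lemma massZ D u c : 0 <= c -> (forall x, 0 <= u x) ->
  (mass (fun x => (c * u x)%R) D = c%:E * mass u D)%E.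
Proof.
by move=> c0 u0; rewrite /mass -esumZl// => x _; rewrite lee_fin.
Qed.

Lemma rsumD D u v : (rabs D u < +oo)%E -> (rabs D v < +oo)%E ->
  rsum D (fun x => u x + v x) = rsum D u + rsum D v.
Proof.
move=> hu hv; rewrite (rsumE hu) (rsumE hv).
have [pu nu pv nv] := And4 (rpos_fin hu) (rneg_fin hu) (rpos_fin hv) (rneg_fin hv).
rewrite (@rsum_diff _ _ (fun x => rpos u x + rpos v x) (fun x => rneg u x + rneg v x)).
- rewrite !massD; try solve [exact: rpos_ge0|exact: rneg_ge0].
  rewrite !fineD ?mass_fin//; try solve [exact: rpos_ge0|exact: rneg_ge0].
  ring.
- by move=> x; rewrite addr_ge0 ?rpos_ge0.
- by move=> x; rewrite addr_ge0 ?rneg_ge0.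
- by rewrite massD; [rewrite lte_add_pinfty|exact: rpos_ge0..].
- by rewrite massD; [rewrite lte_add_pinfty|exact: rneg_ge0..].
- by move=> x _; rewrite {1}(rposneg u) {1}(rposneg v); ring.
Qed.

Lemma rsumZ D u c : (rabs D u < +oo)%E -> rsum D (fun x => c * u x) = c * rsum D u.
Proof.
move=> hu; rewrite (rsumE hu).
have [pu nu] := (rpos_fin hu, rneg_fin hu).
have [c0|c0] := leP 0 c.
  rewrite (@rsum_diff _ _ (fun x => c * rpos u x) (fun x => c * rneg u x)).
  - rewrite !massZ; try solve [done|exact: rpos_ge0|exact: rneg_ge0].
    rewrite !fineM ?mass_fin//; try solve [exact: rpos_ge0|exact: rneg_ge0].
    by rewrite /= mulrBr.
  - by move=> x; rewrite mulr_ge0 ?rpos_ge0.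
  - by move=> x; rewrite mulr_ge0 ?rneg_ge0.
  - by rewrite massZ//; [rewrite lte_mul_pinfty|exact: rpos_ge0].
  - by rewrite massZ//; [rewrite lte_mul_pinfty|exact: rneg_ge0].
  - by move=> x _; rewrite {1}(rposneg u) mulrBr.
have c1 : 0 <= - c by rewrite oppr_ge0 ltW.
rewrite (@rsum_diff _ _ (fun x => - c * rneg u x) (fun x => - c * rpos u x)).
- rewrite !massZ; try solve [done|exact: rpos_ge0|exact: rneg_ge0].
  rewrite !fineM ?mass_fin//; try solve [exact: rpos_ge0|exact: rneg_ge0].
  by rewrite /=; ring.
- by move=> x; rewrite mulr_ge0 ?rneg_ge0.
- by move=> x; rewrite mulr_ge0 ?rpos_ge0.
- by rewrite massZ//; [rewrite lte_mul_pinfty|exact: rneg_ge0].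
- by rewrite massZ//; [rewrite lte_mul_pinfty|exact: rpos_ge0].
- by move=> x _; rewrite {1}(rposneg u); ring.
Qed.

Lemma absRe_sum D f : (asum D f < +oo)%E ->
  (rabs D (fun x => complex.Re (f x)) < +oo)%E.
Proof.
by apply: le_lt_trans; apply: le_esum => x _; rewrite lee_fin absRe_le.
Qed.

Lemma absIm_sum D f : (asum D f < +oo)%E ->
  (rabs D (fun x => complex.Im (f x)) < +oo)%E.
Proof.
by apply: le_lt_trans; apply: le_esum => x _; rewrite lee_fin absIm_le.
Qed.

Lemma asum_ge0 D f : (0 <= asum D f)%E.
Proof. by apply: esum_ge0 => x _; rewrite lee_fin cnorm_ge0. Qed.

Lemma eq_rsum D u v : (forall x, D x -> u x = v x) -> rsum D u = rsum D v.
Proof.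
move=> uv; rewrite /rsum; congr (fine _ - fine _); apply: eq_esum => x Dx.
  by rewrite !funeposE /= uv.
by rewrite !funenegE /= uv.
Qed.

Lemma eq_csum D f g : (forall x, D x -> f x = g x) -> csum D f = csum D g.
Proof.
by move=> fg; congr Complex; apply: eq_rsum => x Dx; rewrite fg.
Qed.

Lemma asumZ D f k : (asum D (fun x => (k * f x)%R) = (cnorm k)%:E * asum D f)%E.
Proof.
rewrite /asum -esumZl ?cnorm_ge0// => [|x _]; last by rewrite lee_fin cnorm_ge0.
by apply: eq_esum => x _; rewrite Normc.normcM.
Qed.

Lemma asumZ_fin D f k : (asum D f < +oo)%E ->
  (asum D (fun x => (k * f x)%R) < +oo)%E.
Proof. by move=> h; rewrite asumZ lte_mul_pinfty// ?lee_fin ?cnorm_ge0. Qed.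

Lemma csumD D f g : (asum D f < +oo)%E -> (asum D g < +oo)%E ->
  csum D (fun x => f x + g x) = csum D f + csum D g.
Proof.
move=> hf hg; have := rsumD (absRe_sum hf) (absRe_sum hg).
have := rsumD (absIm_sum hf) (absIm_sum hg).
rewrite /csum => Eim Ere; apply/eqP; rewrite eq_complex /=; apply/andP.
rewrite -Ere -Eim; split; apply/eqP; congr rsum; apply/funext => x.
  by case: (f x) (g x) => [? ?] [? ?].
by case: (f x) (g x) => [? ?] [? ?].
Qed.

Lemma csumZ D f k : (asum D f < +oo)%E -> csum D (fun x => k * f x) = k * csum D f.
Proof.
move=> hf; have [hr hi] := (absRe_sum hf, absIm_sum hf).
have hZ c u : (rabs D u < +oo)%E -> (rabs D (fun x => (c * u x)%R) < +oo)%E.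
  move=> h; rewrite /rabs (@eq_esum _ _ _ _ (fun x => `|c|%:E * `|u x|%:E)%E).
    by rewrite esumZl// lte_mul_pinfty.
  by move=> x _; rewrite normrM EFinM.
case: k => a b.
have -> : csum D (fun x => (a +i* b) * f x) =
    (a * rsum D (fun x => complex.Re (f x)) - b * rsum D (fun x => complex.Im (f x))) +i*
    (a * rsum D (fun x => complex.Im (f x)) + b * rsum D (fun x => complex.Re (f x))).
  congr Complex.
    rewrite -mulNr -!rsumZ// -rsumD; try exact: hZ.
    by apply: eq_rsum => x _; case: (f x) => c d /=; rewrite mulNr.
  rewrite -!rsumZ// -rsumD; try exact: hZ.
  by apply: eq_rsum => x _; case: (f x) => c d /=.
by [].
Qed.

Lemma csumB D f g : (asum D f < +oo)%E -> (asum D g < +oo)%E ->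
  csum D (fun x => f x - g x) = csum D f - csum D g.
Proof.
move=> hf hg; rewrite -mulN1r -csumZ// -csumD//; last exact: asumZ_fin.
by apply: eq_csum => x _; rewrite mulN1r.
Qed.

End ComplexSums.

Section ComplexSumLimits.
Context {R : realType} {T : choiceType}.
Implicit Types (D : set T) (u v : T -> R) (f g : T -> R[i]).

Lemma rsum_le D u : (rabs D u < +oo)%E -> `|rsum D u| <= fine (rabs D u).
Proof.
move=> h; rewrite (rsumE h) rabs_split fineD; last 2 first.
- exact: mass_fin (rpos_ge0 u) (rpos_fin h).
- exact: mass_fin (rneg_ge0 u) (rneg_fin h).
rewrite (le_trans (ler_normB _ _))// !ger0_norm ?fine_ge0 ?mass_ge0//.
  exact: rneg_ge0.
exact: rpos_ge0.
Qed.

(** Rotating [f] so that its sum becomes a nonnegative real reduces the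
    triangle inequality to the one for the real part. *)
Lemma csum_le D f : (asum D f < +oo)%E -> ((cnorm (csum D f))%:E <= asum D f)%E.
Proof.
move=> hf; have [z0|nz] := eqVneq (csum D f) 0.
  by rewrite z0 Normc.normc0 asum_ge0.
have nn : cnorm (csum D f) != 0.
  by apply: contra nz => /eqP/Normc.eq0_normc ->.
pose k := (csum D f)^-1 * (cnorm (csum D f))%:C.
have nk : cnorm k = 1.
  by rewrite Normc.normcM Normc.normcV cnormC ger0_norm ?cnorm_ge0// mulVf.
have E : csum D (fun x => k * f x) = (cnorm (csum D f))%:C.
  by rewrite csumZ// /k mulrAC mulVf// mul1r.
have hk : (asum D (fun x => (k * f x)%R) < +oo)%E by exact: asumZ_fin.
have := rsum_le (absRe_sum hk).
rewrite -[rsum _ _]/(complex.Re (csum D (fun x => k * f x))) E /=.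
rewrite ger0_norm ?cnorm_ge0// => h.
have finR : rabs D (fun x => complex.Re (k * f x)) \is a fin_num.
  rewrite ge0_fin_numE; first exact: absRe_sum.
  by apply: esum_ge0 => x _; rewrite lee_fin.
move: h; rewrite -lee_fin fineK// => /le_trans; apply.
have -> : asum D f = asum D (fun x => k * f x) by rewrite asumZ nk mul1e.
by apply: le_esum => x _; rewrite lee_fin absRe_le.
Qed.

Lemma csum_supp D f : (forall x, ~ D x -> f x = 0) -> csum [set: T] f = csum D f.
Proof.
have aux (u : T -> R) : (forall x, ~ D x -> u x = 0) -> rsum [set: T] u = rsum D u.
  move=> u0; rewrite /rsum; congr (fine _ - fine _); apply/esym/esum_eq_supp => //.
    by move=> x _ nx; rewrite funeposE /= u0// maxxx.
  by move=> x _ nx; rewrite funenegE /= u0// oppr0 maxxx.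
by move=> f0; congr Complex; apply: aux => x nx; rewrite f0.
Qed.

Lemma csum_leP D f (c : \bar R) : (asum D f <= c)%E -> (c < +oo)%E ->
  ((cnorm (csum D f))%:E <= c)%E.
Proof. by move=> h hc; rewrite (le_trans _ h)// csum_le// (le_lt_trans h). Qed.

Definition exhausts D (s : nat -> seq T) : Prop :=
  [/\ forall N, uniq (s N),
      forall N, {subset s N <= s N.+1},
      forall N y, y \in s N -> D y
    & forall y, D y -> exists N, y \in s N].

Lemma exhausts_mono D s m n : exhausts D s -> (m <= n)%N -> {subset s m <= s n}.
Proof.
move=> [_ mono _ _]; elim: n => [|n ih]; first by rewrite leqn0 => /eqP ->.
by rewrite leq_eqVlt => /predU1P[->//|/ih h] y /h; exact: mono.
Qed.

Lemma mass_lim D s u : exhausts D s -> (forall x, 0 <= u x) ->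
  (mass u D < +oo)%E ->
  (fun N => \sum_(y <- s N) u y) @ \oo --> fine (mass u D).
Proof.
move=> ex u0 fin; have [us _ sD cov] := ex.
have finm := mass_fin u0 fin.
apply/cvgrPdist_le => e e0.
have [_ [A [finA AD] <-] Ae] := ub_ereal_sup_adherent e0 finm.
have /finite_seqP[r0 Ar0] := finA; pose r := undup r0.
have {Ar0} Ar : A = [set` r] by rewrite Ar0; apply/seteqP; split => y /=; rewrite mem_undup.
have [N0 AN0] : exists N0, {subset r <= s N0}.
  have : forall y, y \in r -> D y by move=> y yr; apply: AD; rewrite Ar.
  elim: (r) => [|y r1 ih] rD; first by exists 0%N.
  have [|N1 h1] := ih; first by move=> z zr; apply: rD; rewrite inE zr orbT.
  have [|N2 h2] := cov y; first by apply: rD; rewrite inE eqxx.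
  exists (maxn N1 N2) => z; rewrite inE => /predU1P[->|zr].
    exact: (exhausts_mono ex (leq_maxr _ _)).
  by apply: (exhausts_mono ex (leq_maxl N1 _)); exact: h1.
have ur : uniq r by exact: undup_uniq.
near=> N.
have ge : \sum_(y <- r) u y <= \sum_(y <- s N) u y.
  rewrite -lee_fin -!sumEFin.
  rewrite -!(@esum_seq _ _ _ (EFin \o u))//.
  apply: le_esum_set => [y|y _]; last by rewrite /= lee_fin.
  move=> yA; apply: (exhausts_mono ex); last exact: AN0.
  by near: N; exact: nbhs_infty_ge.
have le : \sum_(y <- s N) u y <= fine (mass u D).
  rewrite -lee_fin fineK// -sumEFin.
  rewrite -(@esum_seq _ _ _ (EFin \o u))//.
  by apply: le_esum_set => [y|y _]; [exact: sD|rewrite /= lee_fin].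
rewrite ger0_norm ?subr_ge0// lerBlDl -lerBlDr (le_trans _ ge)//.
move: Ae; rewrite Ar -fsbig_seq// sumEFin -[ereal_sup _]/(mass u D) -[X in (X - _)%E]fineK//.
by rewrite -EFinB lte_fin => /ltW.
Unshelve. all: by end_near. Qed.

Lemma rsum_lim D s u : exhausts D s -> (rabs D u < +oo)%E ->
  (fun N => \sum_(y <- s N) u y) @ \oo --> rsum D u.
Proof.
move=> ex h; rewrite (rsumE h).
rewrite (_ : (fun N => _) = (fun N => \sum_(y <- s N) rpos u y) \-
                            (fun N => \sum_(y <- s N) rneg u y)); last first.
  by apply/funext => N /=; rewrite -sumrB; apply: eq_bigr => y _; exact: rposneg.
apply: cvgB; apply: mass_lim => //.
- exact: rpos_ge0.
- exact: rpos_fin.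
- exact: rneg_ge0.
- exact: rneg_fin.
Qed.

(** The sums are unconditional, so they can be computed along any exhaustion;
    those over a sector are computed generation by generation. *)
Lemma csum_lim D s f L : exhausts D s -> (asum D f < +oo)%E ->
  (fun N => cnorm (\sum_(y <- s N) f y - L)) @ \oo --> (0 : R) ->
  csum D f = L.
Proof.
move=> ex hf hL.
have sumRe (g : T -> R[i]) r : complex.Re (\sum_(y <- r) g y) = \sum_(y <- r) complex.Re (g y).
  by elim/big_rec2: _ => [//|y a b _ <-]; case: (g y) b => [? ?] [? ?].
have sumIm (g : T -> R[i]) r : complex.Im (\sum_(y <- r) g y) = \sum_(y <- r) complex.Im (g y).
  by elim/big_rec2: _ => [//|y a b _ <-]; case: (g y) b => [? ?] [? ?].
have aux (v : T -> R) (l : R) : (rabs D v < +oo)%E ->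
    (forall N, `|\sum_(y <- s N) v y - l| <= cnorm (\sum_(y <- s N) f y - L)) ->
    rsum D v = l.
  move=> hv le; apply: (cvg_unique _ (rsum_lim ex hv)) => //.
  apply/cvgrPdist_le => e e0.
  move/cvgrPdist_le : hL => /(_ e e0); apply: filterS => N.
  rewrite sub0r normrN ger0_norm ?cnorm_ge0// distrC => h.
  exact: le_trans (le N) h.
apply/eqP; rewrite eq_complex /=; apply/andP; split; apply/eqP; apply: aux.
- exact: absRe_sum.
- move=> N; rewrite -sumRe; apply: le_trans (absRe_le _).
  by case: (\sum_(y <- _) _) L {hL} => [? ?] [? ?].
- exact: absIm_sum.
- move=> N; rewrite -sumIm; apply: le_trans (absIm_le _).
  by case: (\sum_(y <- _) _) L {hL} => [? ?] [? ?].
Qed.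

End ComplexSumLimits.

Section NaturalSums.
Context {R : realType}.

Lemma exhausts_nat : exhausts [set: nat] (fun N => iota 0 N).
Proof.
split=> [N|N y|//|y _]; first exact: iota_uniq.
  by rewrite !mem_iota /= !add0n => /ltnW h; rewrite ltnS.
by exists y.+1; rewrite mem_iota /= add0n.
Qed.

Lemma geometric_esum (x c : R) : 0 <= c -> 0 <= x < 1 ->
  (\esum_(k in [set: nat]) (c * x ^+ k)%:E = (c / (1 - x))%:E)%E.
Proof.
move=> c0 /andP[x0 x1].
rewrite -nneseries_esumT; last by move=> n; rewrite lee_fin mulr_ge0 ?exprn_ge0.
apply: cvg_lim => //.
have -> : (fun n => \sum_(0 <= k < n) (c * x ^+ k)%:E)%E =
    EFin \o series (geometric c x).
  by apply/funext => n /=; rewrite sumEFin.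
apply: cvg_EFin; first by near=> n.
by apply: cvg_geometric_series; rewrite ger0_norm.
Unshelve. all: by end_near. Qed.

End NaturalSums.

(** * Trees rooted at a boundary point *)

(** The tree as seen from a boundary point. The parent of a vertex is its
    neighbour in the direction of the boundary point, [scale] is [q ^ (- h)] for
    the horocyclic index [h], so that the measures are powers of [scale], and
    [par_confl] says that all rays to the boundary point merge. *)
Record horotree (R : realType) (T : choiceType) (q : nat) := HoroTree {
  par : T -> T;
  kid : T -> 'I_q -> T;
  scale : T -> R;
  kidK : forall x i, par (kid x i) = x;
  kid_inj : forall x, injective (kid x);
  kid_surj : forall y, exists i, y = kid (par y) i;
  scale_gt0 : forall x, 0 < scale x;
  scale_par : forall x, scale (par x) = q%:R * scale x;
  par_confl : forall x y, exists n m, iter n par x = iter m par y;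
  arity_gt1 : (1 < q)%N }.

Section HoroTreeCombinatorics.
Context {R : realType} {T : choiceType} {q : nat} (X : horotree R T q).
Local Notation par := (par X).
Local Notation kid := (kid X).
Local Notation scale := (scale X).

Lemma arity_gt1R : 1 < q%:R :> R.
Proof. by rewrite ltr1n (arity_gt1 X). Qed.

Lemma arity_gt0R : 0 < q%:R :> R.
Proof. exact: lt_trans ltr01 arity_gt1R. Qed.

Lemma arity_neq0 : q%:R != 0 :> R.
Proof. by rewrite gt_eqF ?arity_gt0R. Qed.

Lemma scale_ge0 x : 0 <= scale x. Proof. exact/ltW/scale_gt0. Qed.

Lemma scale_neq0 x : scale x != 0. Proof. by rewrite gt_eqF ?scale_gt0. Qed.

Lemma scale_iter n x : scale (iter n par x) = q%:R ^+ n * scale x.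
Proof.
by elim: n => [|n ih]; rewrite ?expr0 ?mul1r//= scale_par ih exprS mulrA.
Qed.

Lemma iter_par_inj x m n : iter m par x = iter n par x -> m = n.
Proof.
move=> /(congr1 scale); rewrite !scale_iter => /(mulIf (scale_neq0 x)).
by apply: ieexprIn; rewrite ?gt_eqF ?arity_gt0R ?arity_gt1R.
Qed.

Definition sec x : set T := [set y | exists n, iter n par y = x].
Definition anc x : set T := [set v | sec v x].

Lemma sec_self x : sec x x. Proof. by exists 0%N. Qed.

Lemma sec_par x : sec (par x) x. Proof. by exists 1%N. Qed.

Lemma par_notin_sec x : ~ sec x (par x).
Proof. by move=> [n]; rewrite -iterSr => /(iter_par_inj (n := 0)). Qed.

Lemma sec_iter n x : sec (iter n par x) x. Proof. by exists n. Qed.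

Lemma sec_trans x y z : sec x y -> sec y z -> sec x z.
Proof. by move=> [n <-] [m <-]; exists (n + m)%N; rewrite iterD. Qed.

Lemma sec_comparable v v' y : sec v y -> sec v' y -> sec v v' \/ sec v' v.
Proof.
move=> [n <-] [m <-]; have [le|/ltnW le] := leqP n m.
  by right; exists (m - n)%N; rewrite -iterD subnK.
by left; exists (n - m)%N; rewrite -iterD subnK.
Qed.

Lemma sec_parE v y : sec v y -> y <> v -> sec v (par y).
Proof. by move=> [[|n] <-]// _; exists n; rewrite -iterSr. Qed.

Lemma sec_par_kid v y : sec v y -> y <> v -> forall i, sec v (kid y i).
Proof. by move=> vy _ i; apply: sec_trans vy _; exists 1%N; rewrite /= kidK. Qed.

Lemma scale_sec v y : sec v y -> scale y <= scale v.
Proof.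
move=> [n <-]; rewrite scale_iter ler_peMl ?scale_ge0// exprn_ege1//.
exact/ltW/arity_gt1R.
Qed.

Fixpoint desc n x : seq T :=
  if n is n'.+1 then [seq kid v i | v <- desc n' x, i <- enum 'I_q] else [:: x].

Lemma mem_desc n x y : (y \in desc n x) <-> iter n par y = x.
Proof.
elim: n y => [|n ih] y; first by rewrite inE /=; split => /eqP.
rewrite iterSr /=; split => [/allpairsP[[v i] [/= /ih vx _ ->]]|/ih h].
  by rewrite kidK.
have [i yi] := kid_surj X y; rewrite yi.
by apply/allpairsP; exists (par y, i); rewrite mem_enum.
Qed.

Lemma desc_uniq n x : uniq (desc n x).
Proof.
elim: n => [//|n ih] /=; apply: allpairs_uniq => //; first exact: enum_uniq.
move=> [v i] [v' i'] _ _ /= e.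
have ev : v = v' by rewrite -(kidK X v i) e kidK.
by move: e; rewrite ev => /(@kid_inj _ _ _ X) ->.
Qed.

Lemma size_desc n x : size (desc n x) = (q ^ n)%N.
Proof.
by elim: n => [//|n ih]; rewrite /= size_allpairs ih size_enum_ord expnS mulnC.
Qed.

Lemma sum_desc (V : nmodType) n x (F : T -> V) :
  \sum_(y <- desc n.+1 x) F y = \sum_(v <- desc n x) \sum_i F (kid v i).
Proof.
by rewrite /= big_allpairs_dep; apply: eq_bigr => v _; rewrite big_enum.
Qed.

Lemma sec_desc x : sec x = \bigcup_n [set` desc n x].
Proof.
apply/seteqP; split => [y [n yx]|y [n _ /mem_desc yx]]; last by exists n.
by exists n => //; apply/mem_desc.
Qed.

Lemma desc_disjoint x : trivIset [set: nat] (fun n => [set` desc n x]).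
Proof.
move=> n m _ _ [y []] /= /mem_desc yn /mem_desc ym.
by apply: iter_par_inj (etrans yn (esym ym)).
Qed.

Fixpoint desc_upto N x : seq T :=
  if N is N'.+1 then desc_upto N' x ++ desc N' x else [::].

Lemma mem_desc_upto N x y :
  (y \in desc_upto N x) <-> exists2 n, (n < N)%N & iter n par y = x.
Proof.
elim: N => [|N ih] /=; first by split=> // -[].
rewrite mem_cat; split => [/orP[/ih[n nN yx]|/mem_desc]|[n nN yx]].
- by exists n => //; exact: ltnW.
- by exists N.
- apply/orP; move: nN; rewrite ltnS leq_eqVlt => /predU1P[nN|nN].
    by right; apply/mem_desc; rewrite -nN.
  by left; apply/ih; exists n.
Qed.

Lemma exhausts_sec x : exhausts (sec x) (fun N => desc_upto N x).
Proof.
split=> [N|N y|N y|y [n yx]].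
- elim: N => [//|N ih] /=; rewrite cat_uniq ih desc_uniq andbT /=.
  apply/hasPn => y /mem_desc yN; apply/negP => /mem_desc_upto[n nN yx].
  by move: nN; rewrite (iter_par_inj (etrans yx (esym yN))) ltnn.
- by rewrite /= mem_cat => ->.
- by move/mem_desc_upto => [n _ yx]; exists n.
- by exists n.+1; apply/mem_desc_upto; exists n.
Qed.

Lemma sum_desc_upto (V : nmodType) N x (F : T -> V) :
  \sum_(y <- desc_upto N x) F y = \sum_(n < N) \sum_(y <- desc n x) F y.
Proof.
elim: N => [|N ih]; first by rewrite /= big_nil big_ord0.
by rewrite /= big_cat /= ih big_ord_recr.
Qed.

Lemma anc_range x : anc x = range (fun n => iter n par x).
Proof.
by apply/seteqP; split => [v [n <-]|v [n _ <-]]; exists n.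
Qed.

Lemma esum_anc x (a : T -> \bar R) :
  (\esum_(v in anc x) a v = \esum_(n in [set: nat]) a (iter n par x))%E.
Proof.
rewrite anc_range esum_image// => m n _ _; exact: iter_par_inj.
Qed.

Lemma esum_sec x (a : T -> \bar R) : (forall y, 0 <= a y)%E ->
  (\esum_(y in sec x) a y = \esum_(n in [set: nat]) \sum_(y <- desc n x) a y)%E.
Proof.
move=> a0; rewrite sec_desc esum_bigcupT//; last exact: desc_disjoint.
by apply: eq_esum => n _; rewrite esum_seq// desc_uniq.
Qed.

Lemma scale_pow_iter n x b :
  scale (iter n par x) `^ b = (q%:R `^ b) ^+ n * scale x `^ b.
Proof.
rewrite scale_iter powRM ?scale_ge0 ?exprn_ge0//; congr (_ * _).
by rewrite -powR_mulrn// -powRrM mulrC powRrM powR_mulrn ?powR_ge0.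
Qed.

Lemma scale_pow_gt0 x b : 0 < scale x `^ b.
Proof. exact/powR_gt0/scale_gt0. Qed.

Definition sec_const (b : R) := (1 - q%:R `^ (1 - b))^-1.
Definition anc_const (s : R) := (1 - q%:R `^ (- s))^-1.

Lemma arity_powN_lt1 (s : R) : 0 < s -> 0 <= (q%:R : R) `^ (- s) < 1.
Proof.
move=> s0; rewrite powR_ge0 powRN invf_lt1 ?powR_gt0 ?arity_gt0R//.
suff: (1 : R) `^ s < q%:R `^ s by rewrite powR1.
by rewrite gt0_ltr_powR ?nnegrE ?arity_gt1R// ltW ?arity_gt0R.
Qed.

Lemma arity_pow1B_lt1 (b : R) : 1 < b -> 0 <= (q%:R : R) `^ (1 - b) < 1.
Proof. by move=> b1; rewrite -opprB; apply: arity_powN_lt1; rewrite subr_gt0. Qed.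

Lemma sec_const_gt0 b : 1 < b -> 0 < sec_const b.
Proof.
by move=> /arity_pow1B_lt1/andP[_ h]; rewrite invr_gt0 subr_gt0.
Qed.

Lemma anc_const_gt0 s : 0 < s -> 0 < anc_const s.
Proof. by move=> /arity_powN_lt1/andP[_ h]; rewrite invr_gt0 subr_gt0. Qed.

(** There are [q ^ n] vertices [n] generations below [x] and each has weight
    [q ^ (- b n)] times that of [x], so the weight of a sector is a geometric
    series. *)
Lemma sec_pow x b : 1 < b ->
  mass (fun y => scale y `^ b) (sec x) = (sec_const b * scale x `^ b)%:E.
Proof.
move=> b1; rewrite /mass esum_sec => [|y]; last by rewrite lee_fin powR_ge0.
have q0 := arity_gt0R.
rewrite (@eq_esum _ _ _ _ (fun n => (scale x `^ b * (q%:R `^ (1 - b)) ^+ n)%:E)).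
  by rewrite geometric_esum ?arity_pow1B_lt1 ?powR_ge0// mulrC.
move=> n _; rewrite sumEFin; congr EFin.
rewrite (eq_big_seq (fun=> (q%:R `^ (- b)) ^+ n * scale x `^ b)); last first.
  move=> y /mem_desc <-; rewrite scale_pow_iter mulrA -exprMn powRN mulVf.
    by rewrite expr1n mul1r.
  by rewrite gt_eqF// powR_gt0.
rewrite big_const_seq count_predT size_desc iter_addr_0 -[LHS]mulr_natl natrX mulrA.
rewrite -exprMn mulrC; congr (_ * _ ^+ _).
by rewrite powRD ?powRr1 ?(ltW q0)// (gt_eqF q0) implybT.
Qed.

Lemma anc_pow x s : 0 < s ->
  mass (fun v => scale v `^ (- s)) (anc x) = (anc_const s * scale x `^ (- s))%:E.
Proof.
move=> s0; rewrite /mass esum_anc.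
rewrite (@eq_esum _ _ _ _ (fun n => (scale x `^ (- s) * (q%:R `^ (- s)) ^+ n)%:E)).
  by rewrite geometric_esum ?arity_powN_lt1 ?powR_ge0// mulrC.
by move=> n _; rewrite scale_pow_iter mulrC.
Qed.

End HoroTreeCombinatorics.
Arguments sec_const {R} q b.
Arguments anc_const {R} q s.

(** * The positive operator that sums the averages over ancestral sectors *)

Section Averages.
Context {R : realType} {T : choiceType} {q : nat} (X : horotree R T q).
Context (alpha : R) (alpha_gt1 : 1 < alpha).
Local Notation par := (par X).
Local Notation scale := (scale X).
Local Notation sec := (sec X).
Local Notation anc := (anc X).
Implicit Types f g : T -> R.

Definition weight x := scale x `^ alpha.
Local Notation w := weight.

Lemma weight_gt0 x : 0 < w x. Proof. exact: scale_pow_gt0. Qed.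
Lemma weight_ge0 x : 0 <= w x. Proof. exact/ltW/weight_gt0. Qed.
Lemma weight_neq0 x : w x != 0. Proof. by rewrite gt_eqF ?weight_gt0. Qed.

Lemma weight_iter n x : w (iter n par x) = (q%:R `^ alpha) ^+ n * w x.
Proof. exact: scale_pow_iter. Qed.

Lemma arity_pow_gt1 : 1 < q%:R `^ alpha :> R.
Proof.
suff: (1 : R) `^ alpha < q%:R `^ alpha by rewrite powR1.
rewrite gt0_ltr_powR ?nnegrE ?(arity_gt1R X) ?ltW ?(arity_gt0R X)//.
exact: lt_trans alpha_gt1.
Qed.

Lemma sec_mass v : mass w (sec v) = (sec_const q alpha * w v)%:E.
Proof. exact: sec_pow. Qed.

Definition sector_sum f v : \bar R := mass (fun y => f y * w y) (sec v).

Lemma sector_sum_ge0 f v : (forall y, 0 <= f y) -> (0 <= sector_sum f v)%E.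
Proof. by move=> f0; apply: mass_ge0 => y; rewrite mulr_ge0 ?weight_ge0. Qed.

(** The averages are over sectors, up to the constant ratio of the mass of a
    sector to the weight of its vertex. This positive operator dominates the
    projection. *)
Definition anc_avg f x : \bar R :=
  (\esum_(v in anc x) ((w v)^-1%:E * sector_sum f v))%E.

Lemma anc_avg_term_ge0 f v : (forall y, 0 <= f y) ->
  (0 <= (w v)^-1%:E * sector_sum f v)%E.
Proof.
by move=> f0; rewrite mule_ge0 ?sector_sum_ge0// lee_fin invr_ge0 weight_ge0.
Qed.

Lemma anc_avg_ge0 f x : (forall y, 0 <= f y) -> (0 <= anc_avg f x)%E.
Proof. by move=> f0; apply: esum_ge0 => v _; exact: anc_avg_term_ge0. Qed.

Lemma le_sector_sum f g v : (forall y, sec v y -> f y <= g y) ->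
  (sector_sum f v <= sector_sum g v)%E.
Proof.
move=> fg; apply: le_esum => y vy; rewrite lee_fin ler_wpM2r ?weight_ge0//.
exact: fg.
Qed.

Lemma le_anc_avg f g x :
  (forall v, sec v x -> (sector_sum f v <= sector_sum g v)%E) ->
  (anc_avg f x <= anc_avg g x)%E.
Proof.
move=> fg; apply: le_esum => v vx; rewrite lee_wpmul2l ?fg//.
by rewrite lee_fin invr_ge0 weight_ge0.
Qed.

Lemma anc_avgD f g x : (forall y, 0 <= f y) -> (forall y, 0 <= g y) ->
  (anc_avg (fun y => (f y + g y)%R) x = anc_avg f x + anc_avg g x)%E.
Proof.
move=> f0 g0; rewrite /anc_avg -esumD; try by move=> v _; exact: anc_avg_term_ge0.
apply: eq_esum => v _; rewrite -ge0_muleDr ?sector_sum_ge0//.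
rewrite /sector_sum -massD; try by move=> y; rewrite mulr_ge0 ?weight_ge0.
by congr (_ * mass _ _)%E; apply/funext => y; rewrite mulrDl.
Qed.

Lemma anc_avgZ f c x : 0 <= c -> (forall y, 0 <= f y) ->
  (anc_avg (fun y => (c * f y)%R) x = c%:E * anc_avg f x)%E.
Proof.
move=> c0 f0; rewrite /anc_avg -esumZl//; last by move=> v _; exact: anc_avg_term_ge0.
apply: eq_esum => v _; rewrite muleCA; congr (_ * _)%E.
rewrite /sector_sum -massZ//; last by move=> y; rewrite mulr_ge0 ?weight_ge0.
by congr mass; apply/funext => y; rewrite mulrA.
Qed.

Definition schur_const (s : R) := sec_const q (alpha - s) * anc_const q s.

Lemma schur_const_gt0 s : 0 < s < alpha - 1 -> 0 < schur_const s.
Proof.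
move=> /andP[s0 sa]; apply: mulr_gt0; last exact: (anc_const_gt0 X).
by apply: (sec_const_gt0 X); rewrite ltrBrDr addrC -ltrBrDr.
Qed.

(** The powers [scale ^ (- s)] grow down the tree slowly enough to be summable
    over sectors and decay up the tree, so they are eigenfunctions. *)
Lemma anc_avg_pow s x : 0 < s < alpha - 1 ->
  anc_avg (fun y => scale y `^ (- s)) x = (schur_const s * scale x `^ (- s))%:E.
Proof.
move=> /andP[s0 sa]; have as1 : 1 < alpha - s by rewrite ltrBrDr addrC -ltrBrDr.
rewrite /anc_avg (@eq_esum _ _ _ _
    (fun v => (sec_const q (alpha - s))%:E * (scale v `^ (- s))%:E)%E).
  rewrite esumZl; last 2 first.
  - exact/ltW/(sec_const_gt0 X).
  - by move=> y _; rewrite lee_fin powR_ge0.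
  by rewrite -/(mass _ _) (anc_pow _ _ s0) -EFinM mulrA.
move=> v _; have -> : sector_sum (fun y => scale y `^ (- s)) v =
    (sec_const q (alpha - s) * scale v `^ (alpha - s))%:E.
  rewrite -sec_pow//; congr mass; apply/funext => y.
  by rewrite mulrC -powRD// scale_neq0 implybT.
rewrite -!EFinM; congr EFin; rewrite powRD ?scale_neq0 ?implybT// -/(w v).
by rewrite mulrCA mulKf// weight_neq0.
Qed.

(** Both variables enter through the ancestors that they have in common, hence
    the symmetry of the operator. *)
Lemma anc_avg_pairing f g : (forall y, 0 <= f y) -> (forall y, 0 <= g y) ->
  (\esum_(x in [set: T]) ((g x * w x)%:E * anc_avg f x) =
   \esum_(v in [set: T]) ((w v)^-1%:E * sector_sum f v * sector_sum g v))%E.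
Proof.
move=> f0 g0.
have gw0 x : 0 <= g x * w x by rewrite mulr_ge0 ?weight_ge0.
rewrite (@eq_esum _ _ _ _ (fun x => \esum_(v in anc x)
    ((g x * w x)%:E * ((w v)^-1%:E * sector_sum f v)))%E); last first.
  by move=> x _; rewrite esumZl// => v _; exact: anc_avg_term_ge0.
rewrite (@esum_swap _ _ _ _ _ (fun v => sec v) [set: T]); last 2 first.
- by move=> x v; split => -[].
- by move=> x v _ _; rewrite mule_ge0 ?anc_avg_term_ge0// lee_fin.
apply: eq_esum => v _.
rewrite -[RHS]esumZl_ereal; first by apply: eq_esum => x _; rewrite muleC.
  exact: anc_avg_term_ge0.
by move=> y _; rewrite lee_fin.
Qed.

Lemma anc_avg_sym f g : (forall y, 0 <= f y) -> (forall y, 0 <= g y) ->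
  (\esum_(x in [set: T]) ((g x * w x)%:E * anc_avg f x) =
   \esum_(x in [set: T]) ((f x * w x)%:E * anc_avg g x))%E.
Proof.
by move=> f0 g0; rewrite !anc_avg_pairing//; apply: eq_esum => v _; rewrite muleAC.
Qed.

(** ** Schur's test *)

(** Either [u] is at most [l * c], or the power [p] of the quotient dominates
    it. After summation the level [l] can be chosen freely, which replaces
    an appeal to the convexity of powers. *)
Lemma split_at_level (p l u c : R) : 1 < p -> 0 < l -> 0 < c -> 0 <= u ->
  u <= l * c + l `^ (1 - p) * (u `^ p * c `^ (1 - p)).
Proof.
move=> p1 l0 c0 u0; have lc0 : 0 < l * c by rewrite mulr_gt0.
have rhs0 : 0 <= l `^ (1 - p) * (u `^ p * c `^ (1 - p)).
  by rewrite mulr_ge0 ?mulr_ge0 ?powR_ge0.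
have [ul|/ltW ul] := leP u (l * c); first by rewrite (le_trans ul)// lerDl.
apply: (@le_trans _ _ (l `^ (1 - p) * (u `^ p * c `^ (1 - p)))); last first.
  by rewrite lerDr ltW.
rewrite mulrCA -powRM ?(ltW l0) ?(ltW c0)//.
have -> : u `^ p * (l * c) `^ (1 - p) = l * c * (u / (l * c)) `^ p.
  have -> : (l * c) `^ (1 - p) = l * c * ((l * c) `^ p)^-1.
    by rewrite powRB ?powRr1 ?(ltW lc0)// (gt_eqF lc0) implybT.
  have -> : (u / (l * c)) `^ p = u `^ p * ((l * c) `^ p)^-1.
    rewrite powRM ?invr_ge0 ?(ltW lc0)//; congr (_ * _).
    by rewrite -powR_inv1 ?(ltW lc0)// -powRrM mulN1r powRN.
  by rewrite mulrCA.
have e : u = l * c * (u / (l * c)) by rewrite mulrCA mulfV ?mulr1// gt_eqF.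
rewrite {1}e ler_pM2l//; apply: le1r_powR; last exact: ltW.
by rewrite ler_pdivlMr// mul1r.
Qed.


(** If [G] is positive, the two terms are equal at [l = (G / K) ^ (1 / p)]. *)
Lemma optimize_level (p A K G : R) : 1 < p -> 0 <= A -> 0 < K -> 0 <= G ->
  (forall l, 0 < l -> A <= l * K + l `^ (1 - p) * G) ->
  A `^ p <= 2 `^ p * K `^ (p - 1) * G.
Proof.
move=> p1 A0 K0 G0 h; have p0 : 0 < p by apply: lt_trans p1.
have [G1|G1] := eqVneq G 0.
  suff -> : A = 0 by rewrite powR0 ?G1 ?mulr0// gt_eqF.
  apply/eqP; rewrite eq_le A0 andbT; apply/ler_addgt0Pl => e e0.
  have := h (e / K); rewrite divr_gt0// => /(_ isT).
  by rewrite G1 mulr0 divfK ?gt_eqF// addr0.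
have {G0 G1}G0 : 0 < G by rewrite lt0r G1.
pose l := (G / K) `^ p^-1.
have GK0 : 0 < G / K by rewrite divr_gt0.
have l0 : 0 < l by rewrite powR_gt0.
have lp : l `^ p = G / K by rewrite -powRrM mulVf ?gt_eqF// powRr1// ltW.
have Gl : l `^ (1 - p) * G = l * K.
  rewrite powRB ?(gt_eqF l0) ?implybT// powRr1 ?(ltW l0)// lp.
  by rewrite invf_div -mulrA [_ / G * G]divfK// gt_eqF.
have A2 : A <= 2 * (l * K) by have := h l l0; rewrite Gl; lra.
have lK0 : 0 < l * K by rewrite mulr_gt0.
apply: (@le_trans _ _ ((2 * (l * K)) `^ p)).
  by rewrite ge0_ler_powR ?nnegrE ?(ltW p0)// mulr_ge0// ltW.
rewrite !powRM ?(ltW l0) ?(ltW K0) ?(ltW lK0)// lp powRB ?(gt_eqF K0) ?implybT//.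
rewrite powRr1 ?(ltW K0)// le_eqVlt; apply/orP; left; apply/eqP.
by field; rewrite gt_eqF.
Qed.

Definition Lp_mass (p : R) f : \bar R :=
  mass (fun x => f x `^ p * w x) [set: T].

(** Schur's test on the eigenfunction [scale ^ (- s)], with [s] so small that
    its [p - 1]st power is still an eigenfunction. *)
Lemma anc_avg_Lp (p : R) : 1 < p -> exists2 C : R, 0 < C &
  forall f, (forall x, 0 <= f x) ->
    (Lp_mass p f < +oo)%E ->
    (forall x, anc_avg f x < +oo)%E /\
    (Lp_mass p (fine \o anc_avg f) <= C%:E * Lp_mass p f)%E.
Proof.
move=> p1; have p0 : 0 < p by apply: lt_trans p1.
have a1 : 0 < alpha - 1 by rewrite subr_gt0.
pose s := (alpha - 1) / (2 * p).
have s0 : 0 < s by rewrite divr_gt0// mulr_gt0.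
have sE : s * (2 * p) = alpha - 1 by rewrite divfK// gt_eqF// mulr_gt0.
have hs1 : 0 < s < alpha - 1 by rewrite s0 /=; nra.
have hs2 : 0 < s * (p - 1) < alpha - 1.
  by rewrite mulr_gt0 ?subr_gt0//=; nra.
pose c1 := schur_const s; pose c2 := schur_const (s * (p - 1)).
have c10 : 0 < c1 by exact: schur_const_gt0.
have c20 : 0 < c2 by exact: schur_const_gt0.
exists (2 `^ p * c1 `^ (p - 1) * c2).
  by rewrite mulr_gt0// mulr_gt0 ?powR_gt0.
move=> f f0 finN; set N := Lp_mass p f in finN *.
pose psi x := scale x `^ (- s).
have psi0 x : 0 < psi x by exact: scale_pow_gt0.
pose g x := f x `^ p * psi x `^ (1 - p).
have g0 x : 0 <= g x by rewrite mulr_ge0 ?powR_ge0.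
have psip0 x : 0 <= psi x `^ (p - 1) by exact: powR_ge0.
have total : (\esum_(x in [set: T]) ((psi x `^ (p - 1) * w x)%:E * anc_avg g x) =
    c2%:E * N)%E.
  rewrite anc_avg_sym//.
  have -> : (fun y => psi y `^ (p - 1)) = (fun y => scale y `^ (- (s * (p - 1)))).
    by apply/funext => y; rewrite /psi -powRrM mulNr.
  rewrite /N /Lp_mass /mass -esumZl ?(ltW c20)//; last first.
    by move=> y _; rewrite lee_fin mulr_ge0 ?powR_ge0 ?weight_ge0.
  apply: eq_esum => x _; rewrite anc_avg_pow// -EFinM; congr EFin.
  rewrite /g -/c2 (_ : scale x `^ (- (s * (p - 1))) = psi x `^ (p - 1)); last first.
    by rewrite /psi -powRrM mulNr.
  have : psi x `^ (1 - p) * psi x `^ (p - 1) = 1.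
    by rewrite -powRD ?(gt_eqF (psi0 x)) ?implybT// addrC subrKA subrr powRr0.
  by move=> e; transitivity (c2 * (f x `^ p * w x) *
    (psi x `^ (1 - p) * psi x `^ (p - 1))); [ring|rewrite e mulr1].
have finT : (c2%:E * N < +oo)%E.
  rewrite lte_mul_pinfty// lee_fin; exact: ltW.
have finG x : (anc_avg g x < +oo)%E.
  have c0 : 0 < psi x `^ (p - 1) * w x.
    exact: mulr_gt0 (powR_gt0 _ (psi0 x)) (weight_gt0 x).
  have : ((psi x `^ (p - 1) * w x)%:E * anc_avg g x < +oo)%E.
    apply: le_lt_trans finT; rewrite -total.
    apply: (esum_ge_term (a := fun x => ((psi x `^ (p - 1) * w x)%:E * anc_avg g x)%E)) => // y _.
    by rewrite mule_ge0 ?anc_avg_ge0// lee_fin mulr_ge0 ?weight_ge0.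
  have := anc_avg_ge0 x g0; case: (anc_avg g x) => [r||//]; first by move=> _ _; rewrite ltry.
  by rewrite gt0_muley ?ltxx// lte_fin.
have bound x l : 0 < l ->
    (anc_avg f x <= (l * (c1 * psi x) + l `^ (1 - p) * fine (anc_avg g x))%:E)%E.
  move=> l0; have l1 : 0 <= l `^ (1 - p) by exact: powR_ge0.
  have lpsi y : 0 <= l * psi y by rewrite mulr_ge0// ltW.
  have lg y : 0 <= l `^ (1 - p) * g y by rewrite mulr_ge0.
  apply: (@le_trans _ _ (anc_avg (fun y => l * psi y + l `^ (1 - p) * g y) x)).
    by apply: le_anc_avg => v _; apply: le_sector_sum => y _; exact: split_at_level.
  rewrite anc_avgD// !anc_avgZ// ?(ltW l0)//; last by move=> y; exact/ltW.
  rewrite anc_avg_pow// EFinD !EFinM fineK//.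
  by rewrite ge0_fin_numE ?anc_avg_ge0.
have fin x : (anc_avg f x < +oo)%E by apply: le_lt_trans (bound x 1 ltr01) (ltry _).
split=> //; rewrite EFinM -muleA -total.
rewrite -esumZl; last 2 first.
- by rewrite mulr_ge0 ?powR_ge0.
- by move=> x _; rewrite mule_ge0 ?anc_avg_ge0// lee_fin mulr_ge0 ?weight_ge0.
apply: le_esum => x _.
have -> : anc_avg g x = (fine (anc_avg g x))%:E.
  by rewrite fineK// ge0_fin_numE ?anc_avg_ge0.
rewrite -!EFinM lee_fin.
have : fine (anc_avg f x) `^ p <=
    2 `^ p * (c1 * psi x) `^ (p - 1) * fine (anc_avg g x).
  apply: optimize_level => //; rewrite ?fine_ge0 ?anc_avg_ge0//.
    by rewrite mulr_gt0.
  move=> l l0; rewrite -lee_fin fineK ?bound//.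
  by rewrite ge0_fin_numE ?anc_avg_ge0.
rewrite (powRM _ (ltW c10) (ltW (psi0 x))) => h.
apply: le_trans (ler_wpM2r (weight_ge0 x) h) _.
rewrite le_eqVlt; apply/orP; left; apply/eqP; ring.
Qed.

End Averages.
Arguments schur_const {R} q alpha s.

(** ** Weak type (1,1) *)

Section WeakType.
Context {R : realType} {T : choiceType} {q : nat} (X : horotree R T q).
Context (alpha : R) (alpha_gt1 : 1 < alpha).
Local Notation par := (par X).
Local Notation sec := (sec X).
Local Notation anc := (anc X).
Local Notation w := (weight X alpha).
Local Notation sector_sum := (sector_sum X alpha).
Local Notation anc_avg := (anc_avg X alpha).
Implicit Types f g : T -> R.

Lemma cover_sectors (A U : set T) (a : T -> \bar R) :
  (forall y, 0 <= a y)%E -> (forall y, A y -> exists2 u, U u & sec u y) ->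
  (\esum_(y in A) a y <= \esum_(u in U) \esum_(y in sec u) a y)%E.
Proof.
move=> a0 cov.
rewrite (@esum_swap _ _ _ _ _ (fun y => U `&` anc y) [set: T]) => [|u y|//]; last first.
  by split=> [[Uu uy]|[_ []]].
apply: (@le_trans _ _ (\esum_(y in A) \esum_(u in U `&` anc y) a y)%E).
  apply: le_esum => y /cov[u Uu uy].
  by apply: (esum_ge_term (x := u) (a := fun=> a y)).
by apply: le_esum_set => // y _; exact: esum_ge0.
Qed.

Lemma pack_sectors (B U : set T) (a : T -> \bar R) :
  (forall y, 0 <= a y)%E -> (forall u, U u -> sec u `<=` B) ->
  (forall u v y, U u -> U v -> sec u y -> sec v y -> u = v) ->
  (\esum_(u in U) \esum_(y in sec u) a y <= \esum_(y in B) a y)%E.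
Proof.
move=> a0 UB disj.
rewrite (@esum_swap _ _ _ _ _ (fun y => U `&` anc y) B) => [|u y|//]; last first.
  by split=> [[Uu uy]|[_ []//]]; split; [exact: UB uy|].
by apply: le_esum => y By; apply: esum_const_le => // u v [Uu uy] [Uv vy]; exact: disj uy vy.
Qed.

Lemma le_sector_total f v : (forall y, 0 <= f y) ->
  (sector_sum f v <= mass (fun y => (f y * w y)%R) [set: T])%E.
Proof.
move=> f0; apply: le_esum_set => // y _.
by rewrite lee_fin mulr_ge0 ?weight_ge0.
Qed.

Lemma anc_avg_L1_fin f x : (forall y, 0 <= f y) ->
  (mass (fun y => (f y * w y)%R) [set: T] < +oo)%E -> (anc_avg f x < +oo)%E.
Proof.
move=> f0 fin; set M := mass _ _ in fin.
have M0 : (0 <= M)%E by apply: mass_ge0 => y; rewrite mulr_ge0 ?weight_ge0.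
apply: (@le_lt_trans _ _ (\esum_(v in anc x) (M * (w v)^-1%:E))%E).
  apply: le_esum => v _; rewrite muleC lee_wpmul2r ?le_sector_total//.
  by rewrite lee_fin invr_ge0 weight_ge0.
rewrite esumZl_ereal//; last by move=> v _; rewrite lee_fin invr_ge0 weight_ge0.
have al0 : 0 < alpha by apply: lt_trans alpha_gt1.
rewrite (_ : (\esum_(v in anc x) _)%E = mass (fun v => scale X v `^ (- alpha)) (anc x)).
  by rewrite anc_pow// muleC lte_mul_pinfty// lee_fin mulr_ge0 ?powR_ge0// ltW// (anc_const_gt0 X).
by apply: eq_esum => v _; rewrite powRN.
Qed.

(** The sectors with a large average are covered by the disjoint maximal ones,
    with vertices in [top] and union [Om]. Moving all the mass of a maximal
    sector to its vertex turns [f] into a function [g] bounded by a multiple of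
    [l], without changing the mass of any sector that is not contained in
    [Om]. So outside [Om] the operator does not distinguish [f] from [g], and
    [g] is controlled by the [L^2] bound. *)
Lemma anc_avg_weak : exists2 C : R, 0 < C & forall f l,
  (forall y, 0 <= f y) -> 0 < l ->
  (mass (fun y => (f y * w y)%R) [set: T] < +oo)%E ->
  (mass w [set x | (l%:E < anc_avg f x)%E] <=
     (C / l)%:E * mass (fun y => (f y * w y)%R) [set: T])%E.
Proof.
have [C2 C20 L2] := @anc_avg_Lp _ _ _ X _ alpha_gt1 2 (ltr1n R 2).
have c0 := sec_const_gt0 X alpha_gt1.
set c := sec_const q alpha in c0.
pose Q : R := q%:R `^ alpha; have Q1 : 1 < Q := arity_pow_gt1 X alpha_gt1.
have Q0 : 0 < Q := lt_trans ltr01 Q1.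
exists (c + C2 * Q); first by rewrite addr_gt0// mulr_gt0.
move=> f l f0 l0 fin; set M := mass _ _ in fin *.
have fw0 y : 0 <= f y * w y by rewrite mulr_ge0 ?weight_ge0.
have fwE y : (0 <= (f y * w y)%:E)%E by rewrite lee_fin.
have Mfin : M \is a fin_num by exact: mass_fin.
have Ffin v : sector_sum f v \is a fin_num.
  apply: mass_fin => //; exact: le_lt_trans (le_sector_total v f0) fin.
pose F v := fine (sector_sum f v).
have F0 v : 0 <= F v by rewrite fine_ge0// sector_sum_ge0.
have FE v : sector_sum f v = (F v)%:E by rewrite fineK.
have FM v : F v <= fine M by rewrite -lee_fin !fineK// le_sector_total.
pose a v := F v / w v.
have a0 v : 0 <= a v by rewrite divr_ge0 ?weight_ge0.
pose top v := l < a v /\ forall k, a (iter k.+1 par v) <= l.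
pose Om := [set x | exists2 v, top v & sec v x].
have top_Om : top `<=` Om by move=> v tv; exists v => //; exact: sec_self.
have top_uniq u v y : top u -> top v -> sec u y -> sec v y -> u = v.
  have aux u' v' : top u' -> top v' -> sec u' v' -> u' = v'.
    move=> [lu _] [_ vl] [[|k] e]; first by rewrite -e.
    by have := vl k; rewrite e leNgt lu.
  by move=> tu tv uy vy; have [/aux->|/aux->] := sec_comparable uy vy.
(* The averages tend to 0 along ancestors, so a sector with a large average
   lies below a maximal one. *)
have notOm x v : ~ Om x -> sec v x -> a v <= l.
  move=> nx [k0 vk]; rewrite leNgt; apply/negP => lv; apply: nx.
  have [K hK] : exists K, forall k, (K <= k)%N -> a (iter k par x) <= l.
    have /cvgrPdist_le/(_ (l * w x / (fine M + 1))) h :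
        (fun n => (Q^-1) ^+ n) @ \oo --> (0 : R).
      by apply: cvg_expr; rewrite ger0_norm ?invr_ge0 ?(ltW Q0)// invf_lt1.
    have M1 : 0 < fine M + 1 by rewrite ltr_wpDl// (le_trans (F0 x) (FM x)).
    have [|K _ hK] := h; first by rewrite divr_gt0// mulr_gt0 ?weight_gt0.
    exists K => k /hK /=; rewrite sub0r normrN ger0_norm ?exprn_ge0 ?invr_ge0 ?(ltW Q0)//.
    rewrite ler_pdivlMr// exprVn ler_pdivrMl ?exprn_gt0// => hk.
    rewrite /a ler_pdivrMr ?weight_gt0// weight_iter -/Q mulrCA (le_trans _ hk)//.
    by rewrite (le_trans (FM _))// lerDl.
  have exP : exists k, l < a (iter k par x) by exists k0; rewrite vk.
  have ubP k : l < a (iter k par x) -> (k <= K)%N.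
    by rewrite ltNge => h; rewrite leqNgt; apply: contra h => /ltnW /hK.
  case: (ex_maxnP exP ubP) => m lm maxm.
  exists (iter m par x); last exact: sec_iter.
  split=> // k; rewrite -iterD leNgt; apply/negP => /maxm.
  by rewrite addSn ltnNge leq_addl.
pose g y := if `[< top y >] then a y else if `[< Om y >] then 0 else f y.
have g0 y : 0 <= g y by rewrite /g; do 2?case: ifP.
have gtop y : top y -> g y = a y by rewrite /g => /asboolP ->.
have gf y : ~ Om y -> g y = f y.
  move=> ny; rewrite /g; case: asboolP => [/top_Om//|_].
  by case: asboolP.
have gz y : Om y -> ~ top y -> g y = 0.
  by move=> yO yt; rewrite /g; case: asboolP => // _; case: asboolP.
have gw0 y : 0 <= g y * w y by rewrite mulr_ge0 ?weight_ge0.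
have gwE y : (0 <= (g y * w y)%:E)%E by rewrite lee_fin.
have gw_top u : top u -> (g u * w u)%:E = sector_sum f u.
  by move=> tu; rewrite gtop// /a divfK ?weight_neq0// FE.
(* The sector of the parent is not selected, and its weight is only [Q] times
   as large. *)
have FQ y : top y -> F y <= Q * l * w y.
  move=> [_ /(_ 0%N)]; rewrite /a ler_pdivrMr ?weight_gt0// weight_iter expr1 -/Q => h.
  rewrite [leRHS](_ : _ = l * (Q * w y)); last by ring.
  apply: le_trans h; rewrite -lee_fin -!FE; apply: le_esum_set => [z yz|z _].
    by apply: sec_trans yz; exists 1%N.
  by rewrite lee_fin.
have gQ y : g y <= Q * l.
  have [ty|nty] := pselect (top y).
    by rewrite gtop// ler_pdivrMr ?weight_gt0// FQ.
  have [yO|nyO] := pselect (Om y); first by rewrite gz// mulr_ge0 ?ltW.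
  rewrite gf// (@le_trans _ _ l)//; last by rewrite ler_peMl ?ltW.
  rewrite -(ler_pM2r (weight_gt0 X alpha y)) -ler_pdivrMr ?weight_gt0//.
  apply: le_trans (notOm _ _ nyO (sec_self X y)); rewrite ler_wpM2r ?invr_ge0 ?weight_ge0//.
  rewrite -lee_fin -FE.
  apply: (esum_ge_term (x := y) (a := fun y => (f y * w y)%:E)); last exact: sec_self.
  by move=> z _; rewrite lee_fin.
have topM : (\esum_(u in top) sector_sum f u <= mass (fun y => (f y * w y)%R) Om)%E.
  apply: pack_sectors => //; first by move=> u tu y uy; exists u.
have OmM : (mass (fun y => (f y * w y)%R) Om <= M)%E by apply: le_esum_set.
have massOm : (mass w Om <= (c / l)%:E * M)%E.
  apply: (@le_trans _ _ (\esum_(u in top) \esum_(y in sec u) (w y)%:E)%E).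
    apply: cover_sectors => [y|y [u tu uy]]; first by rewrite lee_fin weight_ge0.
    by exists u.
  apply: (@le_trans _ _ (\esum_(u in top) ((c / l)%:E * sector_sum f u))%E).
    apply: le_esum => u tu; rewrite -/(mass _ _) sec_mass// -/c FE -EFinM lee_fin.
    rewrite -mulrA ler_wpM2l ?(ltW c0)// ler_pdivlMl//.
    by have [+ _] := tu; rewrite ltr_pdivlMr ?weight_gt0// => /ltW.
  rewrite esumZl; last 2 first.
  - by rewrite divr_ge0 ?ltW.
  - by move=> u _; rewrite sector_sum_ge0.
  apply: lee_wpmul2l; first by rewrite lee_fin divr_ge0 ?ltW.
  exact: le_trans topM OmM.
have gM : (mass (fun y => (g y * w y)%R) [set: T] <= M)%E.
  rewrite /M /mass (esumID Om)// [leRHS](esumID Om)// !setTI leeD//.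
    rewrite -(@esum_eq_supp _ _ top)//; last by move=> y Oy nty; rewrite gz// mul0r.
    by apply: le_trans topM; apply: le_esum => u tu; rewrite gw_top.
  by apply: le_esum => y /gf ->.
have gT x : ~ Om x -> (anc_avg f x <= anc_avg g x)%E.
  move=> nx; apply: le_anc_avg => v vx.
  have nv : ~ Om v by move=> [u tu uv]; apply: nx; exists u => //; exact: sec_trans uv vx.
  rewrite /sector_sum /mass (esumID Om)// [leRHS](esumID Om)// leeD//; last first.
    by apply: le_esum => y [_ /gf ->].
  apply: (@le_trans _ _ (\esum_(u in top `&` sec v) sector_sum f u)%E).
    apply: cover_sectors => // y [vy [u tu uy]]; exists u => //; split=> //.
    have [uv|//] := sec_comparable uy vy.
    by case: nv; exists u.
  apply: (@le_trans _ _ (\esum_(u in top `&` sec v) (g u * w u)%:E)%E).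
    by apply: le_esum => u [tu _]; rewrite gw_top.
  by apply: le_esum_set => // u [tu vu]; split=> //; exact: top_Om.
have Ql0 : 0 <= Q * l by rewrite mulr_ge0// ltW.
have l20 : 0 <= l ^- 2 by rewrite invr_ge0 exprn_ge0// ltW.
have g2 : (Lp_mass X alpha 2 g <= (Q * l)%:E * M)%E.
  apply: (@le_trans _ _ ((Q * l)%:E * mass (fun y => (g y * w y)%R) [set: T])%E).
    rewrite -massZ//; apply: le_esum => y _; rewrite lee_fin.
    by rewrite powR_mulrn// expr2 -mulrA ler_wpM2r.
  by rewrite lee_wpmul2l// lee_fin.
have g2fin : (Lp_mass X alpha 2 g < +oo)%E.
  by apply: le_lt_trans g2 _; rewrite lte_mul_pinfty// lee_fin.
have [gfin gL2] := L2 g g0 g2fin.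
pose B := [set x | ~ Om x /\ (l%:E < anc_avg f x)%E].
have massB : (mass w B <= (C2 * Q / l)%:E * M)%E.
  apply: (@le_trans _ _ ((l ^- 2)%:E * Lp_mass X alpha 2 (fine \o anc_avg g))%E).
    have P0 y : 0 <= fine (anc_avg g y) `^ 2 * w y by rewrite mulr_ge0 ?powR_ge0 ?weight_ge0.
    apply: (@le_trans _ _ ((l ^- 2)%:E * mass (fun y => (fine (anc_avg g y) `^ 2 * w y)%R) B)%E).
      rewrite -massZ//; apply: le_esum => y [ny ly].
      rewrite lee_fin mulrA ler_peMl ?weight_ge0// powR_mulrn ?fine_ge0 ?anc_avg_ge0//.
      rewrite ler_pdivlMl ?exprn_gt0// mulr1.
      rewrite lerXn2r ?nnegrE ?(ltW l0) ?fine_ge0 ?anc_avg_ge0//; apply/ltW.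
      rewrite -lte_fin fineK ?ge0_fin_numE ?anc_avg_ge0//.
      exact: lt_le_trans ly (gT _ ny).
    rewrite lee_wpmul2l ?lee_fin//.
    by apply: le_esum_set => // y _; rewrite lee_fin.
  apply: (@le_trans _ _ ((l ^- 2)%:E * (C2%:E * ((Q * l)%:E * M)))%E).
    rewrite lee_wpmul2l ?lee_fin//.
    by apply: le_trans gL2 _; rewrite lee_wpmul2l// lee_fin ltW.
  rewrite !muleA -!EFinM le_eqVlt; apply/orP; left; apply/eqP; congr (_%:E * _)%E.
  by field; rewrite gt_eqF.
apply: (@le_trans _ _ (mass w Om + mass w B)%E); last first.
  rewrite (_ : (c + C2 * Q) / l = c / l + C2 * Q / l); last by rewrite mulrDl.
  by rewrite EFinD ge0_muleDl ?leeD// lee_fin divr_ge0// ?mulr_ge0// ltW.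
rewrite [leLHS](esumID Om); last by move=> y _; rewrite lee_fin weight_ge0.
apply: leeD.
  by apply: le_esum_set => [y []//|y _]; rewrite lee_fin weight_ge0.
by apply: le_esum_set => [y [ly ny]//|y _]; rewrite lee_fin weight_ge0.
Qed.

End WeakType.

(** * Harmonic functions, wavelets and the reproducing formula *)

Section Wavelets.
Context {R : realType} {T : choiceType} {q : nat} (X : horotree R T q).
Context (alpha : R) (alpha_gt1 : 1 < alpha).
Local Notation par := (par X).
Local Notation kid := (kid X).
Local Notation scale := (scale X).
Local Notation sec := (sec X).
Local Notation anc := (anc X).
Local Notation desc := (desc X).
Local Notation w := (weight X alpha).
Local Notation sector_sum := (sector_sum X alpha).
Local Notation anc_avg := (anc_avg X alpha).
Implicit Types f g : T -> R[i].

Definition tree_harmonic g : Prop :=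
  forall x, g x = (q.+1%:R)^-1 * (g (par x) + \sum_i g (kid x i)).

Definition grad g x := g x - g (par x).

Lemma arity_neq0C : q%:R != 0 :> R[i].
Proof. by rewrite pnatr_eq0 -lt0n (ltn_trans _ (arity_gt1 X)). Qed.

Lemma harmonic_kids g x : tree_harmonic g ->
  \sum_i g (kid x i) = q%:R * g x + grad g x.
Proof.
move=> /(_ x) h; have q1 : q.+1%:R != 0 :> R[i] by rewrite pnatr_eq0.
have e : g (par x) + \sum_i g (kid x i) = q.+1%:R * g x.
  by rewrite h mulrA mulfV// mul1r.
have -> : \sum_i g (kid x i) = q.+1%:R * g x - g (par x) by rewrite -e addrC addKr.
by rewrite -natr1 /grad; ring.
Qed.

(** The flux of the gradient through the children of a vertex equals the flux
    through the vertex. *)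
Lemma harmonic_grad_kids g x : tree_harmonic g ->
  \sum_i grad g (kid x i) = grad g x.
Proof.
move=> h; rewrite /grad sumrB harmonic_kids//.
under eq_bigr do rewrite kidK.
by rewrite sumr_const card_ord -mulr_natl /grad; ring.
Qed.

Lemma sum_desc_top (V : nmodType) n x (F : T -> V) :
  \sum_(y <- desc n.+1 x) F y = \sum_i \sum_(y <- desc n (kid x i)) F y.
Proof.
elim: n F => [|n ih] F.
  rewrite sum_desc /= big_seq1; apply: eq_bigr => i _; by rewrite big_seq1.
rewrite sum_desc ih; apply: eq_bigr => i _; by rewrite sum_desc.
Qed.

(** [q^-1 + q^-2 + ... + q^-n], built so as to match the recursion of
    harmonic functions. *)
Fixpoint geom n : R := if n is n'.+1 then (geom n' + 1) / q%:R else 0.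

Lemma geom_itv n : 0 <= geom n <= 1.
Proof.
have q0 := arity_gt0R X; have q1 := arity_gt1R X.
have q2 : 2 <= q%:R :> R by rewrite ler_nat (arity_gt1 X).
elim: n => [|n /andP[g0 g1]]; first by rewrite /= lexx ler01.
by rewrite /= divr_ge0 ?addr_ge0 ?(ltW q0)//= ler_pdivrMr// mul1r; lra.
Qed.

(** Conservation of the flux determines the mean of a harmonic function over
    each generation below [x] from its value and gradient at [x]. *)
Lemma sum_desc_harmonic g n x : tree_harmonic g ->
  \sum_(y <- desc n x) g y = q%:R ^+ n * (g x + grad g x * (geom n)%:C).
Proof.
move=> h; elim: n x => [|n ih] x.
  by rewrite /= big_seq1 expr0 mul1r mulr0 addr0.
rewrite sum_desc_top; under eq_bigr do rewrite ih.
rewrite -mulr_sumr big_split /= harmonic_kids// -mulr_suml harmonic_grad_kids//.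
rewrite exprS rmorphM rmorphD rmorph1 fmorphV rmorph_nat.
by field; exact: arity_neq0C.
Qed.

(** The harmonic function supported strictly below [par u] that grows in the
    same way with the generation below each child of [par u], with coefficient
    [1 - 1/q] below [u] and [- 1/q] below its siblings: the coefficients add up
    to 0, as harmonicity at [par u] requires. *)
Definition wavelet u y : R :=
  (1 - scale y / scale (par u)) *
  ((`[< sec u y >])%:R - q%:R^-1 * (`[< sec (par u) y >])%:R).

Lemma wavelet_out u y : ~ sec (par u) y -> wavelet u y = 0.
Proof.
move=> ny; rewrite /wavelet; case: asboolP => [uy|_].
  by case: ny; apply: sec_trans uy; exact: sec_par.
by case: asboolP => // _; rewrite mulr0 subr0 mulr0.
Qed.

Lemma wavelet_top u : wavelet u (par u) = 0.
Proof. by rewrite /wavelet mulfV ?subrr ?mul0r// scale_neq0. Qed.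

Lemma wavelet_bound u y : `|wavelet u y| <= 1.
Proof.
have q0 := arity_gt0R X; have q1 := arity_gt1R X.
have qi : 0 <= (q%:R : R)^-1 <= 1 by rewrite invr_ge0 ltW//= invf_le1 ?ltW.
have [zy|/wavelet_out->] := pselect (sec (par u) y); last by rewrite normr0.
rewrite normrM -[leRHS]mulr1 ler_pM//.
  have t1 : scale y / scale (par u) <= 1.
    by rewrite ler_pdivrMr ?scale_gt0// mul1r scale_sec.
  have t0 : 0 <= scale y / scale (par u) by rewrite divr_ge0 ?scale_ge0.
  by rewrite ger0_norm ?subr_ge0//; lra.
by rewrite ler_norml; case: asboolP; case: asboolP => _ _ /=; lra.
Qed.

(** Both [1] and [scale] are harmonic; the factor [1 - scale / scale (par u)]
    vanishes at [par u], where the other factor jumps. *)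
Lemma wavelet_harmonic u : tree_harmonic (fun y => (wavelet u y)%:C).
Proof.
set z := par u.
have q0 := arity_neq0 X; have qC := arity_neq0C.
have q1 : q.+1%:R != 0 :> R by rewrite pnatr_eq0.
suff h y : q.+1%:R * wavelet u y = wavelet u (par y) + \sum_i wavelet u (kid y i).
  move=> y; have -> : wavelet u y = q.+1%:R^-1 * (wavelet u (par y) + \sum_i wavelet u (kid y i)).
    by rewrite -h mulKf.
  by rewrite rmorphM fmorphV rmorph_nat rmorphD rmorph_sum.
have [zy|nzy] := pselect (sec z y); last first.
  rewrite wavelet_out// mulr0 wavelet_out; last first.
    by move=> /(@sec_trans _ _ _ X _ _ _)/(_ (sec_par X y)).
  rewrite big1 ?addr0// => i _; have [<-|ne] := eqVneq z (kid y i).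
    exact: wavelet_top.
  rewrite wavelet_out// => zk; apply: nzy; rewrite -(kidK X y i).
  by apply: sec_parE zk _ => e; move/eqP : ne; rewrite e.
have [->|yz] := eqVneq y z.
  rewrite wavelet_top mulr0 wavelet_out ?add0r; last first.
    exact: par_notin_sec.
  have [i0 ui0] := kid_surj X u.
  have kidE i : wavelet u (kid z i) = (1 - q%:R^-1) * ((i == i0)%:R - q%:R^-1).
    rewrite /wavelet -/z (_ : scale (kid z i) / scale z = q%:R^-1); last first.
      rewrite -[X in _ / scale X](kidK X z i) scale_par invfM mulrCA mulfV ?mulr1//.
      exact: scale_neq0.
    congr (_ * (_ - _)).
      congr ((nat_of_bool _)%:R); apply/asboolP/eqP => [[n e]|->].
        apply: (@kid_inj _ _ _ X z); rewrite -ui0 -e.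
        suff -> : n = 0%N by [].
        have /= := iter_par_inj (x := kid z i) (m := n.+1) (n := 1) (X := X).
        by rewrite e kidK => /(_ erefl) [].
      by rewrite -ui0; exact: sec_self.
    rewrite (_ : `[< _ >] = true) ?mulr1//; apply/asboolP.
    by exists 1%N; rewrite /= kidK.
  under eq_bigr do rewrite kidE.
  rewrite -mulr_sumr sumrB (bigD1 i0)//= eqxx big1 => [|i /negbTE->//].
  rewrite sumr_const card_ord addr0.
  by rewrite -[q%:R^-1 *+ q]mulr_natl mulfV// subrr mulr0.
have zyP : y <> z by apply/eqP.
pose c : R := (`[< sec u y >])%:R - q%:R^-1.
have inz v : sec z v -> wavelet u v =
    (1 - scale v / scale z) * ((`[< sec u v >])%:R - q%:R^-1).
  by rewrite /wavelet -/z => /asboolP ->; rewrite mulr1.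
have pary : wavelet u (par y) = (1 - scale (par y) / scale z) * c.
  have zpy := sec_parE zy zyP.
  have [pyz|pyz] := eqVneq (par y) z.
    by rewrite pyz wavelet_top mulfV ?scale_neq0// subrr mul0r.
  rewrite inz// /c; congr (_ * ((nat_of_bool _)%:R - _)); apply/asboolP/asboolP => uy.
    exact: sec_trans uy (sec_par X y).
  apply: sec_parE uy _ => yu; move/eqP : pyz; apply.
  by rewrite yu.
have kidy i : wavelet u (kid y i) = (1 - scale y / q%:R / scale z) * c.
  rewrite inz; last exact: sec_par_kid.
  rewrite (_ : scale (kid y i) = scale y / q%:R); last first.
    by rewrite -[in RHS](kidK X y i) scale_par mulrC mulKf.
  rewrite /c; congr (_ * ((nat_of_bool _)%:R - _)); apply/asboolP/asboolP => uy.
    rewrite -(kidK X y i); apply: sec_parE uy _ => e.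
    by move: zyP; rewrite /z -e kidK.
  by apply: sec_trans uy _; exists 1%N; rewrite /= kidK.
rewrite inz// pary scale_par; under eq_bigr do rewrite kidy.
rewrite sumr_const card_ord -mulr_natl -natr1 -/c.
by field; rewrite q0 scale_neq0.
Qed.

End Wavelets.
Arguments geom {R} q n.

(** * The projection as an integral operator *)

Section Projection.
Context {R : realType} {T : choiceType} {q : nat} (X : horotree R T q).
Context (alpha : R) (alpha_gt1 : 1 < alpha).
Local Notation par := (par X).
Local Notation kid := (kid X).
Local Notation scale := (scale X).
Local Notation sec := (sec X).
Local Notation anc := (anc X).
Local Notation desc := (desc X).
Local Notation w := (weight X alpha).
Local Notation sector_sum := (sector_sum X alpha).
Local Notation anc_avg := (anc_avg X alpha).
Local Notation wavelet := (wavelet X).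
Local Notation grad := (grad X).
Implicit Types f g : T -> R[i].

Definition modulus f x : R := cnorm (f x).

Lemma modulus_ge0 f x : 0 <= modulus f x. Proof. exact: cnorm_ge0. Qed.

Definition coef f u : R[i] :=
  csum [set: T] (fun y => f y * (wavelet u y * w y)%:C).

Lemma coef_asum f u :
  (asum [set: T] (fun y => f y * (wavelet u y * w y)%:C)%R <=
   sector_sum (modulus f) (par u))%E.
Proof.
rewrite /asum -(@esum_eq_supp _ _ (sec (par u)))//; last 2 first.
- by move=> y _; rewrite lee_fin cnorm_ge0.
- by move=> y _ ny; rewrite wavelet_out// mul0r mulr0 Normc.normc0.
apply: le_esum => y _; rewrite lee_fin cnormCM normrM (ger0_norm (weight_ge0 _ _ _)).
by rewrite ler_wpM2l ?cnorm_ge0// ler_piMl ?weight_ge0// wavelet_bound.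
Qed.

Lemma coef_bound f u : (sector_sum (modulus f) (par u) < +oo)%E ->
  ((cnorm (coef f u))%:E <= sector_sum (modulus f) (par u))%E.
Proof. exact: csum_leP (coef_asum f u). Qed.

(** ** Coefficients of harmonic functions *)

Local Notation Q := (q%:R `^ alpha).

(** The contribution of the [n]th generation below [par u] to the inner product
    of a harmonic function with the wavelet of [u], up to a factor that does
    not depend on [n]. *)
Definition kappa_term n : R :=
  if n is m.+1 then
    (1 - q%:R ^- m.+1) * (Q ^- m.+1 * (q%:R ^+ m * (1 + geom q m)))
  else 0.

Lemma arity_inv_itv n : 0 <= (q%:R : R) ^- n <= 1.
Proof.
have q0 := arity_gt0R X; have q1 := arity_gt1R X.
by rewrite invr_ge0 exprn_ge0 ?(ltW q0)//= invf_le1 ?exprn_gt0// exprn_ege1 ?ltW.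
Qed.

Lemma kappa_term_ge0 n : 0 <= kappa_term n.
Proof.
case: n => //= m; have /andP[q0 q1] := arity_inv_itv m.+1.
have /andP[g0 _] := geom_itv X m.
rewrite !mulr_ge0 ?subr_ge0 ?invr_ge0 ?exprn_ge0 ?powR_ge0//.
by rewrite addr_ge0.
Qed.

Lemma kappa_fin : (mass kappa_term [set: nat] < +oo)%E.
Proof.
have q0 := arity_gt0R X; have Q1 := arity_pow_gt1 X alpha_gt1.
have Q0 := lt_trans ltr01 Q1.
have x1 : 0 <= (q%:R / Q : R) < 1.
  have := arity_pow1B_lt1 X alpha_gt1.
  by rewrite powRB ?(gt_eqF q0) ?implybT// powRr1// ltW.
apply: (@le_lt_trans _ _ (\esum_(n in [set: nat]) (2 * (q%:R / Q) ^+ n)%:E)%E).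
  apply: le_esum => -[|m] _; rewrite lee_fin.
    by rewrite expr0 mulr1.
  have /andP[qi0 qi1] := arity_inv_itv m.+1.
  have /andP[g0 g1] := geom_itv X m.
  rewrite /= expr_div_n mulrCA.
  rewrite [leRHS](_ : _ = Q ^- m.+1 * (q%:R ^+ m.+1 * 2));
    last by rewrite mulrC [RHS]mulrA [_^-1 * _]mulrC.
  rewrite ler_wpM2l ?invr_ge0 ?exprn_ge0 ?(ltW Q0)//.
  have qm : q%:R ^+ m <= q%:R ^+ m.+1 :> R.
    by rewrite ler_weXn2l// ltW// (arity_gt1R X).
  have qm0 : 0 <= q%:R ^+ m :> R by rewrite exprn_ge0 ?ltW.
  apply: (@le_trans _ _ (q%:R ^+ m * (1 + geom q m))).
    by rewrite ler_piMl ?mulr_ge0//; lra.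
  by rewrite ler_pM//; lra.
by rewrite geometric_esum ?ltry.
Qed.

Definition kappa : R := fine (mass kappa_term [set: nat]).

Lemma kappa_gt0 : 0 < kappa.
Proof.
have q0 := arity_gt0R X; have q1 := arity_gt1R X.
have k1 : 0 < kappa_term 1.
  rewrite /= !expr1 expr0 mul1r addr0 mulr1 mulr_gt0 ?subr_gt0 ?invf_lt1//.
  by rewrite invr_gt0 powR_gt0.
rewrite -lte_fin fineK; last by apply: mass_fin; [exact: kappa_term_ge0|exact: kappa_fin].
apply: (@lt_le_trans _ _ (kappa_term 1)%:E); first by rewrite lte_fin.
apply: (esum_ge_term (x := 1%N) (a := fun n => (kappa_term n)%:E)) => // n _.
by rewrite lee_fin kappa_term_ge0.
Qed.

Lemma sum_desc_sec (F : T -> R[i]) n u :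
  \sum_(y <- desc n.+1 (par u)) F y * (`[< sec u y >])%:R = \sum_(y <- desc n u) F y.
Proof.
under eq_bigr do rewrite mulr_natr mulrb.
rewrite -big_mkcond -big_filter; apply: perm_big; apply: uniq_perm.
- exact/filter_uniq/desc_uniq.
- exact: desc_uniq.
move=> y; rewrite mem_filter; apply/andP/idP.
  move=> [/asboolP[m mu] /mem_desc nz]; apply/mem_desc.
  suff /eqP : m.+1 = n.+1 by rewrite eqSS => /eqP <-.
  by apply: (iter_par_inj (x := y) (X := X)); rewrite nz /= mu.
move=> /mem_desc nu; split; first by apply/asboolP; exists n.
by apply/mem_desc; rewrite /= nu.
Qed.

Lemma coef_level g n u : tree_harmonic X g ->
  \sum_(y <- desc n (par u)) g y * (wavelet u y * w y)%:C =
  (kappa_term n * w (par u))%:C * (grad g u - grad g (par u) / q%:R).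
Proof.
move=> h; set z := par u.
have qC := arity_neq0C X; have Q1 := arity_pow_gt1 X alpha_gt1.
have Q0 := lt_trans ltr01 Q1.
case: n => [|n]; first by rewrite /= big_seq1 wavelet_top !mul0r mulr0.
have e y : y \in desc n.+1 z -> g y * (wavelet u y * w y)%:C =
    ((1 - q%:R ^- n.+1) * (Q ^- n.+1 * w z))%:C *
    (g y * (`[< sec u y >])%:R - q%:R^-1 * g y).
  move=> /mem_desc yz.
  have zy : sec z y by exists n.+1.
  have -> : w y = Q ^- n.+1 * w z.
    by rewrite -yz weight_iter mulKf// expf_neq0// gt_eqF.
  have -> : wavelet u y = (1 - q%:R ^- n.+1) * ((`[< sec u y >])%:R - q%:R^-1).
    rewrite /wavelet -/z -{1}yz scale_iter invfM mulrCA mulfV ?mulr1 ?scale_neq0//.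
    by move/asboolP : zy => ->; rewrite mulr1.
  rewrite !(rmorphM, rmorphB, fmorphV, rmorph_nat)/=; ring.
rewrite (eq_big_seq _ e) -mulr_sumr sumrB -mulr_sumr sum_desc_sec.
rewrite !sum_desc_harmonic//=.
rewrite !(rmorphM, rmorphB, rmorphD, rmorph1, fmorphV, rmorphXn, rmorph_nat)/=.
have -> : g u = grad g u + g z by rewrite subrK.
rewrite !exprS.
have QC : (Q : R)%:C != 0 by rewrite fmorph_eq0 gt_eqF.
by field; rewrite qC QC !expf_neq0.
Qed.

(** By [sum_desc_harmonic] every generation contributes the same combination of
    gradients. *)
Lemma coef_harmonic g u : tree_harmonic X g ->
  (sector_sum (modulus g) (par u) < +oo)%E ->
  coef g u = (kappa * w (par u))%:C * (grad g u - grad g (par u) / q%:R).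
Proof.
move=> h fin; set z := par u; set d := (_ - _).
have finT := le_lt_trans (coef_asum g u) fin.
rewrite /coef (csum_supp (D := sec z)); last first.
  by move=> y ny; rewrite wavelet_out// mul0r mulr0.
apply: (csum_lim (exhausts_sec X z)).
  by apply: le_lt_trans finT; apply: le_esum_set => // y _; rewrite lee_fin cnorm_ge0.
have lim := mass_lim exhausts_nat kappa_term_ge0 kappa_fin.
have E N : cnorm (\sum_(y <- desc_upto X N z) g y * (wavelet u y * w y)%:C -
    (kappa * w z)%:C * d) =
    `|kappa - \sum_(n <- iota 0 N) kappa_term n| * (w z * cnorm d).
  rewrite sum_desc_upto; under eq_bigr do rewrite coef_level//.
  rewrite -mulr_suml -rmorph_sum -mulr_suml -mulrBl -rmorphB -mulrBl.
  rewrite Normc.normcM cnormC normrM (ger0_norm (weight_ge0 _ _ _)) mulrA distrC.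
  by rewrite -(big_mkord xpredT kappa_term) /index_iota subn0.
under eq_fun do rewrite E.
have h0 : (fun N => kappa - \sum_(n <- iota 0 N) kappa_term n) @ \oo -->
    kappa - kappa by apply: cvgB => //; exact: cvg_cst.
have h1 : (fun N => `|kappa - \sum_(n <- iota 0 N) kappa_term n| *
    (w z * cnorm d)) @ \oo --> `|kappa - kappa| * (w z * cnorm d).
  by apply: cvgM; [exact: cvg_norm h0|exact: cvg_cst].
by rewrite subrr normr0 mul0r in h1.
Qed.

(** ** The operator *)

(** Normalised so that it is the gradient combination
    [grad g u - grad g (par u) / q] on harmonic functions. *)
Definition ncoef f u : R[i] := coef f u * ((kappa * w (par u))^-1)%:C.

Lemma ncoef_harmonic g u : tree_harmonic X g ->
  (sector_sum (modulus g) (par u) < +oo)%E ->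
  ncoef g u = grad g u - grad g (par u) / q%:R.
Proof.
move=> h fin; rewrite /ncoef coef_harmonic// mulrAC -rmorphM mulfV ?mul1r//.
by rewrite mulf_neq0 ?weight_neq0// gt_eqF// kappa_gt0.
Qed.

Lemma ncoef_bound f u : (sector_sum (modulus f) (par u) < +oo)%E ->
  ((cnorm (ncoef f u))%:E <=
   kappa^-1%:E * ((w (par u))^-1%:E * sector_sum (modulus f) (par u)))%E.
Proof.
move=> fin; have k0 := kappa_gt0.
have i0 : 0 <= (kappa * w (par u))^-1.
  by rewrite invr_ge0 mulr_ge0 ?weight_ge0 ?(ltW k0).
rewrite cnormCM ger0_norm// EFinM muleC [leRHS]muleA -[X in (_ <= X * _)%E]EFinM -invfM.
by rewrite lee_wpmul2l ?lee_fin// coef_bound.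
Qed.

(** The weights for which the sum of [grad g v - grad g (par v) / q] over the
    [k]th ancestors [v] of [x] telescopes to [g x]. *)
Definition kern_const k : R := (1 - q%:R ^- k.+1) * (q%:R / (q%:R - 1)).

Lemma kern_const_itv k : 0 <= kern_const k <= 2.
Proof.
have /andP[q0 q1] := arity_inv_itv k.+1.
have q2 : 2 <= q%:R :> R by rewrite ler_nat (arity_gt1 X).
have a0 : 0 <= (q%:R / (q%:R - 1) : R) <= 2.
  by rewrite divr_ge0 ?ler_pdivrMr//=; lra.
move: a0 => /andP[a0 a2]; rewrite /kern_const mulr_ge0 ?subr_ge0//=.
nra.
Qed.

Definition berg_term f x k : R[i] := (kern_const k)%:C * ncoef f (iter k par x).

(** The projection as a series of wavelet coefficients along the ray of [x].
    The series makes sense on all the spaces of [berg_dom]. *)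
Definition berg f x : R[i] := csum [set: nat] (berg_term f x).

Definition berg_dom : set (T -> R[i]) :=
  [set f | forall x, (anc_avg (modulus f) x < +oo)%E].

Lemma le_anc_avg_sector f v x : sec v x ->
  ((w v)^-1%:E * sector_sum (modulus f) v <= anc_avg (modulus f) x)%E.
Proof.
move=> vx; apply: (esum_ge_term (x := v)
  (a := fun v => ((w v)^-1%:E * sector_sum (modulus f) v)%E)) => // y _.
exact/anc_avg_term_ge0/modulus_ge0.
Qed.

Lemma berg_dom_sector f v : berg_dom f -> (sector_sum (modulus f) v < +oo)%E.
Proof.
move=> /(_ v); have := le_anc_avg_sector f (sec_self X v).
have w0 := weight_gt0 X alpha v.
rewrite lee_pdivrMl// => /le_lt_trans h fin; apply: h.
by rewrite lte_mul_pinfty// lee_fin ltW.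
Qed.

Lemma berg_asum f x : berg_dom f ->
  (asum [set: nat] (berg_term f x) <=
   (2 / kappa)%:E * anc_avg (modulus f) x)%E.
Proof.
move=> fd; have k0 := kappa_gt0.
pose a v := ((w v)^-1%:E * sector_sum (modulus f) v)%E.
have a0 v : (0 <= a v)%E by exact/anc_avg_term_ge0/modulus_ge0.
apply: (@le_trans _ _ (\esum_(k in [set: nat]) ((2 / kappa)%:E * a (iter k.+1 par x)))%E).
  apply: le_esum => k _; have /andP[c0 c2] := kern_const_itv k.
  rewrite Normc.normcM cnormC ger0_norm// EFinM [(2 / _)%:E]EFinM -muleA.
  apply: lee_pmul; rewrite ?lee_fin ?cnorm_ge0//.
  by apply: ncoef_bound; exact: berg_dom_sector.
rewrite esumZl ?divr_ge0 ?(ltW k0)// lee_wpmul2l ?lee_fin ?divr_ge0 ?(ltW k0)//.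
rewrite -(esum_image _ (fun k => iter k.+1 par x)); last first.
  by move=> m n _ _ e; have [] := iter_par_inj e.
by apply: le_esum_set => // v [k _ <-]; exists k.+1.
Qed.

Lemma berg_asum_fin f x : berg_dom f -> (asum [set: nat] (berg_term f x) < +oo)%E.
Proof.
move=> fd; apply: le_lt_trans (berg_asum x fd) _.
rewrite lte_mul_pinfty ?fd// lee_fin divr_ge0// ltW//; exact: kappa_gt0.
Qed.

Lemma berg_bound f x : berg_dom f ->
  ((modulus (berg f) x)%:E <= (2 / kappa)%:E * anc_avg (modulus f) x)%E.
Proof.
move=> fd; apply: csum_leP (berg_asum x fd) _.
rewrite lte_mul_pinfty ?fd// lee_fin divr_ge0// ltW//; exact: kappa_gt0.
Qed.

Lemma modulusD_anc_avg k f g x :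
  (anc_avg (modulus (fun y => (k * f y + g y)%R)) x <=
   (cnorm k)%:E * anc_avg (modulus f) x + anc_avg (modulus g) x)%E.
Proof.
rewrite -anc_avgZ ?cnorm_ge0//; last exact: modulus_ge0.
rewrite -anc_avgD//; last exact: modulus_ge0.
  apply: le_anc_avg => v _; apply: le_sector_sum => y _.
  by rewrite /modulus (le_trans (cnormD _ _))// Normc.normcM.
by move=> y; rewrite mulr_ge0 ?cnorm_ge0.
Qed.

Lemma berg_dom_lin k f g : berg_dom f -> berg_dom g ->
  berg_dom (fun y => k * f y + g y).
Proof.
move=> fd gd x; apply: le_lt_trans (modulusD_anc_avg k f g x) _.
by rewrite lte_add_pinfty// lte_mul_pinfty ?lee_fin ?cnorm_ge0.
Qed.

Lemma coef_lin k f g u : (sector_sum (modulus f) (par u) < +oo)%E ->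
  (sector_sum (modulus g) (par u) < +oo)%E ->
  coef (fun y => k * f y + g y) u = k * coef f u + coef g u.
Proof.
move=> ff fg; have af := le_lt_trans (coef_asum f u) ff.
have ag := le_lt_trans (coef_asum g u) fg.
rewrite /coef -csumZ// -csumD//; last exact: asumZ_fin.
by apply: eq_csum => y _; rewrite mulrDl mulrA.
Qed.

Lemma ncoef_lin k f g u : (sector_sum (modulus f) (par u) < +oo)%E ->
  (sector_sum (modulus g) (par u) < +oo)%E ->
  ncoef (fun y => k * f y + g y) u = k * ncoef f u + ncoef g u.
Proof. by move=> ff fg; rewrite /ncoef coef_lin// mulrDl mulrA. Qed.

Lemma berg_lin k f g x : berg_dom f -> berg_dom g ->
  berg (fun y => k * f y + g y) x = k * berg f x + berg g x.
Proof.
move=> fd gd; have [af ag] := (berg_asum_fin x fd, berg_asum_fin x gd).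
rewrite /berg -csumZ// -csumD//; last exact: asumZ_fin.
apply: eq_csum => n _; rewrite /berg_term ncoef_lin; try exact: berg_dom_sector.
by ring.
Qed.

(** ** Reproducing formula *)

Lemma berg_partial g x N : tree_harmonic X g -> berg_dom g ->
  \sum_(k <- iota 0 N) berg_term g x k =
  g x - g (iter N par x) - ((1 - q%:R ^- N) / (q%:R - 1))%:C * grad g (iter N par x).
Proof.
move=> h gd.
have q0 := arity_neq0C X.
have q1 : q%:R - 1 != 0 :> R[i].
  by rewrite subr_eq0 pnatr_eq1 gtn_eqF// (arity_gt1 X).
elim: N => [|N ih]; first by rewrite big_nil /= expr0 invr1 !subrr !mul0r subrr.
rewrite -addn1 iotaD big_cat /= big_seq1 ih add0n addn1 /berg_term /kern_const.
rewrite ncoef_harmonic//; last exact: berg_dom_sector.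
rewrite !(rmorphM, rmorphB, rmorphD, rmorph1, fmorphV, rmorphXn, rmorph_nat)/=.
rewrite /grad exprS /=.
by field; rewrite ?q1 ?q0 ?expf_neq0.
Qed.

(** The decay of [g] along the ray removes the boundary terms of the telescoping
    sum. *)
Lemma berg_reproducing g x : tree_harmonic X g -> berg_dom g ->
  (fun N => cnorm (g (iter N par x))) @ \oo --> (0 : R) ->
  berg g x = g x.
Proof.
move=> h gd g0; apply: (csum_lim exhausts_nat); first exact: berg_asum_fin.
have g0S : (fun N => cnorm (g (iter N.+1 par x))) @ \oo --> (0 : R).
  by rewrite -(cvg_shiftS (fun N => cnorm (g (iter N par x)))) in g0.
apply: (@squeeze_cvgr _ _ _ _ (fun=> 0)
  (fun N => 2 * cnorm (g (iter N par x)) + cnorm (g (iter N.+1 par x)))).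
- near=> N; rewrite cnorm_ge0/= berg_partial//.
  set a := g (iter N par x); set b := g (iter N.+1 par x); set c := (_ / _).
  have c01 : 0 <= c <= 1.
    have /andP[qi0 qi1] := arity_inv_itv N.
    have q2 : 2 <= q%:R :> R by rewrite ler_nat (arity_gt1 X).
    by rewrite /c divr_ge0 ?ler_pdivrMr//=; lra.
  move: c01 => /andP[c0 c1].
  have -> : g x - a - c%:C * grad g (iter N par x) - g x = - (a + c%:C * (a - b)).
    by rewrite /grad -iterS -/a -/b; ring.
  rewrite cnormN (le_trans (cnormD _ _))// Normc.normcM cnormC ger0_norm//.
  have ab := cnormB a b; have := cnorm_ge0 (a - b); nra.
- exact: cvg_cst.
- have h2 : (fun N => 2 * cnorm (g (iter N par x)) + cnorm (g (iter N.+1 par x)))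
      @ \oo --> (2 * 0 + 0 : R).
    by apply: cvgD => //; apply: cvgM => //; exact: cvg_cst.
  by rewrite mulr0 addr0 in h2.
Unshelve. all: by end_near. Qed.

End Projection.
Arguments kappa {R} q alpha.

(** * Boundedness on Lebesgue spaces *)

Section Lebesgue.
Context {R : realType} {T : choiceType} {q : nat} (X : horotree R T q).
Context (alpha : R) (alpha_gt1 : 1 < alpha).
Local Notation par := (par X).
Local Notation sec := (sec X).
Local Notation w := (weight X alpha).
Local Notation Lp_mass := (Lp_mass X alpha).
Local Notation sector_sum := (sector_sum X alpha).
Local Notation anc_avg := (anc_avg X alpha).
Local Notation wavelet := (wavelet X).
Local Notation berg := (berg X alpha).
Local Notation berg_dom := (berg_dom X alpha).
Local Notation kappa := (kappa q alpha).
Implicit Types f g : T -> R[i].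

Lemma Lp_normE p f : Lp_norm w p f = (Lp_mass p (modulus f) `^ p^-1)%E.
Proof. by []. Qed.

Lemma Lp_mass_ge0 p (u : T -> R) : (0 <= Lp_mass p u)%E.
Proof. by apply: mass_ge0 => x; rewrite mulr_ge0 ?powR_ge0 ?weight_ge0. Qed.

Lemma Lp_domE p f : 0 < p ->
  fs_dom (Lp w p) f <-> (Lp_mass p (modulus f) < +oo)%E.
Proof.
move=> p0; rewrite /= Lp_normE; split; first by apply: lty_poweRy; rewrite invr_eq0 gt_eqF.
exact: poweR_lty.
Qed.

Lemma Lp_mass1 (u : T -> R) : (forall x, 0 <= u x) ->
  Lp_mass 1 u = mass (fun x => u x * w x) [set: T].
Proof. by move=> u0; congr mass; apply/funext => x; rewrite powRr1. Qed.

Lemma Lp_norm1 f : Lp_norm w 1 f = mass (fun x => modulus f x * w x) [set: T].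
Proof.
rewrite Lp_normE invr1 poweRe1 ?Lp_mass_ge0// Lp_mass1//; exact: modulus_ge0.
Qed.

Lemma L1_berg_dom : fs_dom (Lp w 1) `<=` berg_dom.
Proof.
move=> f /(Lp_domE f ltr01); rewrite Lp_mass1 => [fin x|]; last exact: modulus_ge0.
by apply: anc_avg_L1_fin => //; exact: modulus_ge0.
Qed.

Lemma Lp_berg_dom p : 1 < p -> fs_dom (Lp w p) `<=` berg_dom.
Proof.
move=> p1 f /(Lp_domE f (lt_trans ltr01 p1)) fin.
have [C _ /(_ _ (modulus_ge0 f) fin)[]//] := anc_avg_Lp X alpha_gt1 p1.
Qed.

Lemma berg_bounded_Lp p : 1 < p -> bounded_linear (Lp w p) (Lp w p) berg.
Proof.
move=> p1; have p0 := lt_trans ltr01 p1.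
have [C C0 HC] := anc_avg_Lp X alpha_gt1 p1.
have k0 := kappa_gt0 X alpha_gt1.
pose K := 2 / kappa; have K0 : 0 < K by rewrite divr_gt0.
have bd f : fs_dom (Lp w p) f -> (Lp_mass p (modulus (berg f)) <=
    (K `^ p * C)%:E * Lp_mass p (modulus f))%E.
  move=> fd; have [fin le] := HC _ (modulus_ge0 f) ((Lp_domE f p0).1 fd).
  rewrite EFinM -muleA; apply: le_trans (lee_wpmul2l _ le); last by rewrite lee_fin powR_ge0.
  rewrite -massZ ?powR_ge0// => [|x]; last by rewrite mulr_ge0 ?powR_ge0 ?weight_ge0.
  apply: le_esum => x _; rewrite lee_fin mulrA ler_wpM2r ?weight_ge0//.
  have T0 := anc_avg_ge0 X alpha x (modulus_ge0 f).
  rewrite -powRM ?(ltW K0) ?fine_ge0//= ge0_ler_powR ?nnegrE ?modulus_ge0 ?(ltW p0)//.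
    by rewrite mulr_ge0 ?(ltW K0) ?fine_ge0.
  have := berg_bound alpha_gt1 x (Lp_berg_dom p1 fd).
  rewrite -[anc_avg _ _]fineK ?lee_fin//.
  by rewrite ge0_fin_numE.
have dom f : fs_dom (Lp w p) f -> fs_dom (Lp w p) (berg f).
  move=> fd; apply/Lp_domE => //; apply: le_lt_trans (bd f fd) _.
  rewrite lte_mul_pinfty ?lee_fin ?mulr_ge0 ?powR_ge0 ?(ltW C0)//.
  exact/Lp_domE.
split; first exact: dom.
  move=> k f g fd gd; apply/funext => x.
  by apply: berg_lin => //; exact: (Lp_berg_dom p1).
exists ((K `^ p * C) `^ p^-1) => f fd /=; rewrite !Lp_normE.
have i0 : 0 <= p^-1 by rewrite invr_ge0 ltW.
have KC0 : 0 <= K `^ p * C by rewrite mulr_ge0 ?powR_ge0 ?ltW.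
rewrite -poweR_EFin -poweRM ?Lp_mass_ge0 ?lee_fin//.
have i0' : 0 <= p^-1 by [].
apply: gt0_ler_poweR => //; last exact: bd.
  by rewrite in_itv /= leey Lp_mass_ge0.
by rewrite in_itv /= leey mule_ge0 ?Lp_mass_ge0 ?lee_fin.
Qed.

(** ** Identification with the orthogonal projection *)

Definition tree_bergman : set (T -> R[i]) :=
  [set f | tree_harmonic X f /\ fs_dom (Lp w 2) f].

Lemma wavelet_bergman u : tree_bergman (fun y => (wavelet u y)%:C).
Proof.
split; first exact: wavelet_harmonic.
apply/Lp_domE => //; apply: (@le_lt_trans _ _ (mass w (sec (par u)))).
  have nn y : (0 <= (modulus (fun y => (wavelet u y)%:C) y `^ 2 * w y)%:E)%E.
    by rewrite lee_fin mulr_ge0 ?powR_ge0 ?weight_ge0.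
  rewrite /Lp_mass /mass -(@esum_eq_supp _ _ (sec (par u)))//.
    apply: le_esum => y _; rewrite lee_fin ler_piMl ?weight_ge0//.
    by rewrite /modulus cnormC powR_mulrn// exprn_ile1 ?wavelet_bound.
  move=> y _ ny; rewrite /modulus wavelet_out// cnormC normr0 powR0 ?mul0r//.
by rewrite sec_mass// ltry.
Qed.

(** A square summable function is small at vertices of large mass, and the
    masses grow geometrically towards the boundary point. *)
Lemma L2_decay g x : fs_dom (Lp w 2) g ->
  (fun N => cnorm (g (iter N par x))) @ \oo --> (0 : R).
Proof.
move=> /(Lp_domE g (ltr0n R 2)) fin.
have Q1 := arity_pow_gt1 X alpha_gt1; have Q0 := lt_trans ltr01 Q1.
set M := Lp_mass 2 _ in fin.
have M0 : (0 <= M)%E by exact: Lp_mass_ge0.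
have pt y : cnorm (g y) ^+ 2 * w y <= fine M.
  rewrite -lee_fin fineK ?ge0_fin_numE// -powR_mulrn ?cnorm_ge0//.
  apply: (esum_ge_term (x := y) (a := fun y => (cnorm (g y) `^ 2 * w y)%:E)) => // z _.
  by rewrite lee_fin mulr_ge0 ?powR_ge0 ?weight_ge0.
pose c := Num.sqrt (fine M / w x); pose r := Num.sqrt (q%:R `^ alpha)^-1.
have r1 : 0 <= r < 1.
  rewrite sqrtr_ge0 -sqrtr1 ltr_sqrt// invf_lt1//.
have c0 : 0 <= c by exact: sqrtr_ge0.
move: r1 => /andP[r0 r1].
apply: (@squeeze_cvgr _ _ _ _ (fun=> 0) (fun N => c * r ^+ N)).
- near=> N; rewrite cnorm_ge0 /=.
  rewrite -(@ler_pXn2r _ 2) ?nnegrE ?cnorm_ge0 ?mulr_ge0 ?exprn_ge0//.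
  rewrite exprMn -exprM mulnC exprM !sqr_sqrtr ?invr_ge0 ?(ltW Q0)//; last first.
    by rewrite divr_ge0 ?fine_ge0 ?weight_ge0.
  have := pt (iter N par x); rewrite weight_iter -ler_pdivlMr; last first.
    by rewrite mulr_gt0 ?exprn_gt0 ?weight_gt0.
  by rewrite invfM mulrA mulrAC exprVn.
- exact: cvg_cst.
- have h : (fun N => c * r ^+ N) @ \oo --> (c * 0 : R).
    apply: cvgM; first exact: cvg_cst.
    by apply: cvg_expr; rewrite ger0_norm.
  by rewrite mulr0 in h.
Unshelve. all: by end_near. Qed.

Context (P : (T -> R[i]) -> T -> R[i]).
Context (P_proj : orthogonal_projection w tree_bergman P).

(** The wavelets belong to the Bergman space, so [f - P f] is orthogonal to
    them. *)
Lemma proj_ncoef f u : fs_dom (Lp w 2) f -> ncoef X alpha f u = ncoef X alpha (P f) u.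
Proof.
move=> fd; have [[Ph Pd] orth] := P_proj fd.
have two1 : 1 < 2 :> R by rewrite ltr1n.
have sf := berg_dom_sector (par u) (Lp_berg_dom two1 fd).
have sP := berg_dom_sector (par u) (Lp_berg_dom two1 Pd).
have := orth _ (wavelet_bergman u).
have -> : inner w (fun x => f x - P f x) (fun y => (wavelet u y)%:C) =
    coef X alpha (fun x => -1 * P f x + f x) u.
  apply: eq_csum => y _ /=.
  by rewrite rmorphM/= oppr0 mulN1r [- _ + _]addrC mulrA.
rewrite coef_lin// mulN1r addrC => /eqP; rewrite subr_eq0 => /eqP e.
by rewrite /ncoef e.
Qed.

(** The series of [berg] only sees the coefficients, which are those of the
    harmonic function [P f]; on the latter the series is the identity. *)
Lemma proj_berg f : fs_dom (Lp w 2) f -> berg f = P f.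
Proof.
move=> fd; have [[Ph Pd] _] := P_proj fd.
have two1 : 1 < 2 :> R by rewrite ltr1n.
apply/funext => x.
have := berg_reproducing alpha_gt1 Ph (Lp_berg_dom two1 Pd) (L2_decay x Pd).
by move=> <-; apply: eq_csum => k _; rewrite /berg_term proj_ncoef.
Qed.

Lemma proj_Lp p : 1 < p -> extends_bounded w P (Lp w p) (Lp w p).
Proof.
move=> p1; exists berg; first exact: berg_bounded_Lp.
by move=> f _ /proj_berg.
Qed.

Lemma proj_weak : weak_type11 w P.
Proof.
have [C C0 HC] := anc_avg_weak X alpha_gt1.
have k0 := kappa_gt0 X alpha_gt1.
have [K KE] : exists K, K = 2 / kappa by exists (2 / kappa).
have K0 : 0 < K by rewrite KE divr_gt0.
exists (C * K); first by rewrite mulr_gt0.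
move=> l f l0 f1 f2; rewrite -proj_berg// Lp_norm1.
have := HC (modulus f) (l / K) (modulus_ge0 f); rewrite divr_gt0// => /(_ isT).
have fin : (mass (fun y => (modulus f y * w y)%R) [set: T] < +oo)%E.
  by move/(Lp_domE f ltr01) : f1; rewrite Lp_mass1//; exact: modulus_ge0.
move=> /(_ fin); rewrite invf_div mulrA; apply: le_trans.
apply: le_esum_set => [x /= lx|x _]; last by rewrite lee_fin weight_ge0.
have T0 := anc_avg_ge0 X alpha x (modulus_ge0 f).
have := berg_bound alpha_gt1 x (L1_berg_dom f1).
have finT := L1_berg_dom f1 x.
rewrite -[anc_avg _ _]fineK ?ge0_fin_numE// -KE lee_fin lte_fin ltr_pdivrMr// mulrC.
exact: lt_le_trans.
Qed.

End Lebesgue.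

(** * From the atomic Hardy space to [L^1] *)

Section Hardy.
Context {R : realType} {T : choiceType} {q : nat} (X : horotree R T q).
Context (alpha : R) (alpha_gt1 : 1 < alpha).
Local Notation par := (par X).
Local Notation scale := (scale X).
Local Notation sec := (sec X).
Local Notation anc := (anc X).
Local Notation w := (weight X alpha).
Local Notation Lp_mass := (Lp_mass X alpha).
Local Notation sector_sum := (sector_sum X alpha).
Local Notation anc_avg := (anc_avg X alpha).
Local Notation wavelet := (wavelet X).
Local Notation berg := (berg X alpha).
Local Notation berg_dom := (berg_dom X alpha).
Local Notation kappa := (kappa q alpha).
Implicit Types f g : T -> R[i].

Definition tree_sectors_points : set (set T) :=
  [set D | exists x, D = sec x \/ D = [set x]].
Local Notation Ds := tree_sectors_points.

(** An atom of a singleton vanishes, so every atom is one of a sector. *)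
Definition sector_atom z (a : T -> R[i]) : Prop :=
  [/\ forall x, ~ sec z x -> a x = 0,
      forall x, cnorm (a x) <= (sec_const q alpha * w z)^-1
    & csum (sec z) (fun x => a x * (w x)%:C) = 0].

Lemma csum0 (I : choiceType) (D : set I) : csum D (fun=> 0 : R[i]) = 0.
Proof.
have h : (asum D (fun=> 0%R : R[i]) < +oo)%E.
  by rewrite /asum esum1 ?ltry// => x _; rewrite Normc.normc0.
by have := csumZ 0 h; rewrite !mul0r.
Qed.

Lemma csum1 (I : choiceType) (x : I) (f : I -> R[i]) : csum [set x] f = f x.
Proof.
have aux (u : I -> R) : rsum [set x] u = u x.
  rewrite rsumE.
    by rewrite /mass !esum_set1 ?lee_fin ?rpos_ge0 ?rneg_ge0//= -rposneg.
  by rewrite /rabs esum_set1 ?lee_fin// ltry.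
by rewrite /csum !aux; case: (f x).
Qed.

Lemma atom_sector a : atom w Ds a -> exists z, sector_atom z a.
Proof.
move=> [D [z [->|->]] [a0 aoo az]]; exists z.
  split=> // x; rewrite -lee_fin.
  have -> : sec_const q alpha * w z = fine (mass w (sec z)) by rewrite sec_mass.
  by apply: le_trans aoo; apply: ereal_sup_ubound; exists x.
have {}a0 x : a x = 0.
  have [->|/eqP xz] := eqVneq x z; last exact: a0.
  move: az; rewrite csum1 => /eqP; rewrite mulf_eq0 => /orP[/eqP//|].
  by rewrite fmorph_eq0 (negbTE (weight_neq0 _ _ _)).
have c0 := sec_const_gt0 X alpha_gt1.
split=> // [x|]; first by rewrite a0 Normc.normc0 invr_ge0 mulr_ge0 ?weight_ge0 ?ltW.
rewrite -[RHS](csum0 (sec z)); apply: eq_csum => x _; by rewrite a0 mul0r.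
Qed.

Lemma sector_atom_L1 z a v : sector_atom z a -> (sector_sum (modulus a) v <= 1)%E.
Proof.
move=> [a0 ab _]; have c0 := sec_const_gt0 X alpha_gt1.
have cw0 : 0 < sec_const q alpha * w z by rewrite mulr_gt0 ?weight_gt0.
apply: (@le_trans _ _ (mass (fun y => (modulus a y * w y)%R) [set: T])).
  by apply: le_esum_set => // y _; rewrite lee_fin mulr_ge0 ?modulus_ge0 ?weight_ge0.
rewrite /mass -(@esum_eq_supp _ _ (sec z))//; last 2 first.
- by move=> y _; rewrite lee_fin mulr_ge0 ?modulus_ge0 ?weight_ge0.
- by move=> y _ ny; rewrite /modulus a0// Normc.normc0 mul0r.
apply: (@le_trans _ _ ((sec_const q alpha * w z)^-1%:E * mass w (sec z))%E).
  rewrite -massZ ?invr_ge0 ?(ltW cw0)//; last by move=> y; exact: weight_ge0.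
  by apply: le_esum => y _; rewrite lee_fin ler_wpM2r ?weight_ge0 ?ab.
by rewrite sec_mass// -EFinM mulVf// gt_eqF.
Qed.

Lemma sector_atom_dom z a : sector_atom z a -> berg_dom a.
Proof.
move=> /[dup] az [a0 _ _] x; apply: anc_avg_L1_fin => //; first exact: modulus_ge0.
apply: le_lt_trans (ltry 1); rewrite /mass -(@esum_eq_supp _ _ (sec z))//.
- exact: sector_atom_L1 az.
- by move=> y _; rewrite lee_fin mulr_ge0 ?modulus_ge0 ?weight_ge0.
- by move=> y _ ny; rewrite /modulus a0// Normc.normc0 mul0r.
Qed.

(** Any exponent strictly between [0] and [alpha - 1] would do. *)
Definition hardy_exp : R := (alpha - 1) / 2.

Lemma hardy_exp_itv : 0 < hardy_exp < alpha - 1.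
Proof. rewrite /hardy_exp divr_gt0 ?subr_gt0//= ltr_pdivrMr// mulr_natr mulr2n.
by rewrite ltrDl subr_gt0. Qed.

(** On the sector itself, its indicator is dominated by the eigenfunction
    [scale ^ (- s)], normalised at [z]. *)
Lemma sector_atom_local z a : sector_atom z a ->
  (\esum_(x in sec z) ((w x)%:E * anc_avg (modulus a) x) <=
   (schur_const q alpha hardy_exp * sec_const q (alpha - hardy_exp) /
     sec_const q alpha)%:E)%E.
Proof.
move=> [a0 ab _]; set s := hardy_exp; have /andP[s0 sa] := hardy_exp_itv.
have c0 := sec_const_gt0 X alpha_gt1.
set A := (_ * w z)^-1 in ab.
have A0 : 0 <= A by rewrite invr_ge0 mulr_ge0 ?weight_ge0 ?ltW.
pose B := A * scale z `^ s; have B0 : 0 <= B by rewrite mulr_ge0 ?powR_ge0.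
have schur0 := schur_const_gt0 X hardy_exp_itv.
have aB y : modulus a y <= B * scale y `^ (- s).
  have [zy|nzy] := pselect (sec z y); last first.
    by rewrite /modulus a0// Normc.normc0 mulr_ge0 ?powR_ge0.
  rewrite (le_trans (ab y))// /B -mulrA ler_peMr// powRN.
  rewrite ler_pdivlMr ?scale_pow_gt0// mul1r.
  by rewrite ge0_ler_powR ?nnegrE ?scale_ge0 ?(ltW s0) ?scale_sec.
pose K := B * schur_const q alpha s.
have K0 : 0 <= K by rewrite mulr_ge0// ltW.
apply: (@le_trans _ _ (\esum_(x in sec z) (K%:E * (scale x `^ (alpha - s))%:E))%E).
  apply: le_esum => x _.
  apply: (@le_trans _ _ ((w x)%:E * (B * (schur_const q alpha s * scale x `^ (- s)))%:E)%E).
    apply: lee_wpmul2l; first by rewrite lee_fin weight_ge0.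
    rewrite EFinM -(anc_avg_pow X x hardy_exp_itv) -anc_avgZ//; last first.
      by move=> y; exact: powR_ge0.
    by apply: le_anc_avg => v _; apply: le_sector_sum => y _.
  rewrite -!EFinM lee_fin powRD ?scale_neq0 ?implybT// -/(w x) le_eqVlt.
  by apply/orP; left; apply/eqP; rewrite /K; ring.
rewrite esumZl//; last by move=> y _; rewrite lee_fin powR_ge0.
rewrite -/(mass _ _) sec_pow; last by rewrite ltrBrDr addrC -ltrBrDr.
rewrite -EFinM lee_fin powRD ?scale_neq0 ?implybT// powRN -/(w z) le_eqVlt.
apply/orP; left; apply/eqP; rewrite /K /B /A.
by field; rewrite (gt_eqF c0) gt_eqF ?scale_pow_gt0// weight_neq0.
Qed.

(** Outside the sector of an atom the wavelet is, on that sector, a constant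
    plus a multiple of [scale]; the mean value zero of the atom removes the
    constant. *)
Lemma sector_atom_coef z a u : sector_atom z a -> ~ sec z (par u) ->
  sec (par u) z ->
  cnorm (coef X alpha a u) <= scale z / scale (par u).
Proof.
move=> /[dup] az [a0 ab am] nzu uz.
have nu : sec z u -> sec u z.
  move=> zu; have [->|/eqP uz'] := eqVneq u z; first exact: sec_self.
  by case: nzu; exact: sec_parE.
have p0 := scale_gt0 X (par u).
(* On the sector of [z] the second factor of the wavelet is constant. *)
pose c : R := (`[< sec u z >])%:R - q%:R^-1.
have c1 : `|c| <= 1.
  have q0 := arity_gt0R X; have q1 := arity_gt1R X.
  have : 0 <= (q%:R : R)^-1 <= 1 by rewrite invr_ge0 ltW//= invf_le1 ?ltW.
  by rewrite /c ler_norml; case: asboolP => _ /= /andP[? ?]; lra.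
have wE y : sec z y -> wavelet u y = c - c * (scale y / scale (par u)).
  move=> zy; rewrite /wavelet (_ : `[< sec (par u) y >] = true); last first.
    by apply/asboolP; exact: sec_trans uz zy.
  have -> : `[< sec u y >] = `[< sec u z >].
    apply/asboolP/asboolP => [uy|uz']; last exact: sec_trans uz' zy.
    by have [//|/nu] := sec_comparable uy zy.
  by rewrite -/c mulr1 mulrBl mul1r mulrC.
pose F y := a y * (w y)%:C.
pose G y := a y * (c * (scale y / scale (par u)) * w y)%:C.
have finF : (asum (sec z) F < +oo)%E.
  apply: le_lt_trans (ltry 1); apply: le_trans (sector_atom_L1 z az).
  by apply: le_esum => y _; rewrite lee_fin cnormCM ger0_norm ?weight_ge0.
have boundG : (asum (sec z) G <= (scale z / scale (par u))%:E)%E.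
  rewrite -[leRHS]mule1; apply: le_trans (lee_wpmul2l _ (sector_atom_L1 z az)).
    rewrite -esumZl ?divr_ge0 ?scale_ge0//; last first.
      by move=> y _; rewrite lee_fin mulr_ge0 ?modulus_ge0 ?weight_ge0.
    apply: le_esum => y zy; rewrite lee_fin cnormCM [leRHS]mulrCA.
    rewrite ler_wpM2l ?cnorm_ge0// normrM [X in _ * X]ger0_norm ?weight_ge0//.
    rewrite ler_wpM2r ?weight_ge0// normrM [X in _ * X]ger0_norm ?divr_ge0 ?scale_ge0//.
    rewrite (le_trans (ler_piMl _ c1)) ?divr_ge0 ?scale_ge0//.
    by rewrite ler_wpM2r ?invr_ge0 ?scale_ge0 ?scale_sec.
  by rewrite lee_fin divr_ge0 ?scale_ge0.
have finG : (asum (sec z) G < +oo)%E := le_lt_trans boundG (ltry _).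
have -> : coef X alpha a u = - csum (sec z) G.
  have -> : coef X alpha a u = csum (sec z) (fun y => c%:C * F y - G y).
    rewrite /coef (csum_supp (D := sec z)); last by move=> y ny; rewrite a0// mul0r.
    apply: eq_csum => y zy; rewrite wE// /F /G.
    rewrite !(rmorphM, rmorphB)/=; ring.
  rewrite csumB//; last exact: asumZ_fin.
  by rewrite csumZ// am mulr0 sub0r.
by rewrite cnormN -lee_fin (csum_leP boundG)// ltry.
Qed.

(** The sectors of [z] and of [par u] are disjoint. *)
Lemma disjoint_coef z a u : (forall x, ~ sec z x -> a x = 0) ->
  ~ sec z (par u) -> ~ sec (par u) z -> coef X alpha a u = 0.
Proof.
move=> a0 nzu nuz; rewrite -[RHS](csum0 [set: T]); apply: eq_csum => y _.
have [zy|/a0->] := pselect (sec z y); last by rewrite mul0r.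
rewrite wavelet_out ?mul0r ?mulr0// => uy.
by have [] := sec_comparable zy uy.
Qed.

Lemma sector_atom_far z a x : sector_atom z a -> ~ sec z x ->
  ((cnorm (berg a x))%:E <= \esum_(v in anc x `&` anc z)
     (2 / kappa * ((w v)^-1 * (scale z / scale v)))%:E)%E.
Proof.
move=> /[dup] az [a0 _ _] nx; have ad := sector_atom_dom az.
have k0 := kappa_gt0 X alpha_gt1.
have b0 v : 0 <= 2 / kappa * ((w v)^-1 * (scale z / scale v)).
  by rewrite !mulr_ge0 ?invr_ge0 ?weight_ge0 ?scale_ge0 ?(ltW k0).
apply: le_trans (csum_le (berg_asum_fin alpha_gt1 x ad)) _.
pose b v := if `[< sec v z >] then 2 / kappa * ((w v)^-1 * (scale z / scale v)) else 0.
have b'0 v : 0 <= b v by rewrite /b; case: ifP.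
apply: (@le_trans _ _ (\esum_(k in [set: nat]) (b (iter k.+1 par x))%:E)%E).
  apply: le_esum => k _; set u := iter k par x.
  have nu : ~ sec z u by move=> zu; apply: nx; exact: sec_trans zu (sec_iter _ _ _).
  have nzu : ~ sec z (par u) by move=> zu; apply: nu; exact: sec_trans zu (sec_par _ _).
  have /andP[c0 c2] := kern_const_itv X k.
  rewrite lee_fin /berg_term Normc.normcM cnormC ger0_norm//.
  apply: (@le_trans _ _ (2 * cnorm (ncoef X alpha a u))).
    by rewrite ler_wpM2r ?cnorm_ge0.
  have i0 : 0 <= (kappa * w (par u))^-1.
    by rewrite invr_ge0 mulr_ge0 ?weight_ge0 ?(ltW k0).
  rewrite /ncoef cnormCM ger0_norm// /b -/u iterS -/u; case: asboolP => uz.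
    rewrite -mulrA ler_wpM2l// mulrC invfM -mulrA ler_wpM2l ?invr_ge0 ?(ltW k0)//.
    by rewrite ler_wpM2l ?invr_ge0 ?weight_ge0// (sector_atom_coef az).
  by rewrite (disjoint_coef a0 nzu uz) Normc.normc0 mul0r mulr0.
rewrite -(esum_image _ (fun k => iter k.+1 par x) (fun v => (b v)%:E)); last first.
  by move=> m n _ _ e; have [] := iter_par_inj e.
apply: (@le_trans _ _ (\esum_(v in anc x) (b v)%:E)%E).
  apply: le_esum_set => [v [k _ <-]|v _]; first by exists k.+1.
  by rewrite lee_fin.
rewrite -(@esum_eq_supp _ _ (anc x `&` anc z))//.
- by apply: le_esum => v [_ zv]; rewrite /b; move/asboolP : zv => ->.
- by move=> v _; rewrite lee_fin.
by move=> v xv nv; rewrite /b; case: asboolP => // zv; case: nv.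
Qed.

Definition hardy_const : R :=
  2 / kappa * (schur_const q alpha hardy_exp * sec_const q (alpha - hardy_exp) /
     sec_const q alpha) + 2 / kappa * sec_const q alpha * anc_const q 1.

Lemma hardy_const_gt0 : 0 < hardy_const.
Proof.
have k0 := kappa_gt0 X alpha_gt1; have /andP[s0 sa] := hardy_exp_itv.
have c0 := sec_const_gt0 X alpha_gt1; have a0 := anc_const_gt0 X (ltr01 : 0 < 1 :> R).
have as1 : 1 < alpha - hardy_exp by lra.
have sec0 := sec_const_gt0 X as1; have schur0 := schur_const_gt0 X hardy_exp_itv.
have kk0 : 0 < 2 / kappa by rewrite divr_gt0.
apply: addr_gt0; apply: mulr_gt0 => //; last exact: mulr_gt0.
by apply: divr_gt0 => //; exact: mulr_gt0.
Qed.

(** Near the sector the atom is controlled by its size, and away from it by the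
    factor [scale z / scale v] due to cancellation, which makes the sum over
    the ancestors [v] of [z] a geometric series. *)
Lemma sector_atom_bound z a : sector_atom z a ->
  (mass (fun x => (modulus (berg a) x * w x)%R) [set: T] <= hardy_const%:E)%E.
Proof.
move=> az; have ad := sector_atom_dom az.
have k0 := kappa_gt0 X alpha_gt1; have c0 := sec_const_gt0 X alpha_gt1.
have kk0 : 0 <= 2 / kappa by rewrite divr_ge0// ltW.
have nn x : (0 <= (modulus (berg a) x * w x)%:E)%E.
  by rewrite lee_fin mulr_ge0 ?modulus_ge0 ?weight_ge0.
rewrite /mass (esumID (sec z))// !setTI EFinD leeD//.
  rewrite EFinM; apply: le_trans (lee_wpmul2l _ (sector_atom_local az)); last first.
    by rewrite lee_fin.
  rewrite -esumZl//; last first.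
    by move=> x _; rewrite mule_ge0 ?anc_avg_ge0 ?lee_fin ?weight_ge0//; exact: modulus_ge0.
  apply: le_esum => x _; rewrite mulrC EFinM muleCA.
  by apply: lee_wpmul2l; [rewrite lee_fin weight_ge0|exact: berg_bound].
pose b v := 2 / kappa * ((w v)^-1 * (scale z / scale v)).
have b0 v : 0 <= b v.
  by rewrite !mulr_ge0 ?invr_ge0 ?weight_ge0 ?scale_ge0 ?(ltW k0).
apply: (@le_trans _ _ (\esum_(x in [set: T]) \esum_(v in anc x `&` anc z)
    (w x * b v)%:E)%E).
  apply: (@le_trans _ _ (\esum_(x in ~` sec z) \esum_(v in anc x `&` anc z)
    (w x * b v)%:E)%E).
    apply: le_esum => x nx; rewrite mulrC EFinM.
    under eq_esum do rewrite EFinM.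
    rewrite esumZl ?weight_ge0//; last by move=> v _; rewrite lee_fin.
    by apply: lee_wpmul2l; [rewrite lee_fin weight_ge0|exact: sector_atom_far].
  apply: le_esum_set => // x _; apply: esum_ge0 => v _.
  by rewrite lee_fin mulr_ge0 ?weight_ge0.
rewrite (@esum_swap _ _ _ _ _ (fun v => sec v) (anc z)); last 2 first.
- by move=> x v; split => [[_ []]|[]].
- by move=> x v _ _; rewrite lee_fin mulr_ge0 ?weight_ge0.
rewrite (@eq_esum _ _ _ _ (fun v =>
    (2 / kappa * sec_const q alpha * scale z)%:E * (scale v `^ (- 1))%:E)%E); last first.
  move=> v _; under eq_esum do rewrite mulrC EFinM.
  rewrite esumZl//; last by move=> x _; rewrite lee_fin weight_ge0.
  rewrite -/(mass _ _) sec_mass// -!EFinM; congr EFin.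
  rewrite powR_inv1 ?scale_ge0// /b.
  by field; rewrite scale_neq0 weight_neq0 gt_eqF.
rewrite esumZl; last 2 first.
- by rewrite mulr_ge0 ?scale_ge0// mulr_ge0// ltW.
- by move=> v _; rewrite lee_fin powR_ge0.
rewrite -/(mass _ _) anc_pow// -EFinM lee_fin powR_inv1 ?scale_ge0// le_eqVlt.
apply/orP; left; apply/eqP.
by field; rewrite scale_neq0 gt_eqF.
Qed.

(** ** Atomic series *)

Lemma anc_avg_L1 f x : (anc_avg (modulus f) x <=
  (anc_const q alpha * scale x `^ (- alpha))%:E * Lp_norm w 1 f)%E.
Proof.
have al0 : 0 < alpha by apply: lt_trans alpha_gt1.
rewrite Lp_norm1 -anc_pow// muleC -esumZl_ereal; last 2 first.
- by apply: mass_ge0 => y; rewrite mulr_ge0 ?modulus_ge0 ?weight_ge0.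
- by move=> v _; rewrite lee_fin powR_ge0.
apply: le_esum => v _; rewrite muleC powRN lee_wpmul2r ?le_sector_total//.
  by rewrite lee_fin invr_ge0 weight_ge0.
exact: modulus_ge0.
Qed.

Lemma berg_dom_sum (I : Type) (s : seq I) (lam : I -> R[i]) (a : I -> T -> R[i]) :
  (forall i, berg_dom (a i)) -> berg_dom (fun x => \sum_(i <- s) lam i * a i x).
Proof.
move=> ad; elim: s => [|i s ih].
  rewrite (_ : (fun x => _) = (fun=> 0)); last by apply/funext => x; rewrite big_nil.
  move=> x; rewrite /anc_avg esum1 ?ltry// => v _.
  rewrite /sector_sum /mass esum1 ?mule0// => y _.
  by rewrite /modulus Normc.normc0 mul0r.
rewrite (_ : (fun x => _) = (fun x => lam i * a i x + \sum_(j <- s) lam j * a j x)).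
  exact: berg_dom_lin.
by apply/funext => x; rewrite big_cons.
Qed.

Lemma berg_sum (I : Type) (s : seq I) (lam : I -> R[i]) (a : I -> T -> R[i]) x :
  (forall i, berg_dom (a i)) ->
  berg (fun x => \sum_(i <- s) lam i * a i x) x = \sum_(i <- s) lam i * berg (a i) x.
Proof.
move=> ad; elim: s => [|i s ih].
  rewrite big_nil -[RHS](csum0 [set: nat]); apply: eq_csum => k _.
  rewrite /berg_term /ncoef (_ : coef _ _ _ _ = 0) ?mul0r ?mulr0//.
  rewrite -[RHS](csum0 [set: T]); apply: eq_csum => y _.
  by rewrite big_nil mul0r.
rewrite (_ : (fun y => _) = (fun y => lam i * a i y + \sum_(j <- s) lam j * a j y)).
  by rewrite (berg_lin alpha_gt1 _ _ (ad i) (berg_dom_sum _ _ ad)) ih big_cons.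
by apply/funext => y; rewrite big_cons.
Qed.

(** The operator is continuous from [L^1] to the values at a given vertex, so it
    can be applied to an atomic series term by term. *)
Lemma atomic_berg_bound f lam a : fs_dom (Lp w 1) f ->
  atomic_decomposition w Ds f lam a ->
  (Lp_norm w 1 (berg f) <=
     hardy_const%:E * \sum_(0 <= i <oo) (cnorm (lam i))%:E)%E.
Proof.
move=> f1 [atoms lamfin cvf].
have k0 := kappa_gt0 X alpha_gt1.
have fd := L1_berg_dom alpha_gt1 f1.
have ad i : berg_dom (a i) by have [z /sector_atom_dom] := atom_sector (atoms i).
have ab i : (mass (fun x => (modulus (berg (a i)) x * w x)%R) [set: T] <=
    hardy_const%:E)%E by have [z /sector_atom_bound] := atom_sector (atoms i).
pose t x i : \bar R := (cnorm (lam i) * cnorm (berg (a i) x))%:E.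
have t0 x i : (0 <= t x i)%E by rewrite lee_fin mulr_ge0 ?cnorm_ge0.
have pointwise x : ((cnorm (berg f x))%:E <= \esum_(i in [set: nat]) t x i)%E.
  apply/lee_addgt0Pr => e e0.
  pose c := 2 / kappa * (anc_const q alpha * scale x `^ (- alpha)).
  have al0 : 0 < alpha by apply: lt_trans alpha_gt1.
  have c0 : 0 < c.
    rewrite mulr_gt0 ?divr_gt0// mulr_gt0 ?scale_pow_gt0//.
    exact: anc_const_gt0 X _ al0.
  pose F n := fun y => \sum_(i < n) lam i * a i y.
  have FE n : F n = fun y => \sum_(0 <= i < n) lam i * a i y.
    by apply/funext => y; rewrite (big_mkord xpredT (fun i => lam i * a i y)).
  have [n hn] : exists n, (Lp_norm w 1 (fun y => f y - F n y)%R < (e / c)%:E)%E.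
    have : nbhs (0%E : \bar R) [set y | (y < (e / c)%:E)%E].
      apply: open_nbhs_nbhs; split; first exact: open_ereal_lt_ereal.
      by rewrite /= lte_fin divr_gt0.
    by move=> /cvf[n _ hn]; exists n; apply: (hn n) => /=.
  pose r y := f y - F n y.
  have Fd : berg_dom (F n) by rewrite FE; exact: berg_dom_sum.
  have rE : r = (fun y => -1 * F n y + f y).
    by apply/funext => y; rewrite mulN1r addrC.
  have rd : berg_dom r by rewrite rE; exact: berg_dom_lin.
  have -> : berg f x = berg r x + \sum_(i < n) lam i * berg (a i) x.
    rewrite rE berg_lin//.
    suff -> : berg (F n) x = \sum_(i < n) lam i * berg (a i) x.
      by ring.
    have e1 := berg_sum (index_iota 0 n) lam x ad.
    by rewrite FE e1 (big_mkord xpredT (fun i => lam i * berg (a i) x)).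
  apply: (@le_trans _ _ ((cnorm (berg r x))%:E +
      \sum_(i < n) t x i)%E).
    rewrite sumEFin -EFinD lee_fin (le_trans (cnormD _ _))// lerD2l.
    rewrite (le_trans (cnorm_sum _ _))//.
    by apply: ler_sum => i _; rewrite Normc.normcM.
  rewrite addeC leeD//.
    rewrite -nneseries_esumT// -(big_mkord xpredT (t x)).
    exact: nneseries_lim_ge.
  apply: le_trans (berg_bound alpha_gt1 x rd) _.
  apply: le_trans (lee_wpmul2l _ (anc_avg_L1 r x)) _.
    by rewrite lee_fin divr_ge0// ltW.
  rewrite muleA -EFinM -/c -lee_pdivlMl// -EFinM mulrC.
  exact: ltW.
rewrite Lp_norm1 nneseries_esumT; last by move=> i; rewrite lee_fin cnorm_ge0.
apply: (@le_trans _ _ (\esum_(x in [set: T]) \esum_(i in [set: nat])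
    (cnorm (lam i) * (modulus (berg (a i)) x * w x))%:E)%E).
  apply: le_esum => x _.
  rewrite (@eq_esum _ _ _ _ (fun i => (w x)%:E * t x i)%E); last first.
    by move=> i _; rewrite -EFinM; congr EFin; rewrite /modulus mulrA mulrC.
  rewrite (esumZl (weight_ge0 _ _ _) (fun i _ => t0 x i)) mulrC EFinM.
  by apply: lee_wpmul2l; [rewrite lee_fin weight_ge0|exact: pointwise].
rewrite (@esum_swap _ _ _ _ _ (fun=> [set: T]) [set: nat])//; last first.
  by move=> x i _ _; rewrite lee_fin !mulr_ge0 ?cnorm_ge0 ?weight_ge0.
rewrite -esumZl ?(ltW hardy_const_gt0)//; last first.
  by move=> i _; rewrite lee_fin cnorm_ge0.
apply: le_esum => i _; under eq_esum do rewrite EFinM.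
rewrite esumZl ?cnorm_ge0//; last first.
  by move=> x _; rewrite lee_fin mulr_ge0 ?modulus_ge0 ?weight_ge0.
rewrite muleC lee_wpmul2r ?lee_fin ?cnorm_ge0//; exact: ab.
Qed.

Lemma berg_bounded_H1 : bounded_linear (H1 w Ds) (Lp w 1) berg.
Proof.
have C0 := hardy_const_gt0.
split.
- move=> f [f1 [lam [a dec]]] /=.
  apply: le_lt_trans (atomic_berg_bound f1 dec) _.
  have [_ fin _] := dec.
  by rewrite lte_mul_pinfty// lee_fin ltW.
- move=> k f g [f1 _] [g1 _]; apply/funext => x.
  by apply: berg_lin => //; exact: L1_berg_dom.
- exists hardy_const => f [f1 [lam [a dec]]] /=.
  rewrite -lee_pdivrMl//; apply: le_ereal_inf_tmp => _ [lam' [a' [dec' ->]]].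
  rewrite (lee_pdivrMl _ _ C0).
  exact: atomic_berg_bound f1 dec'.
Qed.

End Hardy.

(** * From [L^oo] to [BMO] *)

Section Oscillation.
Context {R : realType} {T : choiceType} {q : nat} (X : horotree R T q).
Context (alpha : R) (alpha_gt1 : 1 < alpha).
Local Notation par := (par X).
Local Notation scale := (scale X).
Local Notation sec := (sec X).
Local Notation anc := (anc X).
Local Notation w := (weight X alpha).
Local Notation sector_sum := (sector_sum X alpha).
Local Notation kappa := (kappa q alpha).
Local Notation Ds := (tree_sectors_points X).
Local Notation ncoef := (ncoef X alpha).
Local Notation grad := (grad X).
Implicit Types f g F : T -> R[i].

Lemma csum_real (D : set T) (u : T -> R) : (forall x, 0 <= u x) ->
  (mass u D < +oo)%E -> csum D (fun x => (u x)%:C) = (fine (mass u D))%:C.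
Proof.
move=> u0 fin; congr Complex.
  rewrite (@rsum_diff _ _ D _ u (fun=> 0))//=.
  - by rewrite [X in _ - fine X]esum1 ?subr0.
  - by rewrite [X in (X < _)%E]esum1 ?ltry.
  - by move=> x _; rewrite subr0.
by rewrite /rsum !esum1 ?subrr// => x _; rewrite ?funeposE ?funenegE /= ?oppr0 maxxx.
Qed.

(** The mean differs from [c] by at most the mean oscillation around [c]. *)
Lemma oscillation_mean (D : set T) F (c : R[i]) :
  0 < fine (mass w D) -> (mass w D < +oo)%E ->
  (\esum_(x in D) (cnorm (F x - c) * w x)%:E < +oo)%E ->
  (\esum_(x in D) (cnorm (F x - mean w D F) * w x)%:E <=
   2%:E * \esum_(x in D) (cnorm (F x - c) * w x)%:E)%E.
Proof.
move=> m0 mfin; set O := (\esum_(x in D) (cnorm (F x - c) * w x)%:E)%E => Ofin.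
have nn (z : R[i]) x : 0 <= cnorm z * w x by rewrite mulr_ge0 ?cnorm_ge0 ?weight_ge0.
have O0 : (0 <= O)%E by apply: esum_ge0 => x _; rewrite lee_fin.
have mE : mass w D = (fine (mass w D))%:E.
  by rewrite fineK// mass_fin// => x; exact: weight_ge0.
pose G x := (F x - c) * (w x)%:C.
have aG : asum D G = O.
  by apply: eq_esum => x _; rewrite cnormCM ger0_norm ?weight_ge0.
have aw : (asum D (fun x => (w x)%:C) < +oo)%E.
  by apply: le_lt_trans mfin; apply: le_esum => x _; rewrite cnormC ger0_norm ?weight_ge0.
have meanE : mean w D F - c = ((fine (mass w D))^-1)%:C * csum D G.
  rewrite /mean (_ : csum D (fun x => F x * (w x)%:C) =
      csum D G + c * (fine (mass w D))%:C).
    rewrite mulrDr mulrCA -rmorphM mulVf ?gt_eqF// mulr1.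
    by rewrite addrK.
  rewrite -csum_real//; last by move=> x; exact: weight_ge0.
  rewrite -csumZ// -csumD ?aG//; last exact: asumZ_fin.
  by apply: eq_csum => x _; rewrite /G; ring.
have bound : ((cnorm (mean w D F - c))%:E * mass w D <= O)%E.
  rewrite meanE Normc.normcM cnormC ger0_norm ?invr_ge0 ?(ltW m0)// mE -EFinM /=.
  rewrite mulrAC mulVf ?gt_eqF// mul1r -aG; apply: csum_le.
  by rewrite aG.
apply: (@le_trans _ _ (O + (cnorm (mean w D F - c))%:E * mass w D)%E).
  rewrite -massZ ?cnorm_ge0//; last by move=> x; exact: weight_ge0.
  rewrite /O /mass -esumD; try by move=> x _; rewrite lee_fin.
  apply: le_esum => x _; rewrite -EFinD lee_fin -mulrDl ler_wpM2r ?weight_ge0//.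
  have -> : F x - mean w D F = (F x - c) - (mean w D F - c) by ring.
  exact: cnormB.
rewrite (_ : 2%:E * O = O + O)%E ?leeD2l//.
by rewrite (_ : 2%:E = 1%:E + 1%:E)%E ?ge0_muleDl ?mul1e// ?lee_fin.
Qed.

(** The number of steps from [x] up to [z] is written as a sum over ancestors,
    to be exchanged with the sum over [x]. *)
Lemma gradient_sum F L z n x : (forall y, cnorm (grad F y) <= L) ->
  iter n par x = z ->
  ((cnorm (F x - F z))%:E <= \esum_(v in anc x `&` sec z) L%:E)%E.
Proof.
move=> FL; have L0 : 0 <= L := le_trans (cnorm_ge0 _) (FL z).
have nnL (A : set T) : (0 <= \esum_(v in A) L%:E)%E.
  by apply: esum_ge0 => v _; rewrite lee_fin.
elim: n x => [|n ih] x.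
  by move=> <-; rewrite subrr Normc.normc0.
rewrite iterSr => xz; have {}ih := ih _ xz.
rewrite (esumID [set x]); last by move=> v _; rewrite lee_fin.
rewrite (_ : anc x `&` sec z `&` [set x] = [set x]); last first.
  apply/seteqP; split => [v []//|v ->]; split=> //; split; first exact: sec_self.
  by exists n.+1; rewrite iterSr.
rewrite esum_set1 ?lee_fin//.
apply: (@le_trans _ _ ((L + cnorm (F (par x) - F z))%:E)).
  rewrite lee_fin.
  have -> : F x - F z = grad F x + (F (par x) - F z) by rewrite /grad; ring.
  by rewrite (le_trans (cnormD _ _))// lerD2r FL.
rewrite EFinD leeD2l//; apply: le_trans ih _; apply: le_esum_set => [v [xv zv]|v _].
  split; first by split=> //; exact: sec_trans xv (sec_par X x).
  by move=> /= vx; move: xv; rewrite vx; exact: par_notin_sec.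
by rewrite lee_fin.
Qed.

(** A function with bounded gradient oscillates over a sector by at most the
    mean distance to its vertex, which is bounded since the masses of the
    generations decay geometrically. *)
Lemma gradient_BMO F L : (forall y, cnorm (grad F y) <= L) ->
  (BMO_norm w Ds F <= (2 * (sec_const q alpha ^+ 2 * L))%:E)%E.
Proof.
move=> FL; have c0 := sec_const_gt0 X alpha_gt1.
apply: ge_ereal_sup => _ [D [z Dz] <-].
have L0 : 0 <= L := le_trans (cnorm_ge0 _) (FL z).
have w0 := weight_gt0 X alpha.
have [Dz0 Dsec] : D z /\ D `<=` sec z.
  case: Dz => ->; first by split=> //; exact: sec_self.
  by split=> // y ->; exact: sec_self.
have nnw y : (0 <= (w y)%:E)%E by rewrite lee_fin weight_ge0.
have mle : (mass w D <= (sec_const q alpha * w z)%:E)%E.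
  by rewrite -sec_mass//; exact: le_esum_set.
have mfin : (mass w D < +oo)%E := le_lt_trans mle (ltry _).
have mE : mass w D = (fine (mass w D))%:E.
  by rewrite fineK// mass_fin// => x; exact: weight_ge0.
have mge : w z <= fine (mass w D).
  rewrite -lee_fin -mE.
  by apply: (esum_ge_term (x := z) (a := fun y => (w y)%:E)).
have m0 : 0 < fine (mass w D) := lt_le_trans (w0 z) mge.
have osc : (\esum_(x in D) (cnorm (F x - F z) * w x)%:E <=
    (sec_const q alpha ^+ 2 * L * w z)%:E)%E.
  apply: (@le_trans _ _ (\esum_(x in sec z) (cnorm (F x - F z) * w x)%:E)%E).
    by apply: le_esum_set => // y _; rewrite lee_fin mulr_ge0 ?cnorm_ge0 ?weight_ge0.
  apply: (@le_trans _ _ (\esum_(x in sec z) \esum_(v in anc x `&` sec z) (L * w x)%:E)%E).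
    apply: le_esum => x [n xz]; rewrite mulrC EFinM.
    rewrite (@eq_esum _ _ _ _ (fun=> (w x)%:E * L%:E)%E); last first.
      by move=> v _; rewrite -EFinM mulrC.
    rewrite esumZl ?weight_ge0//.
    by apply: lee_wpmul2l; [exact: nnw|exact: gradient_sum xz].
  rewrite (@esum_swap _ _ _ _ _ (fun v => sec v) (sec z)); last 2 first.
  - move=> x v; split=> [[_ []//]|[zv vx]]; split=> //; exact: sec_trans zv vx.
  - by move=> x v _ _; rewrite lee_fin mulr_ge0 ?weight_ge0.
  rewrite (@eq_esum _ _ _ _ (fun v => (L * sec_const q alpha)%:E * (w v)%:E)%E).
    rewrite esumZl ?mulr_ge0 ?(ltW c0)//.
    rewrite -/(mass _ _) sec_mass// -EFinM lee_fin le_eqVlt; apply/orP; left.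
    by apply/eqP; ring.
  move=> v _; under eq_esum do rewrite EFinM.
  by rewrite esumZl// -/(mass _ _) sec_mass// -!EFinM mulrA.
rewrite lee_pdivrMl//.
apply: le_trans (oscillation_mean m0 mfin (le_lt_trans osc (ltry _))) _.
apply: le_trans (lee_wpmul2l _ osc) _; first by rewrite lee_fin.
rewrite -!EFinM lee_fin [leRHS]mulrC !mulrA; apply: ler_wpM2l => //.
by rewrite !mulr_ge0// ltW.
Qed.

(** ** The gradient of the projection *)

Definition berg_grad_term f x k : R[i] :=
  (q%:R ^- k)%:C * ncoef f (iter k par x).

(** The gradient of the projection of [f]: unlike the projection itself, it is
    given by an absolutely convergent series for every bounded [f]. *)
Definition berg_grad f x : R[i] := csum [set: nat] (berg_grad_term f x).

Definition sup_bounded f (B : R) := forall x, cnorm (f x) <= B.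

Lemma bounded_sector f B v : sup_bounded f B ->
  (sector_sum (modulus f) v <= (B * (sec_const q alpha * w v))%:E)%E.
Proof.
move=> fB; have B0 := le_trans (cnorm_ge0 _) (fB v).
rewrite EFinM -sec_mass// -massZ//; last by move=> x; exact: weight_ge0.
by apply: le_esum => x _; rewrite lee_fin ler_wpM2r ?weight_ge0 ?fB.
Qed.

Definition ncoef_const := kappa^-1 * sec_const q alpha.

Lemma ncoef_const_gt0 : 0 < ncoef_const.
Proof.
by apply: mulr_gt0; [rewrite invr_gt0 (kappa_gt0 X)|exact: (sec_const_gt0 X)].
Qed.

Lemma bounded_ncoef f B u : sup_bounded f B ->
  cnorm (ncoef f u) <= ncoef_const * B.
Proof.
move=> fB; have fin := le_lt_trans (bounded_sector (par u) fB) (ltry _).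
have k0 := kappa_gt0 X alpha_gt1; have w0 := weight_gt0 X alpha (par u).
rewrite -lee_fin; apply: le_trans (ncoef_bound alpha_gt1 fin) _.
rewrite /ncoef_const -mulrA EFinM; apply: lee_wpmul2l.
  by rewrite lee_fin invr_ge0 ltW.
rewrite lee_pdivrMl//; apply: le_trans (bounded_sector _ fB) _.
rewrite -EFinM lee_fin le_eqVlt; apply/orP; left; apply/eqP; ring.
Qed.

Lemma geometric_inv : (0 <= (q%:R : R)^-1 < 1).
Proof.
by rewrite invr_ge0 ltW ?(arity_gt0R X)//= invf_lt1 ?(arity_gt1R X)// (arity_gt0R X).
Qed.

Lemma berg_grad_asum f B x : sup_bounded f B ->
  (asum [set: nat] (berg_grad_term f x) <=
    (ncoef_const / (1 - q%:R^-1) * B)%:E)%E.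
Proof.
move=> fB; have B0 := le_trans (cnorm_ge0 _) (fB x).
have n0 := ltW ncoef_const_gt0.
rewrite mulrAC -(geometric_esum (mulr_ge0 n0 B0) geometric_inv).
apply: le_esum => k _; rewrite lee_fin Normc.normcM cnormC.
have i0 : 0 <= (q%:R ^- k : R) by have /andP[] := arity_inv_itv X k.
by rewrite ger0_norm// exprVn mulrC ler_wpM2r// bounded_ncoef.
Qed.

Lemma berg_grad_bound f B x : sup_bounded f B ->
  cnorm (berg_grad f x) <= ncoef_const / (1 - q%:R^-1) * B.
Proof.
by move=> fB; rewrite -lee_fin; apply: csum_leP (berg_grad_asum x fB) (ltry _).
Qed.

Lemma berg_grad_lin k f g B B' x : sup_bounded f B -> sup_bounded g B' ->
  berg_grad (fun y => k * f y + g y) x = k * berg_grad f x + berg_grad g x.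
Proof.
move=> fB gB.
have af := le_lt_trans (berg_grad_asum x fB) (ltry _).
have ag := le_lt_trans (berg_grad_asum x gB) (ltry _).
rewrite /berg_grad -(csumZ _ af) -(csumD (asumZ_fin _ af) ag).
apply: eq_csum => n _; rewrite /berg_grad_term ncoef_lin; first by ring.
  exact: le_lt_trans (bounded_sector _ fB) (ltry _).
exact: le_lt_trans (bounded_sector _ gB) (ltry _).
Qed.

(** The same telescoping as for [berg], with geometric weights. *)
Lemma berg_grad_reproducing g x : tree_bergman X alpha g ->
  (asum [set: nat] (berg_grad_term g x) < +oo)%E -> berg_grad g x = grad g x.
Proof.
move=> [gh gd] fin; apply: (csum_lim exhausts_nat) => //.
have two1 : 1 < 2 :> R by rewrite ltr1n.
have gdom := Lp_berg_dom alpha_gt1 two1 gd.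
have qC := arity_neq0C X.
have E N : \sum_(k <- iota 0 N) berg_grad_term g x k =
    grad g x - (q%:R ^- N)%:C * grad g (iter N par x).
  elim: N => [|N ih]; first by rewrite big_nil /= expr0 invr1 mul1r subrr.
  rewrite -addn1 iotaD big_cat /= big_seq1 ih add0n addn1 /berg_grad_term.
  rewrite ncoef_harmonic//; last exact: berg_dom_sector.
  rewrite exprS /= !(rmorphM, fmorphV, rmorphXn, rmorph_nat)/=.
  by field; rewrite ?qC ?expf_neq0.
have d0 := L2_decay alpha_gt1 x gd.
have d1 : (fun N => cnorm (g (iter N.+1 par x))) @ \oo --> (0 : R).
  by rewrite -(cvg_shiftS (fun N => cnorm (g (iter N par x)))) in d0.
apply: (@squeeze_cvgr _ _ _ _ (fun=> 0)
  (fun N => cnorm (g (iter N par x)) + cnorm (g (iter N.+1 par x)))).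
- near=> N; rewrite cnorm_ge0/= E addrAC subrr sub0r cnormN Normc.normcM cnormC.
  have /andP[i0 i1] := arity_inv_itv X N.
  by rewrite ger0_norm// (le_trans (ler_piMl _ i1)) ?cnorm_ge0// cnormB.
- exact: cvg_cst.
- have h : (fun N => cnorm (g (iter N par x)) + cnorm (g (iter N.+1 par x)))
      @ \oo --> (0 + 0 : R) by exact: cvgD.
  by rewrite addr0 in h.
Unshelve. all: by end_near. Qed.

(** ** Integrating the gradient *)

Definition path_sum (e : T -> R[i]) n x : R[i] := \sum_(j < n) e (iter j par x).

Lemma path_sumD e n d x :
  path_sum e (n + d) x = path_sum e n x + path_sum e d (iter n par x).
Proof.
rewrite /path_sum big_split_ord /=; congr (_ + _).
by apply: eq_bigr => j _; rewrite addnC iterD.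
Qed.

Lemma path_sum_indep e x o n m n' m' :
  iter n par x = iter m par o -> iter n' par x = iter m' par o ->
  path_sum e n x - path_sum e m o = path_sum e n' x - path_sum e m' o.
Proof.
wlog le : n m n' m' / (n <= n')%N => [wl h h'|].
  by have [le|/ltnW le] := leqP n n'; [|symmetry]; exact: wl.
move=> h; rewrite -(subnK le) addnC; set d := (n' - n)%N => h'.
have -> : m' = (m + d)%N.
  by apply: (iter_par_inj (X := X) (x := o)); rewrite -h' addnC iterD h -iterD addnC.
by rewrite !path_sumD h; ring.
Qed.

Definition confluence x o : {nm : nat * nat | iter nm.1 par x = iter nm.2 par o}.
Proof.
by apply: cid; have [n [m h]] := par_confl X x o; exists (n, m).
Defined.

(** The function with gradient [e] that vanishes at [o]. *)
Definition primitive o (e : T -> R[i]) x : R[i] :=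
  path_sum e (sval (confluence x o)).1 x - path_sum e (sval (confluence x o)).2 o.

Lemma grad_primitive o e x : grad (primitive o e) x = e x.
Proof.
rewrite /grad /primitive.
case: (confluence x o) => -[n m] /= h; case: (confluence (par x) o) => -[n' m'] /= h'.
rewrite (path_sum_indep e (n' := n'.+1) (m' := m') h); last by rewrite iterSr.
rewrite -add1n path_sumD {1}/path_sum big_ord_recl big_ord0 /=.
by ring.
Qed.

Lemma primitive_lin o k (e e' : T -> R[i]) x :
  primitive o (fun y => k * e y + e' y) x = k * primitive o e x + primitive o e' x.
Proof.
have lin n y : path_sum (fun y => k * e y + e' y) n y = k * path_sum e n y + path_sum e' n y.
  by rewrite /path_sum big_split /= mulr_sumr.
by rewrite /primitive !lin; ring.
Qed.

Lemma path_sum_grad F n x : path_sum (grad F) n x = F x - F (iter n par x).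
Proof.
elim: n => [|n ih]; first by rewrite /path_sum big_ord0 subrr.
by rewrite -addn1 path_sumD ih {1}/path_sum big_ord_recl big_ord0 /grad addn1 /=; ring.
Qed.

Lemma primitive_grad o F x : primitive o (grad F) x = F x - F o.
Proof.
rewrite /primitive; case: (confluence x o) => -[n m] /= h.
by rewrite !path_sum_grad h; ring.
Qed.

Lemma eq_primitive o e e' : e =1 e' -> primitive o e =1 primitive o e'.
Proof. by move=> ee x; congr (_ - _); apply: eq_bigr => j _. Qed.

Lemma Linfty_ge f x : ((cnorm (f x))%:E <= Linfty_norm f)%E.
Proof. by apply: ereal_sup_ubound; exists x. Qed.

Lemma Linfty_fineK (o : T) f : fs_dom Linfty f ->
  (fine (Linfty_norm f))%:E = Linfty_norm f.
Proof.
move=> fin; rewrite fineK// ge0_fin_numE//.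
by apply: le_trans (Linfty_ge f o); rewrite lee_fin cnorm_ge0.
Qed.

Lemma Linfty_bounded (o : T) f : fs_dom Linfty f ->
  sup_bounded f (fine (Linfty_norm f)).
Proof. by move=> fin x; rewrite -lee_fin (Linfty_fineK o fin) Linfty_ge. Qed.

Context (P : (T -> R[i]) -> T -> R[i]).
Context (P_proj : orthogonal_projection w (tree_bergman X alpha) P).

(** The extension is the function whose gradient is [berg_grad f]; fixing its
    value at one vertex makes it linear in [f]. *)
Lemma proj_Linfty_BMO (o : T) : extends_bounded w P Linfty (BMO w Ds).
Proof.
pose L B := ncoef_const / (1 - q%:R^-1) * B : R.
have bmo f : fs_dom Linfty f ->
    (BMO_norm w Ds (primitive o (berg_grad f)) <=
     (2 * (sec_const q alpha ^+ 2 * L (fine (Linfty_norm f))))%:E)%E.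
  move=> fd; apply: gradient_BMO => y; rewrite grad_primitive.
  exact/berg_grad_bound/Linfty_bounded.
exists (fun f => primitive o (berg_grad f)); first split.
- by move=> f fd /=; apply: le_lt_trans (bmo f fd) (ltry _).
- move=> k f g fd gd; exists 0 => x; rewrite addr0 -primitive_lin.
  apply: eq_primitive => y.
  exact: berg_grad_lin (Linfty_bounded o fd) (Linfty_bounded o gd).
- exists (2 * (sec_const q alpha ^+ 2 * (ncoef_const / (1 - q%:R^-1)))) => f fd /=.
  apply: le_trans (bmo f fd) _; rewrite /L.
  rewrite -[in leRHS](Linfty_fineK o fd).
  by rewrite -EFinM lee_fin !mulrA.
- move=> f fd f2; exists (- P f o) => x.
  have fB := Linfty_bounded o fd.
  have [Pb _] := P_proj f2.
  rewrite -[RHS](primitive_grad o (P f) x); apply: eq_primitive => y.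
  have termE : berg_grad_term f y = berg_grad_term (P f) y.
    by apply/funext => k; rewrite /berg_grad_term (proj_ncoef alpha_gt1 P_proj).
  have fin : (asum [set: nat] (berg_grad_term (P f) y) < +oo)%E.
    by rewrite -termE; exact: le_lt_trans (berg_grad_asum y fB) (ltry _).
  by rewrite -(berg_grad_reproducing Pb fin) /berg_grad termE.
Qed.

End Oscillation.

(** * The combinatorics of a homogeneous tree seen from a boundary point *)

Section TreeGeometry.
Context {T : choiceType} (q : nat) (adj : rel T) (omega : set (nat -> T)).
Context (tree : homogeneous_tree q adj) (bdry : boundary_point adj omega).
Implicit Types (x y z : T) (a b c : nat -> T).

Let adj_irr : irreflexive adj. Proof. by have [] := tree. Qed.
Let adj_sym : symmetric adj. Proof. by have [] := tree. Qed.

(** A non-backtracking closed walk would contain a simple cycle: a closed walk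
    of minimal length has no repeated vertex. *)
Lemma walk_open n c : (0 < n)%N -> (forall i, (i < n)%N -> adj (c i) (c i.+1)) ->
  (forall i, (i.+1 < n)%N -> c i <> c i.+2) -> c 0%N <> c n.
Proof.
have [_ _ _ acyclic _] := tree.
elim/ltn_ind: n c => n ih c n0 step nb c0n.
have dist_ij i j : (i < j)%N -> (j <= n)%N -> (j - i < n)%N -> c i <> c j.
  move=> ij jn lt e; apply: (ih (j - i)%N lt (fun k => c (i + k)%N)).
  - by rewrite subn_gt0.
  - by move=> k kji; rewrite addnS; apply: step; lia.
  - by move=> k kji; rewrite !addnS; apply: nb; lia.
  - by rewrite addn0 subnKC// ltnW.
case: n n0 step nb c0n ih dist_ij => [//|[|[|n]]] _ step nb c0n _ dist_ij.
- by have := step 0%N isT; rewrite -c0n adj_irr.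
- exact: (nb 0%N isT).
apply: (acyclic (mkseq c n.+3)); first by rewrite size_mkseq.
apply/andP; split; last first.
  apply/(mkseq_uniqP _ _) => i j; rewrite !inE => iN jN e.
  have [lt|lt|//] := ltngtP i j.
    by exfalso; apply: (dist_ij i j) => //; lia.
  by exfalso; apply: (dist_ij j i) => //; lia.
pose d i := c i.+1.
have E : mkseq c n.+3 = c 0%N :: mkseq d n.+2.
  by rewrite /mkseq -[iota 0 _]/(0%N :: iota (1 + 0) n.+2) map_cons iotaDl -map_comp.
rewrite E /cycle {2}c0n -[c n.+3]/(d n.+2) -mkseqS.
apply/(pathP (c 0%N)) => i; rewrite size_mkseq => iN.
rewrite nth_mkseq//; case: i iN => [|i] iN /=; first exact: step.
by rewrite nth_mkseq; [exact: step|exact: ltnW].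
Qed.

(** Equivalence of chains without integer shifts. *)
Definition same_tail c c' : Prop := exists k l, forall i, c (k + i)%N = c' (l + i)%N.

Lemma chain_equivP c c' : chain_equiv c c' <-> same_tail c c'.
Proof.
split=> [[m [N _ h]]|[k [l h]]].
  exists (N + `|m|)%N, (absz ((N + `|m|)%:Z + m)) => i.
  rewrite h /=; last by rewrite -addnA leq_addr.
  by congr c'; lia.
exists (l%:Z - k%:Z); exists k => // i /= ki.
by rewrite -{1}(subnKC ki) h; congr c'; lia.
Qed.

Lemma omegaP : exists2 c0, chain adj c0 &
  forall c, omega c <-> chain adj c /\ same_tail c0 c.
Proof.
have [c0 c0P ->] := bdry; exists c0 => // c.
by split=> [[cc /chain_equivP]|[cc h]]//; split=> //; apply/chain_equivP.
Qed.

Lemma omega_chain c : omega c -> chain adj c.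
Proof. by have [c0 _ h] := omegaP; move=> /h[]. Qed.

Lemma omega_tail a b : omega a -> omega b -> same_tail a b.
Proof.
have [c0 _ h] := omegaP; move=> /h[_ [k [l e]]] /h[_ [k' [l' e']]].
exists (l + k')%N, (l' + k)%N => i.
by rewrite -!addnA -e -e'; congr c0; lia.
Qed.

Lemma omega_closed a b : omega a -> chain adj b -> same_tail a b -> omega b.
Proof.
have [c0 _ h] := omegaP; move=> /h[_ [k [l e]]] cb [k' [l' e']]; apply/h; split=> //.
exists (k + k')%N, (l' + l)%N => i.
by rewrite -!addnA e addnCA e'.
Qed.

Lemma chain_shift c : chain adj c -> chain adj (fun i => c i.+1).
Proof. by move=> h i; exact: h i.+1. Qed.

Lemma omega_shift c : omega c -> omega (fun i => c i.+1).
Proof.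
move=> oc; apply: (omega_closed oc); first exact/chain_shift/omega_chain.
by exists 1%N, 0%N => i; rewrite add1n.
Qed.

(** Two chains of one class that part at their first step would close up to a
    non-backtracking closed walk where they meet again. *)
Lemma omega_first_step a b : omega a -> omega b -> a 0%N = b 0%N -> a 1%N = b 1%N.
Proof.
move=> oa ob e0; have [ca cb] := (omega_chain oa, omega_chain ob).
have [l [l' e]] := omega_tail oa ob.
apply: contrapT => e1.
pose c t := if (t <= l.+1)%N then a (l.+1 - t)%N else b (t - l.+1)%N.
apply: (@walk_open (l.+1 + l'.+1) c) => //.
- move=> i iN; rewrite /c; case: (leqP i l.+1) => il.
    case: (leqP i.+1 l.+1) => il'.
      rewrite adj_sym (_ : l.+1 - i = (l.+1 - i.+1).+1)%N; last by lia.
      by have [] := ca (l.+1 - i.+1)%N.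
    rewrite (_ : l.+1 - i = 0)%N; last by lia.
    rewrite e0 (_ : i.+1 - l.+1 = 1)%N; last by lia.
    by have [] := cb 0%N.
  rewrite ifF; last by lia.
  rewrite (_ : i.+1 - l.+1 = (i - l.+1).+1)%N; last by lia.
  by have [] := cb (i - l.+1)%N.
- move=> i iN; rewrite /c; case: (leqP i l.+1) => il.
    case: (leqP i.+2 l.+1) => il'.
      rewrite (_ : l.+1 - i = (l.+1 - i.+2).+2)%N; last by lia.
      by have [_ h] := ca (l.+1 - i.+2)%N => /esym/h.
    have [il2|il2] := eqVneq i l.+1.
      rewrite il2 subnn e0 (_ : l.+3 - l.+1 = 2)%N; last by lia.
      by have [_] := cb 0%N.
    rewrite (_ : l.+1 - i = 1)%N; last by lia.
    by rewrite (_ : i.+2 - l.+1 = 1)%N; last by lia.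
  rewrite ifF; last by lia.
  rewrite (_ : i.+2 - l.+1 = (i - l.+1).+2)%N; last by lia.
  by have [_] := cb (i - l.+1)%N.
- rewrite /c leq0n subn0 ifF; last by lia.
  by rewrite (_ : l.+1 + l'.+1 - l.+1 = l' + 1)%N; [rewrite -e addn1|lia].
Qed.

Lemma omega_uniq a b : omega a -> omega b -> a 0%N = b 0%N -> a =1 b.
Proof.
move=> oa ob e0 i; elim: i a b oa ob e0 => [//|i ih] a b oa ob e0.
exact: (ih _ _ (omega_shift oa) (omega_shift ob) (omega_first_step oa ob e0)).
Qed.

(** Follow a shortest walk from [x] to a chain of the class, then the chain. *)
Lemma omega_exists x : exists2 c, omega c & c 0%N = x.
Proof.
have [c0 c0P h] := omegaP; have [_ _ conn _ _] := tree.
pose W n := `[< exists a m, [/\ a 0%N = x, forall i, adj (a i) (a i.+1) &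
  forall i, a (n + i)%N = c0 (m + i)%N] >].
have exW : exists n, W n.
  have [p [px lp]] := conn x (c0 0%N).
  exists (size p); apply/asboolP.
  exists (fun i => if (i <= size p)%N then nth x (x :: p) i else c0 (i - size p)%N), 0%N.
  split=> // [i|i].
    case: (leqP i.+1 (size p)) => ip; last case: (leqP i (size p)) => ip'.
    - by rewrite ltnW//=; move/(pathP x) : px; exact.
    - have -> : i = size p by lia.
      rewrite -(last_nth x) lp (_ : (size p).+1 - size p = 1)%N; last by lia.
      by have [] := c0P 0%N.
    - rewrite (_ : i.+1 - size p = (i - size p).+1)%N; last by lia.
      by have [] := c0P (i - size p)%N.
  case: i => [|i]; last by rewrite ifF; [congr c0; lia|lia].
  by rewrite addn0 leqnn add0n -(last_nth x).
case: (ex_minnP exW) => n /asboolP[a [m [a0 step tail]]] minn.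
exists a => //; apply/h; split; last by exists m, n => i; rewrite tail.
move=> i; split=> // back.
have [ni|ni] := leqP n i.
  have [_ nb] := c0P (m + (i - n))%N; apply: nb.
  have e0 := tail (i - n)%N; have := tail (i - n).+2.
  by rewrite !addnS subnKC// -back -e0 subnKC.
pose a' j := if (j <= i)%N then a j else a j.+2.
have step' j : adj (a' j) (a' j.+1).
  rewrite /a'; case: (leqP j i) => ji; last by rewrite ifF ?step//; lia.
  case: (leqP j.+1 i) => ji'; first exact: step.
  have -> : j = i by lia.
  by rewrite back.
have a'0 : a' 0%N = x by [].
have [i2|i2] := leqP i.+2 n.
  have : W (n - 2)%N.
    apply/asboolP; exists a', m; split=> // j; rewrite /a'.
    case: leqP => ji; last by rewrite -tail; congr a; lia.
    by rewrite (_ : n - 2 + j = i)%N ?back -?tail; [congr a|]; lia.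
  by move/minn; lia.
have : W i.
  apply/asboolP; exists a', m.+1; split=> // j; rewrite /a' addSnnS -tail.
  case: leqP => ji; last by congr a; lia.
  by rewrite (_ : i + j = i)%N ?back; [congr a|]; lia.
by move/minn; lia.
Qed.

Lemma ray_omega x : omega (ray omega x) /\ ray omega x 0%N = x.
Proof.
have [c oc c0] := omega_exists x.
by apply: (@xgetPex _ _ [set c | omega c /\ c 0%N = x]); exists c.
Qed.

Definition parent x := ray omega x 1%N.

Lemma ray_iter x i : ray omega x i = iter i parent x.
Proof.
elim: i x => [|i ih] x; first by have [] := ray_omega x.
have [ox _] := ray_omega x; have [op p0] := ray_omega (parent x).
by rewrite iterSr -ih; apply: (omega_uniq (omega_shift ox) op); rewrite p0.
Qed.

Lemma ray_setE x : ray_set omega x = range (fun i => iter i parent x).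
Proof. by congr image; apply/funext => i; rewrite ray_iter. Qed.

Lemma parent_chain x : chain adj (fun i => iter i parent x).
Proof.
have [/omega_chain h _] := ray_omega x => i.
by have := h i; rewrite !ray_iter.
Qed.

Lemma adj_parent x : adj x (parent x).
Proof. by have [] := parent_chain x 0%N. Qed.

(** If [y] is not the parent of [x], prepending [y] to the ray of [x] gives the
    ray of [y]. *)
Lemma adj_cases x y : adj x y -> y = parent x \/ parent y = x.
Proof.
move=> xy; have [->|/eqP ne] := eqVneq y (parent x); [by left|right].
pose b i := if i is j.+1 then iter j parent x else y.
have cb : chain adj b.
  move=> [|i]; last by have := parent_chain x i.
  by split=> //; rewrite /= adj_sym.
have [ox _] := ray_omega x.
have ob : omega b.
  apply: (omega_closed ox cb); exists 0%N, 1%N => i.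
  by rewrite add0n add1n ray_iter.
have [oy y0] := ray_omega y.
by rewrite /parent (omega_uniq oy ob).
Qed.

Lemma iter_parent_inj x m n : iter m parent x = iter n parent x -> m = n.
Proof.
wlog lt : m n / (m < n)%N => [wl e|e].
  by have [lt|lt|//] := ltngtP m n; [|symmetry]; exact: wl.
exfalso; apply: (@walk_open (n - m) (fun k => iter (m + k)%N parent x)).
- by rewrite subn_gt0.
- by move=> i _; rewrite addnS; have [] := parent_chain x (m + i)%N.
- by move=> i _; rewrite !addnS; have [] := parent_chain x (m + i)%N.
- by rewrite addn0 subnKC// ltnW.
Qed.

Lemma parent_confl x y : exists n m, iter n parent x = iter m parent y.
Proof.
have [ox _] := ray_omega x; have [oy _] := ray_omega y.
have [k [l /(_ 0%N)]] := omega_tail ox oy.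
by rewrite !addn0 !ray_iter => e; exists k, l.
Qed.

Lemma sectorE x : sector omega x = [set y | exists n, iter n parent y = x].
Proof.
apply/seteqP; split => y; rewrite /sector /= !ray_setE.
  by move=> /(_ x)[|n _ <-]; [exists 0%N|exists n].
by move=> [n <-] _ [i _ <-]; exists (i + n)%N => //; rewrite iterD.
Qed.

(** ** Children *)

Lemma children_exist x : exists k : 'I_q -> T,
  injective k /\ forall y, parent y = x <-> exists i, y = k i.
Proof.
have [_ _ _ _ card] := tree.
have finA : finite_set [set y | adj x y] by exists q.+1; exact: card.
pose s : seq T := finmap.enum_fset (fset_set [set y | adj x y]).
have smem y : (y \in s) = adj x y.
  by apply: etrans (in_fset_set finA y) _; exact: asboolb.
have us : uniq s by exact: finmap.fset_uniq.
have ss : size s = q.+1 := card_fset_set (card x).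
pose r := rem (parent x) s.
have sr : size r = q.
  by rewrite size_rem ?smem ?adj_parent// ss.
have rmem y : (y \in r) <-> parent y = x.
  rewrite mem_rem_uniq// inE smem; split => [/andP[ne xy]|yx].
    by have [e|//] := adj_cases xy; move: ne; rewrite e eqxx.
  rewrite -yx adj_sym adj_parent andbT; apply/eqP => e.
  by have := @iter_parent_inj y 0%N 2%N e.
exists (fun i => nth x r i); split.
  move=> i j /eqP; rewrite nth_uniq ?sr ?rem_uniq// => /eqP; exact: val_inj.
move=> y; split => [/rmem yr|[i ->]]; last by apply/rmem/mem_nth; rewrite sr.
have iy : (index y r < q)%N by rewrite -sr index_mem.
by exists (Ordinal iy); rewrite /= nth_index.
Qed.

Definition child x : 'I_q -> T := sval (cid (children_exist x)).

Lemma child_inj x : injective (child x).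
Proof. by have [] := svalP (cid (children_exist x)). Qed.

Lemma childP x y : parent y = x <-> exists i, y = child x i.
Proof. by have [_] := svalP (cid (children_exist x)). Qed.

Lemma neighbour_sum (V : nmodType) x (f : T -> V) :
  \sum_(y \in [set y | adj x y]) f y = f (parent x) + \sum_i f (child x i).
Proof.
pose s := parent x :: [seq child x i | i <- enum 'I_q].
have us : uniq s.
  rewrite /= map_inj_uniq ?enum_uniq ?andbT//; last exact: child_inj.
  apply/mapP => -[i _ e].
  have /childP e2 : exists i, parent x = child x i by exists i.
  by have := @iter_parent_inj x 2%N 0%N e2.
rewrite (_ : [set y | adj x y] = [set` s]).
  by rewrite -fsbig_seq// big_cons big_map big_enum.
apply/seteqP; split => y /=; rewrite inE.
  move=> /adj_cases[->|/childP[i ->]]; first by rewrite eqxx.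
  by apply/orP; right; apply/mapP; exists i => //; rewrite mem_enum.
move=> /orP[/eqP->|/mapP[i _ ->]]; first exact: adj_parent.
have /childP {1}<- : exists j, child x i = child x j by exists i.
by rewrite adj_sym adj_parent.
Qed.

(** ** Distances and horocycles *)

(** Each edge of a path goes one step up or one step down, so the number of steps
    from the end points to a common ancestor is at most the length of the path;
    hence rays are geodesics. *)
Lemma path_confl x p : path adj x p -> exists a b : nat,
  iter a parent x = iter b parent (last x p) /\ (a + b <= size p)%N.
Proof.
elim: p x => [|y p ih] x /=; first by exists 0%N, 0%N.
move=> /andP[xy /ih[a [b [e ab]]]].
have [yx|yx] := adj_cases xy.
  by exists a.+1, b; rewrite iterSr -yx; split=> //; lia.
case: a e ab => [|a] e ab; last by exists a, b; rewrite -yx -iterSr; split=> //; lia.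
by exists 0%N, b.+1; rewrite /= -e -yx /=; split=> //; lia.
Qed.

Lemma dist_iter x n : dist adj x (iter n parent x) = n.
Proof.
have len m : path_lengths adj x (iter n parent x) m -> (n <= m)%N.
  move=> [p [px lp <-]]; have [a [b [e ab]]] := path_confl px.
  move: e; rewrite lp -iterD => /iter_parent_inj; lia.
have lenn : path_lengths adj x (iter n parent x) n.
  exists (traject parent (parent x) n); split.
  - apply/(pathP x) => i; rewrite size_traject => iN.
    rewrite -trajectS nth_traject; last exact: ltnW.
    rewrite (set_nth_default (parent x)) ?size_traject// nth_traject//.
    by rewrite -iterSr; exact: adj_parent.
  - by rewrite last_traject.
  - exact: size_traject.
apply: xget_unique => // m [/len nm /(_ _ lenn) mn].
by apply/eqP; rewrite eqn_leq mn nm.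
Qed.

(** The first common vertex of the two rays is their meeting point. *)
Lemma meet_spec x y : exists n m, [/\ iter n parent x = iter m parent y,
  dist adj x (meet_pt omega x y) = n & dist adj y (meet_pt omega x y) = m].
Proof.
have exn : exists n, `[< exists m, iter n parent x = iter m parent y >].
  by have [n [m e]] := parent_confl x y; exists n; apply/asboolP; exists m.
case: (ex_minnP exn) => n /asboolP[m e] minn.
suff -> : meet_pt omega x y = iter n parent x.
  by exists n, m; rewrite dist_iter {2}e dist_iter.
apply: xget_unique => /=.
  rewrite !ray_setE; apply/seteqP; split => [_ [[i _ <-] [j _ ij]]|_ [i _ <-]].
    have ni : (n <= i)%N by apply: minn; apply/asboolP; exists j.
    by exists (i - n)%N => //; rewrite -iterD subnK.
  split; first by exists (i + n)%N => //; rewrite iterD.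
  by exists (i + m)%N => //; rewrite iterD e.
move=> z; rewrite !ray_setE => ez.
have zin : [set iter i parent z | i in setT] (iter n parent x).
  by rewrite -ez; split; [exists n|exists m].
have [i _ iz] := zin.
have [[j _ jz] [k _ kz]] : ([set iter i parent x | i in setT] `&`
    [set iter i parent y | i in setT]) z by rewrite ez; exists 0%N.
have nj : (n <= j)%N by apply: minn; apply/asboolP; exists k; rewrite jz kz.
have : (i + j)%N = n by apply: (@iter_parent_inj x); rewrite iterD jz.
by move=> ijn; rewrite -jz; congr (iter _ _ _); lia.
Qed.

Context (o : T).

(** The horocyclic index relative to the horocycle of [o], read off from any
    common ancestor of [x] and [o]. *)
Definition height x : int :=
  let nm := cid (parent_confl x o) in (sval nm)%:Z - (sval (cid (svalP nm)))%:Z.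

Lemma heightP x : exists n m, iter n parent x = iter m parent o /\
  height x = n%:Z - m%:Z.
Proof.
rewrite /height; case: cid => n /= ex; case: cid => m /= e.
by exists n, m.
Qed.

(** Any common ancestor gives the same difference of heights, because a ray
    does not return to a vertex. *)
Lemma height_rel x y n m : iter n parent x = iter m parent y ->
  height x - n%:Z = height y - m%:Z.
Proof.
move=> e; have [a [b [ab ->]]] := heightP x; have [c [d [cd ->]]] := heightP y.
have : iter (m + a + d) parent o = iter (n + c + b) parent o.
  rewrite [LHS]iterD -cd -iterD.
  rewrite (_ : m + a + c = (a + c) + m)%N; last by lia.
  rewrite iterD -e -iterD (_ : a + c + n = (n + c) + a)%N; last by lia.
  by rewrite iterD ab -iterD.
by move=> /iter_parent_inj; lia.
Qed.

Lemma height_base : height o = 0.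
Proof.
have [n [m [/iter_parent_inj -> ->]]] := heightP o; exact: subrr.
Qed.

Lemma height_parent x : height (parent x) = height x - 1.
Proof.
have := @height_rel (parent x) x 0%N 1%N erefl; lia.
Qed.

Lemma same_horocycleE x : same_horocycle adj omega o x <-> height x = 0.
Proof.
rewrite /same_horocycle; have [n [m [/height_rel + -> ->]]] := meet_spec o x.
rewrite height_base; lia.
Qed.

Lemma horo_indexE x :
  horo_index adj omega [set y | same_horocycle adj omega o y] x = height x.
Proof.
have at_height y k : height y = 0 ->
    (dist adj x (meet_pt omega x y))%:Z = (dist adj y (meet_pt omega x y))%:Z + k <->
    k = height x.
  move=> y0; have [n [m [/height_rel + -> ->]]] := meet_spec x y.
  rewrite y0; lia.
apply: xget_unique.
  by exists o; [apply/same_horocycleE/height_base|apply/at_height => //; exact: height_base].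
by move=> k [y /same_horocycleE y0 /(at_height _ _ y0)].
Qed.

End TreeGeometry.

(** * Boundedness of the horocyclic Bergman projection *)

Section RootedTree.
Context (R : realType) {T : choiceType} (q : nat) (adj : rel T).
Context (omega : set (nat -> T)) (o : T) (q_gt1 : (1 < q)%N).
Context (tree : homogeneous_tree q adj) (bdry : boundary_point adj omega).
Local Notation parent := (parent omega).
Local Notation height := (height tree bdry o).

Definition height_scale x : R := q%:R `^ (- (height x)%:~R).

Lemma arity_real_gt0 : 0 < q%:R :> R.
Proof. by rewrite ltr0n (ltn_trans _ q_gt1). Qed.

Lemma height_scale_gt0 x : 0 < height_scale x.
Proof. exact/powR_gt0/arity_real_gt0. Qed.

Lemma height_scale_parent x : height_scale (parent x) = q%:R * height_scale x.
Proof.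
have q0 := arity_real_gt0.
rewrite /height_scale height_parent rmorphB/= opprB powRD ?(gt_eqF q0) ?implybT//.
by rewrite powRr1// ltW.
Qed.

Lemma child_parent x i : parent (child tree bdry x i) = x.
Proof. by apply/(childP tree bdry); exists i. Qed.

Lemma child_surj y : exists i, y = child tree bdry (parent y) i.
Proof. exact/(childP tree bdry). Qed.

Definition rooted_tree : horotree R T q :=
  HoroTree child_parent (@child_inj _ _ _ _ tree bdry) child_surj
    height_scale_gt0 height_scale_parent (parent_confl tree bdry) q_gt1.

Lemma rooted_harmonic f : harmonic_function q adj f <-> tree_harmonic rooted_tree f.
Proof.
split=> h x; rewrite {1}h; congr (_ * _); [|symmetry];
  exact: (neighbour_sum tree bdry).
Qed.

Lemma rooted_weight alpha :
  horo_weight q adj omega [set y | same_horocycle adj omega o y] alpha =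
  weight rooted_tree alpha.
Proof.
apply/funext => x; rewrite /horo_weight (horo_indexE tree bdry).
by rewrite /weight /= /height_scale -powRrM mulNr mulrC.
Qed.

Lemma rooted_sectors : sectors_and_points omega = tree_sectors_points rooted_tree.
Proof.
have E x : sector omega x = sec rooted_tree x := sectorE tree bdry x.
by apply/seteqP; split=> D [x Dx]; exists x; move: Dx; rewrite E.
Qed.

Lemma rooted_bergman alpha :
  bergman2 q adj (weight rooted_tree alpha) = tree_bergman rooted_tree alpha.
Proof. by apply/seteqP; split=> f [/rooted_harmonic]. Qed.

End RootedTree.

Theorem corollary25 (R : realType) (T : choiceType) (q : nat) (adj : rel T)
  (omega : set (nat -> T)) (H0 : set T) (alpha : R)
  (P : (T -> R[i]) -> T -> R[i]) :
  (2 <= q)%N ->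
  homogeneous_tree q adj ->
  boundary_point adj omega ->
  horocycle adj omega H0 ->
  1 < alpha ->
  let w := horo_weight q adj omega H0 alpha in
  let Ds := sectors_and_points omega in
  orthogonal_projection w (bergman2 q adj w) P ->
  [/\ weak_type11 w P,
      forall p : R, 1 < p -> extends_bounded w P (Lp w p) (Lp w p),
      extends_bounded w P (H1 w Ds) (Lp w 1)
    & extends_bounded w P Linfty (BMO w Ds)].
Proof.
move=> q2 tree bdry [base ->] alpha_gt1 w Ds.
rewrite /w /Ds (rooted_weight base q2 tree bdry) (rooted_sectors R base q2 tree bdry).
rewrite rooted_bergman => P_proj.
have two1 : 1 < 2 :> R by rewrite ltr1n.
split.
- exact: proj_weak P_proj.
- by move=> p p1; exact: proj_Lp P_proj _ p1.
- exists (berg (rooted_tree R base q2 tree bdry) alpha); first exact: berg_bounded_H1.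
  by move=> f _ f2; exact: proj_berg P_proj _ f2.
- exact: (proj_Linfty_BMO alpha_gt1 P_proj base).
Qed.
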